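(* Let $\mathfrak{o}$ be a compact discrete valuation ring (of arbitrary characteristic) with residue field of cardinality $q$. Let $(\mathsf{G},\mathfrak{g},\epsilon)$ be either $(\mathsf{GL}_3,\mathfrak{gl}_3,1)$ or $(\mathsf{GU}_3,\mathfrak{gu}_3,-1)$; if $\epsilon=-1$ suppose that $\mathfrak{o}$ has odd residue characteristic. For $\ell\in\mathbb{N}_0$ let $s_\ell(\mathfrak{g}(\mathfrak{o}))$ be the number of orbits of the adjoint (conjugation) action of $\mathsf{G}(\mathfrak{o})$ on $\mathfrak{g}(\mathfrak{o}_\ell)$. Then $$\zeta^{\mathrm{sc}}_{\mathfrak{g}(\mathfrak{o})}(s):=\sum_{\ell=0}^\infty s_\ell(\mathfrak{g}(\mathfrak{o}))\,q^{-\ell s}=\frac{1+\epsilon q^{2-2s}}{(1-q^{1-s})(1-q^{2-s})(1-q^{3-s})}.$$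
   Context: $\mathfrak{p}$ is the valuation ideal of $\mathfrak{o}$ and $\mathfrak{o}_\ell=\mathfrak{o}/\mathfrak{p}^\ell$. Let $\mathfrak{O}$ be the unramified quadratic extension of $\mathfrak{o}$ with valuation ideal $\mathfrak{P}$, $\mathfrak{O}_\ell=\mathfrak{O}/\mathfrak{P}^\ell$, and let $\circ$ be the non-trivial Galois automorphism of $\mathfrak{O}|\mathfrak{o}$ (and the induced map on $\mathfrak{O}_\ell$); put $A^\circ=(a_{ji}^\circ)_{ij}$ for $A=(a_{ij})$. Then $\mathsf{GU}_3(\mathfrak{o})=\{A\in\mathsf{GL}_3(\mathfrak{O})\mid A^\circ A=\mathrm{Id}_3\}$ and $\mathfrak{gu}_3(\mathfrak{o}_\ell)=\{A\in\mathfrak{gl}_3(\mathfrak{O}_\ell)\mid A^\circ+A=0\}$, where $\mathfrak{gl}_3$ denotes all $3\times3$ matrices. *)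

(* Defs.v *)
From HB Require Import structures.
From mathcomp Require Import all_boot all_order all_algebra.
From mathcomp Require Import generic_quotient ring_quotient.
From mathcomp Require Import complex finmap.
From mathcomp Require Import all_classical all_reals all_analysis.

Set Implicit Arguments.
Unset Strict Implicit.
Unset Printing Implicit Defensive.

Import Order.TTheory GRing.Theory Num.Theory.
Import numFieldNormedType.Exports.

Local Open Scope classical_set_scope.
Local Open Scope quotient_scope.
Local Open Scope ring_scope.

Section Ideals.
Variable A : comNzRingType.
Implicit Types I J S : set A.

Definition is_ideal I : Prop :=
  [/\ I 0, forall x y, I x -> I y -> I (x + y) & forall a x, I x -> I (a * x)].

(* Finite sums of products; for ideals this is the usual product, and
   [ideal_mul setT S] is the ideal generated by the set [S]. *)
Definition ideal_mul I J : set A :=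
  [set x | exists (n : nat) (a b : 'I_n -> A),
    (forall i, I (a i) /\ J (b i)) /\ x = \sum_(i < n) a i * b i].

Definition ideal_gen S : set A := ideal_mul setT S.

Fixpoint ideal_exp I (n : nat) : set A :=
  if n is m.+1 then ideal_mul I (ideal_exp I m) else setT.

Lemma ideal_mul_ideal I J : is_ideal J -> is_ideal (ideal_mul I J).
Proof.
move=> [J0 JD JM]; split.
- exists 0%N, (fun=> 0), (fun=> 0); split; first by case.
  by rewrite big_ord0.
- move=> _ _ [n [a [b [ab ->]]]] [m [c [d [cd ->]]]].
  exists (n + m)%N, (fun i => match fintype.split i with inl j => a j | inr j => c j end),
    (fun i => match fintype.split i with inl j => b j | inr j => d j end).
  split; first by move=> i; case: (fintype.split i).
  rewrite big_split_ord /=; congr (_ + _); apply: eq_bigr => i _.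
  + by have -> : fintype.split (lshift m i) = inl i by apply: (unsplitK (inl i)).
  + by have -> : fintype.split (rshift n i) = inr i by apply: (unsplitK (inr i)).
- move=> t _ [n [a [b [ab ->]]]]; exists n, a, (fun i => t * b i).
  split; first by move=> i; have [Ia Jb] := ab i; split=> //; exact: JM.
  by rewrite mulr_sumr; apply: eq_bigr => i _; rewrite mulrCA.
Qed.

Lemma ideal_exp_ideal I n : is_ideal (ideal_exp I n).
Proof. by elim: n => [|n IH] //=; exact: ideal_mul_ideal. Qed.

Lemma ideal_expS I n : ideal_exp I n.+1 `<=` ideal_exp I n.
Proof.
move=> _ [m [a [b [ab ->]]]]; have [J0 JD JM] := ideal_exp_ideal I n.
elim/big_ind: _ => // i _; apply: JM; exact: (ab i).2.
Qed.

Lemma ideal_exp_le I m n : (m <= n)%N -> ideal_exp I n `<=` ideal_exp I m.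
Proof.
move=> /subnK <-; elim: (n - m)%N => // k IH x /ideal_expS; exact: IH.
Qed.

End Ideals.

Definition val_ideal (A : idomainType) : set A := [set x | x \isn't a GRing.unit].
Arguments val_ideal : clear implicits.

(* A local principal ideal domain that is not a field; [val_ideal A] is then
   its maximal ideal. *)
Record is_dvr (A : idomainType) : Prop := IsDvr {
  dvr_principal : forall I : set A, is_ideal I ->
    exists a, I = [set a * x | x in [set: A]];
  dvr_local : is_ideal (val_ideal A);
  dvr_not_field : exists2 x, val_ideal A x & x != 0 }.

(* The ring [A] with its valuation topology, in which the powers of the
   valuation ideal are a basis of neighbourhoods of 0. *)
Definition adic (A : idomainType) : Type := A.

Section AdicTopology.
Variable A : idomainType.

Definition adic_open : set_system (adic A) :=
  [set U | forall x : A, U x ->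
    exists l, forall y : A, ideal_exp (val_ideal A) l (y - x) -> U y].

Let adic_openT : adic_open setT.
Proof. by move=> x _; exists 0%N. Qed.

Let adic_openI : setI_closed adic_open.
Proof.
move=> U V oU oV x [/oU[l Ul] /oV[m Vm]]; exists (maxn l m) => y yx.
split; [apply: Ul | apply: Vm]; apply: ideal_exp_le yx;
  by rewrite ?leq_maxl ?leq_maxr.
Qed.

Let adic_open_bigU (I : Type) (f : I -> set (adic A)) :
  (forall i, adic_open (f i)) -> adic_open (\bigcup_i f i).
Proof.
move=> of_ x [i _ /(of_ i)[l fl]]; exists l => y yx; exists i => //.
exact: fl.
Qed.

HB.instance Definition _ := Choice.on (adic A).
HB.instance Definition _ :=
  isOpenTopological.Build (adic A) adic_openT adic_openI adic_open_bigU.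

End AdicTopology.

Definition is_compact_dvr (A : idomainType) : Prop :=
  is_dvr A /\ compact [set: adic A].

Section Truncation.
Variables (A : idomainType) (l : nat).

Definition val_pow : {pred A} := fun x => `[< ideal_exp (val_ideal A) l x >].

Let val_pow_zmod : zmod_closed val_pow.
Proof.
have [J0 JD JM] := ideal_exp_ideal (val_ideal A) l.
split; first exact/asboolP.
move=> x y /asboolP Jx /asboolP Jy; apply/asboolP; apply: JD => //.
by rewrite -mulN1r; exact: JM.
Qed.

HB.instance Definition _ := GRing.isZmodClosed.Build A val_pow val_pow_zmod.

Let val_powM a x : x \in val_pow -> a * x \in val_pow.
Proof.
have [_ _ JM] := ideal_exp_ideal (val_ideal A) l.
by move=> /asboolP Jx; apply/asboolP; exact: JM.
Qed.

(* The quotient of [A] by the [l]-th power of its valuation ideal.  The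
   library makes [{ideal_quot _}] a ring for proper ideals only, which excludes
   [l = 0]; the ring structure is therefore put on the additive quotient. *)
Definition trunc : Type := Quotient.quot val_pow.

HB.instance Definition _ := GRing.Zmodule.on trunc.

Definition trunc_pi (x : A) : trunc := \pi_(Quotient.quot val_pow) x.

Definition trunc_one : trunc := trunc_pi 1.
Definition trunc_mul (x y : trunc) : trunc :=
  trunc_pi (repr (x : Quotient.quot val_pow) * repr (y : Quotient.quot val_pow)).

Let trunc_piP x y : reflect (trunc_pi x = trunc_pi y) (x - y \in val_pow).
Proof. by rewrite Quotient.idealrBE; exact: eqP. Qed.

Let trunc_surj (x : trunc) : exists y, x = trunc_pi y.
Proof. by exists (repr (x : Quotient.quot val_pow)); rewrite /trunc_pi reprK. Qed.

Let trunc_repr x :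
  repr (trunc_pi x : Quotient.quot val_pow) - x \in val_pow.
Proof. by apply/trunc_piP; rewrite /trunc_pi reprK. Qed.

Let trunc_piB : zmod_morphism trunc_pi.
Proof. by move=> x y; rewrite /trunc_pi !piE. Qed.

Let trunc_piM x y : trunc_pi (x * y) = trunc_mul (trunc_pi x) (trunc_pi y).
Proof.
apply/esym/trunc_piP; set a := repr _; set b := repr _.
have -> : a * b - x * y = b * (a - x) + x * (b - y).
  by rewrite !mulrBr addrA [b * x]mulrC subrK [b * a]mulrC.
by rewrite rpredD // val_powM // trunc_repr.
Qed.

Let trunc_piD x y : trunc_pi (x + y) = trunc_pi x + trunc_pi y.
Proof. by rewrite /trunc_pi !piE. Qed.

Let trunc_mulA : associative trunc_mul.
Proof.
move=> x y z; have [[a ->] [b ->] [c ->]] :=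
  And3 (trunc_surj x) (trunc_surj y) (trunc_surj z).
by rewrite -!trunc_piM mulrA.
Qed.

Let trunc_mulC : commutative trunc_mul.
Proof.
move=> x y; have [[a ->] [b ->]] := conj (trunc_surj x) (trunc_surj y).
by rewrite -!trunc_piM mulrC.
Qed.

Let trunc_mul1 : left_id trunc_one trunc_mul.
Proof. by move=> x; have [a ->] := trunc_surj x; rewrite -trunc_piM mul1r. Qed.

Let trunc_mulD : left_distributive trunc_mul +%R.
Proof.
move=> x y z; have [[a ->] [b ->] [c ->]] :=
  And3 (trunc_surj x) (trunc_surj y) (trunc_surj z).
by rewrite -trunc_piD -!trunc_piM mulrDl trunc_piD.
Qed.

HB.instance Definition _ := GRing.Zmodule_isComPzRing.Build trunc
  trunc_mulA trunc_mulC trunc_mul1 trunc_mulD.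

HB.instance Definition _ :=
  GRing.isZmodMorphism.Build A trunc trunc_pi trunc_piB.
Let trunc_pi_monoid : monoid_morphism trunc_pi.
Proof. by split=> // x y; exact: trunc_piM. Qed.
HB.instance Definition _ :=
  GRing.isMonoidMorphism.Build A trunc trunc_pi trunc_pi_monoid.

(* The map induced by [f] on the quotient, meaningful when [f] preserves the
   valuation ideal. *)
Definition trunc_map (f : A -> A) (x : trunc) : trunc :=
  trunc_pi (f (repr (x : Quotient.quot val_pow))).

End Truncation.

(* [[pchar _]] asks for a ring that is nontrivial by instance inference, which
   [trunc A 1] is not; its definition is therefore written out. *)
Definition odd_residue_char (A : idomainType) : Prop :=
  exists r : nat, [/\ prime r, r%:R = 0 :> trunc A 1 & odd r].

(* Meant for [o] with finite residue field: the residue extension is then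
   automatically separable, so that "unramified" only says that the valuation
   ideal of [o] generates that of [O]. *)
Record unramified_quadratic (o O : idomainType) (iota : {rmorphism o -> O}) :
    Prop := UnramifiedQuadratic {
  unram_dvr : is_dvr O;
  unram_free2 : exists b0 b1 : O, forall x : O,
    exists! c : o * o, x = iota c.1 * b0 + iota c.2 * b1;
  unram_ideal : val_ideal O = ideal_gen (iota @` val_ideal o) }.

Definition nontrivial_galois (o O : idomainType) (iota : {rmorphism o -> O})
    (sigma : {rmorphism O -> O}) : Prop :=
  [/\ bijective sigma, forall x, sigma (iota x) = iota x
    & exists x, sigma x != x].

Definition star (T : Type) (n : nat) (f : T -> T) (X : 'M[T]_n) : 'M[T]_n :=
  map_mx f X^T.

Definition GL3 (A : idomainType) : set 'M[A]_3 := [set X | X \in unitmx].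
Definition gl3 (A : idomainType) (l : nat) : set 'M[trunc A l]_3 := setT.

Definition GU3 (O : idomainType) (sigma : O -> O) : set 'M[O]_3 :=
  [set X | X \in unitmx /\ star sigma X *m X = 1%:M].
Definition gu3 (O : idomainType) (sigma : O -> O) (l : nat) :
    set 'M[trunc O l]_3 :=
  [set X | star (trunc_map sigma) X + X = 0].

Section Orbits.
Variables (A : idomainType) (l : nat).

Definition adjoint (X : 'M[A]_3) (Y : 'M[trunc A l]_3) : 'M[trunc A l]_3 :=
  map_mx (@trunc_pi A l) X *m Y *m map_mx (@trunc_pi A l) (invmx X).

Definition adjoint_orbits (G : set 'M[A]_3) (g : set 'M[trunc A l]_3) :
    set (set 'M[trunc A l]_3) :=
  [set [set adjoint X Y | X in G] | Y in g].

Definition num_orbits (G : set 'M[A]_3) (g : set 'M[trunc A l]_3) : nat :=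
  #|` fset_set (adjoint_orbits G g)|%fset.

End Orbits.

Definition s_gl3 (o : idomainType) (l : nat) : nat :=
  num_orbits (@GL3 o) (@gl3 o l).

Definition s_gu3 (O : idomainType) (sigma : O -> O) (l : nat) : nat :=
  num_orbits (GU3 sigma) (@gu3 O sigma l).

Section Zeta.
Variable R : realType.
Local Open Scope complex_scope.

(* [q ^ z = exp (z log q)] for complex [z]. *)
Definition natpowC (q : nat) (z : R[i]) : R[i] :=
  let r := expR (complex.Re z * ln q%:R) in
  let t := complex.Im z * ln q%:R in
  (r * cos t) +i* (r * sin t).

(* [R[i]^o] is [R[i]] with the topology of its absolute value. *)
Definition zeta_term (a : nat -> nat) (q : nat) (s : R[i]) : nat -> R[i]^o :=
  fun l => (a l)%:R * natpowC q (- (l%:R * s)).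

Definition zeta_value (eps : R[i]) (q : nat) (s : R[i]) : R[i]^o :=
  (1 + eps * natpowC q (2 - 2 * s)) /
  ((1 - natpowC q (1 - s)) * (1 - natpowC q (2 - s)) * (1 - natpowC q (3 - s))).

End Zeta.

(* Main.v *)
(** Let p be a uniformizer. A matrix that is scalar modulo p is c + p Y, so these matrices
    contribute q s_(l-1) classes modulo p^l. Any other matrix is conjugate to c + X, where
    X e1 = e2, X e2 = d e1 + t e2 + k e3, X e3 = a e1. If one of a, d, k is a unit, the
    matrix is cyclic and is determined by its characteristic polynomial, which gives q^(3l)
    classes. Otherwise let m be the largest integer in [1, l] such that p^m divides a, d
    and k modulo p^l. One may take either a = p^m or, when m < l and t, a/p^m and d/p^m
    are nonunits, the transpose of such a form with t, d/p^m and k/p^m nonunits. In the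
    first case c modulo p^m, t modulo p^l and d/p^m, k/p^m modulo p^(l-m) are complete
    invariants: k is recovered from det X, which is well defined modulo p^(l+m) because
    the adjugate of X is divisible by p^m. This gives q^(3l-m) and q^(3l-m-3) classes.

    In the unitary case, multiplication by a unit eta with eta^sigma = - eta turns
    skew-Hermitian into Hermitian matrices. Hermitian matrices conjugate under GL_3 are
    conjugate under GU_3: this needs h = c^* c for Hermitian h, which is solved in the
    commutative ring o[h], and the surjectivity of reduction on GU_3, which follows from
    the Cayley transform. The classes that contain a Hermitian matrix are those with
    parameters in o that are stable under transposition; the forms with a = p^m and with
    t, d/p^m, k/p^m nonunits are exchanged with their transposes and drop out, whence the
    sign of epsilon. *)
Require Import Defs.
From mathcomp Require Import all_boot all_order all_algebra complex.
From mathcomp Require Import generic_quotient ring_quotient finmap.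
From mathcomp Require Import all_classical all_reals all_analysis.
From mathcomp Require Import ring lra zify.
Import Order.TTheory GRing.Theory Num.Theory.
Import numFieldNormedType.Exports.
Local Open Scope classical_set_scope.
Local Open Scope ring_scope.

Set Implicit Arguments.
Unset Strict Implicit.
Unset Printing Implicit Defensive.

(** Matrices stay over the domain, and [sim l] asks for X g = g Y modulo p^l with g invertible over
    the domain. Only with such lifts does it make sense to know the determinant modulo p^(l+m):
    matrices over the quotient by p^l would lose the extra m digits. Exact conjugacies, whose
    invariants are equal, can also be mixed freely with congruences.

    The residue characteristic may be 2 or 3 for GL_3, so c cannot be split off as a third of the
    trace. It comes, modulo p^m, as the difference between the trace 3 c + t and the coefficient 2 c
    + t of the quadratic equation that the form satisfies modulo p^m.

    In the unitary case the obstacle to h = c^* c is that o[h] modulo p^l may be neither local nor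
    reduced. An induction on the index of an ideal treats nilpotents, zero divisors and fields at
    once.

    With t = q^-s, the factors 1 - q t, 1 - q^2 t and 1 - q^3 t reflect how the scalar classes, the
    sums over m and the cyclic classes grow from l to l+1. The term epsilon q^2 t^2 reflects that
    the sum of the q^(3l-m-3) is nonempty from l = 2 on, where it equals q^2. *)

Section Matrices3.
Variable E : comNzRingType.
Implicit Types A B X : 'M[E]_3.

Definition i0 : 'I_3 := @Ordinal 3 0 isT.
Definition i1 : 'I_3 := @Ordinal 3 1 isT.
Definition i2 : 'I_3 := @Ordinal 3 2 isT.

Lemma ord3E (i : 'I_3) : [\/ i = i0, i = i1 | i = i2].
Proof.
by case: i => [[|[|[|]]]] // Hi; [constructor 1|constructor 2|constructor 3]; exact: val_inj.
Qed.

Lemma sum3 (V : nmodType) (F : 'I_3 -> V) : \sum_i F i = F i0 + F i1 + F i2.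
Proof.
rewrite !big_ord_recl big_ord0 addr0 addrA; congr (F _ + F _ + F _); exact: val_inj.
Qed.

Definition mx3 (a b c d e f g h i : E) : 'M[E]_3 :=
  \matrix_(r, s) nth 0 (nth [::] [:: [:: a; b; c]; [:: d; e; f]; [:: g; h; i]] r) s.

Lemma mx3_eta A : A = mx3 (A i0 i0) (A i0 i1) (A i0 i2) (A i1 i0) (A i1 i1) (A i1 i2)
  (A i2 i0) (A i2 i1) (A i2 i2).
Proof.
by apply/matrixP => r s; rewrite mxE; case: (ord3E r) => ->; case: (ord3E s) => ->.
Qed.

Lemma mul_mx3 a b c d e f g h i a' b' c' d' e' f' g' h' i' :
  mx3 a b c d e f g h i *m mx3 a' b' c' d' e' f' g' h' i' =
  mx3 (a * a' + b * d' + c * g') (a * b' + b * e' + c * h') (a * c' + b * f' + c * i')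
      (d * a' + e * d' + f * g') (d * b' + e * e' + f * h') (d * c' + e * f' + f * i')
      (g * a' + h * d' + i * g') (g * b' + h * e' + i * h') (g * c' + h * f' + i * i').
Proof.
by apply/matrixP => r s; rewrite mxE sum3 !mxE; case: (ord3E r) => ->; case: (ord3E s) => ->.
Qed.

Lemma add_mx3 a b c d e f g h i a' b' c' d' e' f' g' h' i' :
  mx3 a b c d e f g h i + mx3 a' b' c' d' e' f' g' h' i' =
  mx3 (a + a') (b + b') (c + c') (d + d') (e + e') (f + f') (g + g') (h + h') (i + i').
Proof.
by apply/matrixP => r s; rewrite !mxE; case: (ord3E r) => ->; case: (ord3E s) => ->.
Qed.

Lemma scale_mx3 k a b c d e f g h i :
  k *: mx3 a b c d e f g h i =
  mx3 (k * a) (k * b) (k * c) (k * d) (k * e) (k * f) (k * g) (k * h) (k * i).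
Proof.
by apply/matrixP => r s; rewrite !mxE; case: (ord3E r) => ->; case: (ord3E s) => ->.
Qed.

Lemma scalar_mx3 k : k%:M = mx3 k 0 0 0 k 0 0 0 k.
Proof.
by apply/matrixP => r s; rewrite !mxE; case: (ord3E r) => ->; case: (ord3E s) => ->.
Qed.

Lemma tr_mx3 a b c d e f g h i : (mx3 a b c d e f g h i)^T = mx3 a d g b e h c f i.
Proof.
by apply/matrixP => r s; rewrite !mxE; case: (ord3E r) => ->; case: (ord3E s) => ->.
Qed.

Lemma det3 A : \det A =
  A i0 i0 * (A i1 i1 * A i2 i2 - A i1 i2 * A i2 i1)
  - A i0 i1 * (A i1 i0 * A i2 i2 - A i1 i2 * A i2 i0)
  + A i0 i2 * (A i1 i0 * A i2 i1 - A i1 i1 * A i2 i0).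
Proof.
have L (B : 'M[E]_2) : \det B = B 0 0 * B 1 1 - B 0 1 * B 1 0.
  rewrite (expand_det_row _ 0) !big_ord_recl big_ord0 /cofactor !det_mx11 !mxE /=.
  have -> : lift 0 0 = 1 :> 'I_2 by exact: val_inj.
  have -> : lift 1 0 = 0 :> 'I_2 by exact: val_inj.
  by rewrite !expr0 expr1 /=; ring.
rewrite (expand_det_row _ i0) sum3 /cofactor !L ?mxE //=.
have l00 : lift i0 0 = i1 by apply: val_inj.
have l01 : lift i0 1 = i2 by apply: val_inj.
have l10 : lift i1 0 = i0 by apply: val_inj.
have l11 : lift i1 1 = i2 by apply: val_inj.
have l20 : lift i2 0 = i0 by apply: val_inj.
have l21 : lift i2 1 = i1 by apply: val_inj.
rewrite l00 l01 l10 l11 l20 l21; ring.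
Qed.

Lemma mx3E a b c d e f g h i :
  (mx3 a b c d e f g h i i0 i0 = a) * (mx3 a b c d e f g h i i0 i1 = b) *
  (mx3 a b c d e f g h i i0 i2 = c) * (mx3 a b c d e f g h i i1 i0 = d) *
  (mx3 a b c d e f g h i i1 i1 = e) * (mx3 a b c d e f g h i i1 i2 = f) *
  (mx3 a b c d e f g h i i2 i0 = g) * (mx3 a b c d e f g h i i2 i1 = h) *
  (mx3 a b c d e f g h i i2 i2 = i).
Proof. by rewrite !mxE. Qed.

Lemma det_mx3 a b c d e f g h i :
  \det (mx3 a b c d e f g h i) =
  a * (e * i - f * h) - b * (d * i - f * g) + c * (d * h - e * g).
Proof. by rewrite det3 !mx3E. Qed.

End Matrices3.

(** * Congruences and similarity *)

Record uniformizer (E : idomainType) (p : E) : Prop := Uniformizer {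
  uniformizer_neq0 : p != 0;
  uniformizer_nunit : p \isn't a GRing.unit;
  uniformizer_dvd : forall x, x \isn't a GRing.unit -> exists y, x = p * y }.

Section Congruence.
Variables (E : idomainType) (p : E).
Implicit Types (x y z : E) (X Y Z g h : 'M[E]_3) (k l m : nat).

Definition cong k x y := exists z, x - y = p ^+ k * z.
Definition mcong k X Y := exists Z, X - Y = p ^+ k *: Z.

Lemma cong_refl k x : cong k x x.
Proof. by exists 0; rewrite subrr mulr0. Qed.

Lemma cong_sym k x y : cong k x y -> cong k y x.
Proof. by move=> [z e]; exists (- z); rewrite mulrN -e opprB. Qed.

Lemma cong_trans k y x z : cong k x y -> cong k y z -> cong k x z.
Proof. by move=> [a e] [b f]; exists (a + b); rewrite mulrDr -e -f; ring. Qed.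

Lemma congD k x y x' y' : cong k x y -> cong k x' y' -> cong k (x + x') (y + y').
Proof. by move=> [a e] [b f]; exists (a + b); rewrite mulrDr -e -f; ring. Qed.

Lemma congN k x y : cong k x y -> cong k (- x) (- y).
Proof. by move=> [z e]; exists (- z); rewrite mulrN -e; ring. Qed.

Lemma congB k x y x' y' : cong k x y -> cong k x' y' -> cong k (x - x') (y - y').
Proof. by move=> xy xy'; apply: congD => //; exact: congN. Qed.

Lemma congM k x y x' y' : cong k x y -> cong k x' y' -> cong k (x * x') (y * y').
Proof.
move=> [a e] [b f]; exists (a * x' + y * b).
by have -> : p ^+ k * (a * x' + y * b) = (p ^+ k * a) * x' + y * (p ^+ k * b);
  [ring | rewrite -e -f; ring].
Qed.

Lemma cong0P k x : cong k x 0 <-> exists z, x = p ^+ k * z.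
Proof. by split=> -[z e]; exists z; move: e; rewrite subr0. Qed.

Lemma cong_le k l x y : (k <= l)%N -> cong l x y -> cong k x y.
Proof.
by move=> kl [z e]; exists (p ^+ (l - k) * z); rewrite mulrA -exprD subnKC.
Qed.

Lemma cong_expl k l x : (k <= l)%N -> cong k (p ^+ l * x) 0.
Proof.
by move=> kl; apply/cong0P; exists (p ^+ (l - k) * x); rewrite mulrA -exprD subnKC.
Qed.

Lemma cong_mulp k l x y : cong k x y -> cong (l + k) (p ^+ l * x) (p ^+ l * y).
Proof. by move=> [z e]; exists z; rewrite -mulrBr e exprD mulrA. Qed.

Lemma mcongP k X Y : mcong k X Y <-> forall i j, cong k (X i j) (Y i j).
Proof.
split=> [[Z e] i j|h].
  by exists (Z i j); move/matrixP: e => /(_ i j); rewrite !mxE.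
have /choice[f fP] (i : 'I_3 * 'I_3) : exists z, X i.1 i.2 - Y i.1 i.2 = p ^+ k * z.
  exact: h.
exists (\matrix_(i, j) f (i, j)); apply/matrixP => i j; rewrite !mxE.
exact: (fP (i, j)).
Qed.

Lemma mcong_refl k X : mcong k X X.
Proof. by exists 0; rewrite subrr scaler0. Qed.

Lemma mcong_sym k X Y : mcong k X Y -> mcong k Y X.
Proof. by move=> [z e]; exists (- z); rewrite scalerN -e opprB. Qed.

Lemma mcong_trans k Y X Z : mcong k X Y -> mcong k Y Z -> mcong k X Z.
Proof. by move=> [a e] [b f]; exists (a + b); rewrite scalerDr -e -f addrA subrK. Qed.

Lemma mcongD k X Y X' Y' : mcong k X Y -> mcong k X' Y' -> mcong k (X + X') (Y + Y').
Proof.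
by move=> [a e] [b f]; exists (a + b); rewrite scalerDr -e -f opprD addrACA.
Qed.

Lemma mcongN k X Y : mcong k X Y -> mcong k (- X) (- Y).
Proof. by move=> [z e]; exists (- z); rewrite scalerN -e opprB opprK addrC. Qed.

Lemma mcongMl k X Y Z : mcong k X Y -> mcong k (Z *m X) (Z *m Y).
Proof. by move=> [z e]; exists (Z *m z); rewrite -mulmxBr e scalemxAr. Qed.

Lemma mcongMr k X Y Z : mcong k X Y -> mcong k (X *m Z) (Y *m Z).
Proof. by move=> [z e]; exists (z *m Z); rewrite -mulmxBl e scalemxAl. Qed.

Lemma mcongZ k a X Y : mcong k X Y -> mcong k (a *: X) (a *: Y).
Proof. by move=> [z e]; exists (a *: z); rewrite -scalerBr e !scalerA mulrC. Qed.

Lemma mcong_le k l X Y : (k <= l)%N -> mcong l X Y -> mcong k X Y.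
Proof.
by move=> kl [z e]; exists (p ^+ (l - k) *: z); rewrite scalerA -exprD subnKC.
Qed.

Lemma mcong_tr k X Y : mcong k X Y -> mcong k X^T Y^T.
Proof. by move=> [z e]; exists z^T; rewrite -raddfB /= e linearZ. Qed.

Lemma mcong0 X Y : mcong 0 X Y.
Proof. by exists (X - Y); rewrite expr0 scale1r. Qed.

Lemma mcong_mx3 k (a b c d e f g h i a' b' c' d' e' f' g' h' i' : E) :
  cong k a a' -> cong k b b' -> cong k c c' -> cong k d d' -> cong k e e' ->
  cong k f f' -> cong k g g' -> cong k h h' -> cong k i i' ->
  mcong k (mx3 a b c d e f g h i) (mx3 a' b' c' d' e' f' g' h' i').
Proof.
move=> *; apply/mcongP => r s.
by case: (ord3E r) => ->; case: (ord3E s) => ->; rewrite !mx3E.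
Qed.

Lemma cong_det k X Y : mcong k X Y -> cong k (\det X) (\det Y).
Proof.
move=> /mcongP h; rewrite !det3.
by repeat (apply: congD || apply: congN || apply: congM); exact: h.
Qed.

Definition simx X Y := exists2 g, g \in unitmx & X *m g = g *m Y.
Definition sim k X Y := exists2 g, g \in unitmx & mcong k (X *m g) (g *m Y).

Lemma simx_sim k X Y : simx X Y -> sim k X Y.
Proof. by move=> [g gu e]; exists g => //; rewrite e; exact: mcong_refl. Qed.

Lemma mcong_sim k X Y : mcong k X Y -> sim k X Y.
Proof. by move=> h; exists 1%:M; [exact: unitmx1 | rewrite mulmx1 mul1mx]. Qed.

Lemma sim_refl k X : sim k X X.
Proof. exact/mcong_sim/mcong_refl. Qed.

Lemma sim_sym k X Y : sim k X Y -> sim k Y X.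
Proof.
move=> [g gu e]; exists (invmx g); first by rewrite unitmx_inv.
have := mcongMl (invmx g) (mcongMr (invmx g) e).
by rewrite !mulmxA mulVmx // mul1mx -!mulmxA mulmxV // mulmx1; exact: mcong_sym.
Qed.

Lemma sim_trans k Y X Z : sim k X Y -> sim k Y Z -> sim k X Z.
Proof.
move=> [g gu e] [h hu f]; exists (g *m h); first by rewrite unitmx_mul gu.
rewrite mulmxA; apply: (mcong_trans (mcongMr _ e)).
by rewrite -!mulmxA; exact: mcongMl.
Qed.

Lemma simx_sym X Y : simx X Y -> simx Y X.
Proof.
move=> [g gu e]; exists (invmx g); first by rewrite unitmx_inv.
have : invmx g *m (X *m g) *m invmx g = invmx g *m (g *m Y) *m invmx g by rewrite e.
by rewrite !mulmxA mulVmx // mul1mx -!mulmxA mulmxV // mulmx1.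
Qed.

Lemma simx_trans Y X Z : simx X Y -> simx Y Z -> simx X Z.
Proof.
move=> [g gu e] [h hu f]; exists (g *m h); first by rewrite unitmx_mul gu.
by rewrite mulmxA e -(mulmxA g Y) f mulmxA.
Qed.

Lemma sim_le k l X Y : (k <= l)%N -> sim l X Y -> sim k X Y.
Proof. by move=> kl [g gu e]; exists g => //; exact: mcong_le e. Qed.

(** Separates similarity into an exact conjugacy, which preserves invariants, and a congruence,
    under which polynomial expressions in the entries are controlled. *)
Lemma sim_exact k X Y : sim k X Y -> exists2 Y', simx Y' Y & mcong k X Y'.
Proof.
move=> [g gu e]; exists (g *m Y *m invmx g).
  by exists g => //; rewrite -(mulmxA (g *m Y)) mulVmx // mulmx1.
by have := mcongMr (invmx g) e; rewrite -mulmxA mulmxV // mulmx1.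
Qed.

Lemma simx_shift a X Y : simx X Y -> simx (a%:M + X) (a%:M + Y).
Proof.
by move=> [g gu e]; exists g => //; rewrite mulmxDl mulmxDr e scalar_mxC.
Qed.

Lemma sim_shift k a X Y : sim k (a%:M + X) (a%:M + Y) <-> sim k X Y.
Proof.
have H b U V : sim k U V -> sim k (b%:M + U) (b%:M + V).
  move=> [g gu e]; exists g => //; rewrite mulmxDl mulmxDr scalar_mxC.
  by apply: mcongD => //; exact: mcong_refl.
split=> [|]; last exact: H.
by move=> /(H (- a)); rewrite !addrA -raddfD /= addNr raddf0 !add0r.
Qed.

Lemma simx_tr X Y : simx X Y -> simx X^T Y^T.
Proof.
move=> /simx_sym[g gu e]; exists g^T; first by rewrite unitmx_tr.
by rewrite -!trmx_mul e.
Qed.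

Lemma sim_tr k X Y : sim k X Y -> sim k X^T Y^T.
Proof.
move=> /sim_sym[g gu e]; exists g^T; first by rewrite unitmx_tr.
by rewrite -!trmx_mul; apply/mcong_tr/mcong_sym.
Qed.

(** The sum of the principal 2 x 2 minors, that is, the linear coefficient of the characteristic
    polynomial. *)
Definition trace2 X : E :=
  X i0 i0 * X i1 i1 - X i0 i1 * X i1 i0 + (X i0 i0 * X i2 i2 - X i0 i2 * X i2 i0)
  + (X i1 i1 * X i2 i2 - X i1 i2 * X i2 i1).

Lemma char_poly3 X : char_poly X =
  'X^3 - (\tr X)%:P * 'X^2 + (trace2 X)%:P * 'X - (\det X)%:P.
Proof.
rewrite /char_poly det3 !mxE /= /trace2 /mxtrace sum3 det3.
by rewrite !(polyCD, polyCB, polyCM, polyCN) mulr1n !mulr0n; ring.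
Qed.

Lemma simx_char_poly X Y : simx X Y -> char_poly X = char_poly Y.
Proof.
move=> [g gu e]; rewrite /char_poly.
have gpu : \det (map_mx polyC g) \is a GRing.unit.
  by rewrite det_map_mx rmorph_unit // -unitmxE.
apply: (mulIr gpu); rewrite -det_mulmx [RHS]mulrC -det_mulmx; congr (\det _).
rewrite /char_poly_mx mulmxBl mulmxBr scalar_mxC; congr (_ - _).
by rewrite -!map_mxM e.
Qed.

Lemma simx_invariants X Y : simx X Y ->
  [/\ \tr X = \tr Y, trace2 X = trace2 Y & \det X = \det Y].
Proof.
move=> /simx_char_poly; rewrite !char_poly3 => /polyP h.
have := h 0%N; have := h 1%N; have := h 2.
rewrite !(coefE, coefCM) /= !mulr0 !mulr1 !addr0 !subr0 !sub0r !add0r.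
by move=> /oppr_inj -> -> /oppr_inj ->.
Qed.

Lemma sim_invariants k X Y : sim k X Y ->
  [/\ cong k (\tr X) (\tr Y), cong k (trace2 X) (trace2 Y)
    & cong k (\det X) (\det Y)].
Proof.
move=> /sim_exact[Z /simx_invariants[<- <- <-] h]; split; last exact: cong_det.
  move/mcongP: h => h; rewrite /mxtrace !sum3.
  by repeat (apply: congD || apply: congN || apply: congM); exact: h.
move/mcongP: h => h; rewrite /trace2.
by repeat (apply: congD || apply: congN || apply: congM); exact: h.
Qed.

End Congruence.

(** * Normal forms *)

Section NormalForm.
Variables (E : idomainType) (p : E).
Hypothesis pP : uniformizer p.
Implicit Types (x y z : E) (X Y Z : 'M[E]_3).
Local Notation cong := (cong p).
Local Notation mcong := (mcong p).
Local Notation sim := (sim p).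

Lemma nunitP x : reflect (exists y, x = p * y) (x \isn't a GRing.unit).
Proof.
apply: (iffP idP) => [|[y ->]]; first exact: (uniformizer_dvd pP).
by rewrite unitrM (negPf (uniformizer_nunit pP)).
Qed.

Lemma cong1P x : cong 1 x 0 <-> x \isn't a GRing.unit.
Proof.
by split=> [/cong0P[z e]|/nunitP[z e]]; [apply/nunitP|apply/cong0P]; exists z;
  rewrite e expr1.
Qed.

Lemma unit_cong k x y : (0 < k)%N -> cong k x y -> x \is a GRing.unit ->
  y \is a GRing.unit.
Proof.
move=> k0 /(cong_le k0) xy xu; apply: contraT => /cong1P/(cong_trans xy)/cong1P.
by rewrite xu.
Qed.

Lemma nunitD x y : x \isn't a GRing.unit -> y \isn't a GRing.unit ->
  x + y \isn't a GRing.unit.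
Proof.
by move=> /cong1P hx /cong1P hy; apply/cong1P; have := congD hx hy; rewrite addr0.
Qed.

Lemma nunitMl x y : x \isn't a GRing.unit -> x * y \isn't a GRing.unit.
Proof. by rewrite unitrM => /negPf->. Qed.

Lemma nunitMr x y : y \isn't a GRing.unit -> x * y \isn't a GRing.unit.
Proof. by rewrite mulrC; exact: nunitMl. Qed.

Lemma unitD_nunit x y : x \is a GRing.unit -> y \isn't a GRing.unit ->
  x + y \is a GRing.unit.
Proof.
move=> xu /cong1P yn; apply: (unit_cong (k := 1) _ _ xu) => //.
by rewrite -{1}[x]addr0; apply: congD; [exact: cong_refl | exact: cong_sym].
Qed.

Lemma nunit_exp k x : (0 < k)%N -> p ^+ k * x \isn't a GRing.unit.
Proof.
by case: k => // k _; rewrite exprS -mulrA nunitMl // (uniformizer_nunit pP).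
Qed.

Lemma expp_neq0 k : p ^+ k != 0.
Proof. by rewrite expf_neq0 // (uniformizer_neq0 pP). Qed.

Lemma cong_divp k l x y : cong (l + k) (p ^+ l * x) (p ^+ l * y) -> cong k x y.
Proof.
move=> [z]; rewrite -mulrBr exprD -mulrA => /(mulfI (expp_neq0 l)) e.
by exists z.
Qed.

Lemma unitmx_mcong k X Y : (0 < k)%N -> mcong k X Y -> X \in unitmx -> Y \in unitmx.
Proof. by rewrite !unitmxE => k0 /cong_det; exact: unit_cong. Qed.

(* X e1 = e2, X e2 = d e1 + t e2 + k e3, X e3 = a e1; the characteristic polynomial is
   x^3 - t x^2 - d x - a k. *)
Definition frob (t d k a : E) : 'M[E]_3 := mx3 0 d a 1 t 0 0 k 0.
Definition nform (c t d k a : E) : 'M[E]_3 := c%:M + frob t d k a.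

Lemma nformE c t d k a : nform c t d k a = mx3 c d a 1 (c + t) 0 0 k c.
Proof.
by rewrite /nform scalar_mx3 add_mx3; congr mx3; rewrite ?addr0 ?add0r.
Qed.

(** The columns of P are a basis f1, f2, f3 with X f1 = f2 and X f3 = a f1. Only X f2 is
    unconstrained; its coordinates are d, t, k. *)
Lemma simx_frob X P a : P \in unitmx ->
  (forall i, (X *m P) i i0 = P i i1) -> (forall i, (X *m P) i i2 = a * P i i0) ->
  exists t d k, simx X (frob t d k a).
Proof.
move=> Pu h1 h3; set M := invmx P *m (X *m P).
have MS i : M i i0 = (i == i1)%:R.
  rewrite /M mxE (eq_bigr (fun j => invmx P i j * P j i1)) => [|j _]; last by rewrite h1.
  by have := mulVmx Pu; move/matrixP => /(_ i i1); rewrite !mxE => ->.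
have MA i : M i i2 = a * (i == i0)%:R.
  rewrite /M mxE (eq_bigr (fun j => a * (invmx P i j * P j i0))) => [|j _]; last first.
    by rewrite h3 mulrCA.
  rewrite -mulr_sumr; congr (_ * _).
  by have := mulVmx Pu; move/matrixP => /(_ i i0); rewrite !mxE => ->.
exists (M i1 i1), (M i0 i1), (M i2 i1), P => //.
rewrite (_ : frob _ _ _ _ = M) ?mulKVmx // [RHS]mx3_eta !MS !MA.
by rewrite /frob; congr mx3; rewrite /= ?mulr1 ?mulr0.
Qed.

(** The basis is e_j, X e_j, e_k with k the third index; its determinant is X i j up to sign. *)
Lemma simx_col0 X (i j : 'I_3) : i != j -> X i j \is a GRing.unit ->
  exists a b c d e f, simx X (mx3 0 a b 1 c d 0 e f).
Proof.
move=> ij Xu.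
have [k [ki kj]] : exists k : 'I_3, k != i /\ k != j.
  by case: (ord3E i) ij => ->; case: (ord3E j) => -> // _;
    [exists i2|exists i1|exists i2|exists i0|exists i1|exists i0].
pose P : 'M[E]_3 := \matrix_(r, s)
  (if s == i0 then (r == j)%:R else if s == i1 then X r j else (r == k)%:R).
have detP : \det P = X i j \/ \det P = - X i j.
  rewrite det3 !mxE /=; case: (ord3E i) ij ki => ->; case: (ord3E j) kj => -> //;
  case: (ord3E k) => -> //= _ _ _; by [left; ring|right; ring].
have Pu : P \in unitmx by rewrite unitmxE; case: detP => ->; rewrite ?unitrN.
set M := invmx P *m (X *m P).
have MS r : M r i0 = (r == i1)%:R.
  rewrite /M mxE (eq_bigr (fun s => invmx P r s * P s i1)) => [|s _]; last first.
    rewrite mxE (bigD1 j) //= big1 ?addr0; last by move=> u /negPf uj; rewrite !mxE /= uj mulr0.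
    by rewrite !mxE /= eqxx mulr1.
  by have := mulVmx Pu; move/matrixP => /(_ r i1); rewrite !mxE => ->.
exists (M i0 i1), (M i0 i2), (M i1 i1), (M i1 i2), (M i2 i1), (M i2 i2), P => //.
by rewrite -[mx3 _ _ _ _ _ _ _ _ _](_ : M = _) ?mulKVmx // [LHS]mx3_eta !MS.
Qed.

Lemma simx_conj g h X : h *m g = 1%:M -> simx X (h *m X *m g).
Proof.
move=> hg; have [hu gu] := mulmx1_unit hg; exists g => //.
by rewrite !mulmxA (mulmx1C hg) mul1mx.
Qed.

Lemma nonscalar_nform X : ~ (exists c, mcong 1 X c%:M) ->
  exists c t d k a, simx X (nform c t d k a).
Proof.
move=> Xns; have [Y XY [i [j [ij Yu]]]] :
    exists2 Y, simx X Y & exists i j, i != j /\ Y i j \is a GRing.unit.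
  (* If no conjugate has an off-diagonal unit, conjugation by the transvections 1 + E_01 and 1 +
     E_02 turns differences of diagonal entries into off-diagonal entries, so X is scalar modulo
     p. *)
  apply: contrapT => H; apply: Xns.
  have N Y i j : simx X Y -> i != j -> Y i j \isn't a GRing.unit.
    by move=> XY ij; apply/negP => Yu; apply: H; exists Y => //; exists i, j.
  have X1 : simx X X by exists 1%:M; rewrite ?unitmx1 // mulmx1 mul1mx.
  have D1 : X i0 i0 - X i1 i1 \isn't a GRing.unit.
    have h : mx3 1 (-1) 0 0 1 0 0 0 1 *m mx3 1 1 0 0 1 0 0 0 1 = 1%:M :> 'M[E]_3.
      by rewrite mul_mx3 scalar_mx3; congr mx3; ring.
    have := N _ i0 i1 (simx_conj X h) isT.
    rewrite {1}[X]mx3_eta !mul_mx3 mx3E => {}h.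
    match type of h with is_true (?v \isn't a _) =>
      have -> : X i0 i0 - X i1 i1 = v + - X i0 i1 + X i1 i0 by ring end.
    by apply: nunitD; [apply: nunitD => //; rewrite unitrN|]; exact: N.
  have D2 : X i0 i0 - X i2 i2 \isn't a GRing.unit.
    have h : mx3 1 0 (-1) 0 1 0 0 0 1 *m mx3 1 0 1 0 1 0 0 0 1 = 1%:M :> 'M[E]_3.
      by rewrite mul_mx3 scalar_mx3; congr mx3; ring.
    have := N _ i0 i2 (simx_conj X h) isT.
    rewrite {1}[X]mx3_eta !mul_mx3 mx3E => {}h.
    match type of h with is_true (?v \isn't a _) =>
      have -> : X i0 i0 - X i2 i2 = v + - X i0 i2 + X i2 i0 by ring end.
    by apply: nunitD; [apply: nunitD => //; rewrite unitrN|]; exact: N.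
  exists (X i0 i0); rewrite [X]mx3_eta scalar_mx3 mx3E.
  apply: mcong_mx3; try exact: cong_refl; try (by apply/cong1P; rewrite N).
    by apply: cong_sym; move/cong1P: D1 => [z e]; exists z; rewrite -e subr0.
  by apply: cong_sym; move/cong1P: D2 => [z e]; exists z; rewrite -e subr0.
have [a [b [c [d [e [f Yf]]]]]] := simx_col0 ij Yu.
(* Subtracting the last diagonal entry f makes the image of e3 equal to b e1 + d e2; then e3 - d e1
   is sent to (b + d f) e1. *)
have [t [d' [k h]]] : exists t d' k,
    simx (mx3 (- f) a b 1 (c - f) d 0 e 0) (frob t d' k (b + d * f)).
  apply: (@simx_frob _ (mx3 1 (- f) (- d) 0 1 0 0 0 1)).
  - by rewrite unitmxE det_mx3 (_ : _ + _ = 1) ?unitr1 //; ring.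
  - by move=> r; rewrite mul_mx3; case: (ord3E r) => ->; rewrite !mx3E; ring.
  - by move=> r; rewrite mul_mx3; case: (ord3E r) => ->; rewrite !mx3E; ring.
exists f, t, d', k, (b + d * f); apply: (simx_trans XY); apply: (simx_trans Yf).
suff -> : mx3 0 a b 1 c d 0 e f = f%:M + mx3 (- f) a b 1 (c - f) d 0 e 0.
  exact: simx_shift.
by rewrite scalar_mx3 add_mx3; congr mx3; ring.
Qed.

Lemma simx_companion X P : P \in unitmx ->
  (forall i, (X *m P) i i0 = P i i1) -> (forall i, (X *m P) i i1 = P i i2) ->
  exists t d a, simx X (frob t d 1 a).
Proof.
move=> Pu h0 h1; set M := invmx P *m (X *m P).
have MS i : M i i0 = (i == i1)%:R.
  rewrite /M mxE (eq_bigr (fun j => invmx P i j * P j i1)) => [|j _]; last by rewrite h0.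
  by have := mulVmx Pu; move/matrixP => /(_ i i1); rewrite !mxE => ->.
have MT i : M i i1 = (i == i2)%:R.
  rewrite /M mxE (eq_bigr (fun j => invmx P i j * P j i2)) => [|j _]; last by rewrite h1.
  by have := mulVmx Pu; move/matrixP => /(_ i i2); rewrite !mxE => ->.
exists (M i2 i2), (M i1 i2), (M i0 i2).
apply: (@simx_trans _ M); first by exists P; rewrite ?mulKVmx.
(* M is a companion matrix; replacing e3 by e3 - t e2 - d e1 moves t and d from the third column to
   the second. *)
exists (mx3 1 0 (- M i1 i2) 0 1 (- M i2 i2) 0 0 1).
  by rewrite unitmxE det_mx3 (_ : _ + _ = 1) ?unitr1 //; ring.
by rewrite {1}[M]mx3_eta !MS !MT !mul_mx3 /=; congr mx3; ring.
Qed.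

(** A cyclic vector for the part without c is e1 if k is a unit, e3 if a is, and e1 + e3 if only d
    is: the determinant is then - d modulo p. Adding c keeps the matrix cyclic, so c is absorbed
    into the companion form. *)
Lemma nform_cyclic c t d k a :
  [|| k \is a GRing.unit, a \is a GRing.unit | d \is a GRing.unit] ->
  exists t' d' a', simx (nform c t d k a) (frob t' d' 1 a').
Proof.
move=> u; suff [t1 [d1 [a1 h]]] : exists t' d' a', simx (frob t d k a) (frob t' d' 1 a').
  have [t2 [d2 [a2 h']]] : exists t' d' a', simx (nform c t1 d1 1 a1) (frob t' d' 1 a').
    rewrite nformE; apply: (@simx_companion _ (mx3 1 c (c ^+ 2 + d1) 0 1 (2 * c + t1) 0 0 1)).
    - by rewrite unitmxE det_mx3 (_ : _ + _ = 1) ?unitr1 //; ring.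
    - by move=> r; rewrite mul_mx3; case: (ord3E r) => ->; rewrite !mx3E; ring.
    - by move=> r; rewrite mul_mx3; case: (ord3E r) => ->; rewrite !mx3E; ring.
  by exists t2, d2, a2; apply: simx_trans h'; exact: simx_shift.
have [ku|kn] := boolP (k \is a GRing.unit).
  apply: (@simx_companion _ (mx3 1 0 d 0 1 t 0 0 k)).
  - by rewrite unitmxE det_mx3 (_ : _ + _ = k) //; ring.
  - by move=> r; rewrite mul_mx3; case: (ord3E r) => ->; rewrite !mx3E; ring.
  - by move=> r; rewrite mul_mx3; case: (ord3E r) => ->; rewrite !mx3E; ring.
have [au|an] := boolP (a \is a GRing.unit).
  apply: (@simx_companion _ (mx3 0 a 0 0 0 a 1 0 0)).
  - by rewrite unitmxE det_mx3 (_ : _ + _ = a * a) ?unitrM ?au //; ring.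
  - by move=> r; rewrite mul_mx3; case: (ord3E r) => ->; rewrite !mx3E; ring.
  - by move=> r; rewrite mul_mx3; case: (ord3E r) => ->; rewrite !mx3E; ring.
have du : d \is a GRing.unit by move: u; rewrite (negPf kn) (negPf an).
apply: (@simx_companion _ (mx3 1 a d 0 1 (t + a) 1 0 k)).
- rewrite unitmxE det_mx3 (_ : _ + _ = - d + (k + a * (t + a))); last by ring.
  by rewrite unitD_nunit ?unitrN // nunitD // nunitMl.
- by move=> r; rewrite mul_mx3; case: (ord3E r) => ->; rewrite !mx3E; ring.
- by move=> r; rewrite mul_mx3; case: (ord3E r) => ->; rewrite !mx3E; ring.
Qed.

(** A normal form satisfies a monic quadratic equation modulo p^k exactly when p^k divides d, k and
    a. This makes the exponent m a similarity invariant. *)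
Definition quad k a b X := mcong k (X *m X) (a *: X + b%:M).

Lemma mcong_cancelr k g X Y : g \in unitmx -> mcong k (X *m g) (Y *m g) -> mcong k X Y.
Proof.
by move=> gu /(mcongMr (invmx g)); rewrite -!mulmxA mulmxV // !mulmx1.
Qed.

Lemma quad_sim k l a b X Y : (k <= l)%N -> sim l X Y -> quad k a b X -> quad k a b Y.
Proof.
move=> kl /(sim_le kl)/sim_sym[g gu e] q; apply: (mcong_cancelr gu).
rewrite -mulmxA; apply: (mcong_trans (mcongMl _ e)); rewrite mulmxA.
apply: (mcong_trans (mcongMr _ e)); rewrite -mulmxA.
apply: (mcong_trans (mcongMl _ q)).
rewrite mulmxDr mulmxDl -scalemxAr -scalemxAl scalar_mxC.
by apply: mcongD; [apply: mcongZ; exact: mcong_sym | exact: mcong_refl].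
Qed.

Lemma nform_quad j c t d k a : cong j d 0 -> cong j k 0 -> cong j a 0 ->
  quad j (2 * c + t) (- c ^+ 2 - c * t) (nform c t d k a).
Proof.
move=> /cong0P[d' ->] /cong0P[k' ->] /cong0P[a' ->].
rewrite /quad nformE mul_mx3 scale_mx3 scalar_mx3 add_mx3.
apply: mcong_mx3.
- by exists d'; ring.
- by exists (p ^+ j * a' * k'); ring.
- by exists (- t * a'); ring.
- by exists 0; ring.
- by exists d'; ring.
- by exists a'; ring.
- by exists k'; ring.
- by exists 0; ring.
- by exists 0; ring.
Qed.

Lemma quad_nform j c t d k a u v : quad j u v (nform c t d k a) ->
  [/\ cong j u (2 * c + t), cong j d 0, cong j k 0 & cong j a 0].
Proof.
rewrite /quad nformE mul_mx3 scale_mx3 scalar_mx3 add_mx3 => /mcongP h.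
have h10 := h i1 i0; have h20 := h i2 i0; have h00 := h i0 i0.
have h12 := h i1 i2; have h22 := h i2 i2; move: h10 h20 h00 h12 h22; rewrite !mx3E.
move=> [z10 e10] [z20 e20] [z00 e00] [z12 e12] [z22 e22].
split.
- by exists (- z10); rewrite mulrN -e10; ring.
- exists (z00 - z22 ); rewrite mulrBr -e00 -e22.
  have -> : d - 0 = (c * c + d * 1 + a * 0 - (u * c + v)) - (0 * a + k * 0 + c * c - (u * c + v)).
    by ring.
  by [].
- by exists z20; rewrite -e20; ring.
- by exists z12; rewrite -e12; ring.
Qed.

Definition aform (c : E) (m : nat) (t d k : E) : 'M[E]_3 :=
  nform c t (p ^+ m * d) (p ^+ m * k) (p ^+ m).

(** Extracts p^m from the new d and k after a change of basis without computing them. *)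
Lemma nform_divm m c X t d k a : simx X (nform c t d k a) ->
  (exists u v, quad m u v X) ->
  exists d' k', d = p ^+ m * d' /\ k = p ^+ m * k'.
Proof.
move=> h [u [v q]]; have := quad_sim (leqnn m) (simx_sim p m h) q.
by move=> /quad_nform[_ /cong0P[d' ->] /cong0P[k' ->] _]; exists d', k'.
Qed.

(* For w = r e3 + s (e2 - t e1) + p^m u e1 the vector v = X w / p^m is integral, and in the
   basis v, X v, w the matrix has the required form. The determinant of this basis is
   (a r + d s + u t) (a r^2 + d r s + t k s^2) modulo p. *)
Lemma nform_aform m c t d k a : (0 < m)%N ->
  [|| a \is a GRing.unit, d \is a GRing.unit |
      (t \is a GRing.unit) && (k \is a GRing.unit)] ->
  exists t' d' k', simx (nform c t (p ^+ m * d) (p ^+ m * k) (p ^+ m * a)) (aform c m t' d' k').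
Proof.
move=> m0 H.
have [r [s [u [h1 h2]]]] : exists r s u, (a * r + d * s + u * t \is a GRing.unit) /\
    (a * r ^+ 2 + d * r * s + t * k * s ^+ 2 \is a GRing.unit).
  have [au|an] := boolP (a \is a GRing.unit).
    exists 1, 0, 0; have -> : a * 1 + d * 0 + 0 * t = a by ring.
    by have -> : a * 1 ^+ 2 + d * 1 * 0 + t * k * 0 ^+ 2 = a by ring.
  have [tu|tn] := boolP (t \is a GRing.unit).
    have [ku|kn] := boolP (k \is a GRing.unit).
      (* Whenever t is a unit, u is solved from a r + d s + u t = 1, and r, s are left to make the
         second factor a unit. *)
      exists 0, 1, ((1 - d) / t).
      rewrite divrK // (_ : _ + _ = 1); last by ring.
      rewrite (_ : _ + _ = t * k); last by ring.
      by rewrite unitr1 unitrM tu ku.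
    have du : d \is a GRing.unit by move: H; rewrite (negPf an) (negPf kn) andbF orbF.
    exists 1, 1, ((1 - a - d) / t).
    rewrite divrK // (_ : _ + _ = 1); last by ring.
    rewrite (_ : _ + _ = d + (a + t * k)); last by ring.
    by rewrite unitr1 unitD_nunit // nunitD // nunitMr.
  have du : d \is a GRing.unit by move: H; rewrite (negPf an) (negPf tn) /= orbF.
  exists 1, 1, 0; rewrite (_ : a * _ + _ + _ = d + a); last by ring.
  rewrite (_ : a * _ + _ + _ = d + (a + t * k)); last by ring.
    split; first exact: unitD_nunit.
  by apply: unitD_nunit => //; apply: nunitD => //; exact: nunitMl.
pose pm := p ^+ m; pose A := a * r + d * s; pose K := k * s.
have [t' [d1 [k1 h]]] : exists t' d' k', simx (frob t (pm * d) (pm * k) (pm * a)) (frob t' d' k' pm).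
  apply: (@simx_frob _ (mx3 A (pm * (u * d + K * a)) (pm * u - s * t)
                            u (A + u * t) s
                            K (pm * (u * k)) r)).
  - pose W := - A * s * u * k - (u * d + K * a) * (u * r - s * K)
      + u * (u * pm * u * k - (A + u * t) * K) - s * t * u * u * k.
    rewrite unitmxE.
    have -> : \det (mx3 A (pm * (u * d + K * a)) (pm * u - s * t) u (A + u * t) s
                      K (pm * (u * k)) r) =
        (A + u * t) * (a * r ^+ 2 + d * r * s + t * k * s ^+ 2) + pm * W.
      by rewrite det_mx3 /W /A /K; ring.
    by rewrite unitD_nunit ?nunit_exp // unitrM h1 h2.
  - by move=> i; rewrite mul_mx3; case: (ord3E i) => ->; rewrite !mx3E /A /K; ring.
  - by move=> i; rewrite mul_mx3; case: (ord3E i) => ->; rewrite !mx3E /A /K; ring.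
have [|d' [k' [ed ek]]] := nform_divm (m := m) (simx_shift c h).
  exists (2 * c + t), (- c ^+ 2 - c * t); apply: nform_quad; rewrite -[p ^+ m * _]subr0;
    by eexists; rewrite !subr0.
by exists t', d', k'; move: (simx_shift c h); rewrite ed ek.
Qed.

(** Hence c matters only modulo p^m: Y = p^m x + X satisfies Y e3 = p^m (e1 + x e3), so e1 + x e3
    can take the place of e1 while e3 is kept. *)
Lemma aform_shift x c m t d k : exists t' d' k',
  simx (aform c m t d k) (aform (c - p ^+ m * x) m t' d' k').
Proof.
pose pm := p ^+ m.
have [t' [d1 [k1 h]]] : exists t' d' k',
    simx ((pm * x)%:M + frob t (pm * d) (pm * k) pm) (frob t' d' k' pm).
  apply: (@simx_frob _ (mx3 1 (2 * x * pm) 0 0 1 0 x (x ^+ 2 * pm + pm * k * 0) 1)).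
  - by rewrite unitmxE det_mx3 (_ : _ + _ = 1) ?unitr1 //; ring.
  - move=> i; rewrite scalar_mx3 add_mx3 mul_mx3.
    by case: (ord3E i) => ->; rewrite !mx3E; ring.
  - move=> i; rewrite scalar_mx3 add_mx3 mul_mx3.
    by case: (ord3E i) => ->; rewrite !mx3E; ring.
have {}h := simx_shift (c - pm * x) h.
rewrite addrA -raddfD /= subrK in h.
have [|d' [k' [ed ek]]] := nform_divm (m := m) h; last by exists t', d', k'; rewrite ed ek in h.
exists (2 * c + t), (- c ^+ 2 - c * t); apply: nform_quad; first by exists d; rewrite subr0.
  by exists k; rewrite subr0.
by exists 1; rewrite subr0 mulr1.
Qed.

(* The adjugate of the left-hand matrix is divisible by p^m, so its determinant is an
   invariant of the class modulo p^l to the higher precision p^(m + l). *)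
Lemma sim_det_precise l m t d k Y : (m <= l)%N ->
  sim l (frob t (p ^+ m * d) (p ^+ m * k) (p ^+ m)) Y ->
  cong (m + l) (p ^+ m * (p ^+ m * k)) (\det Y).
Proof.
move=> ml /sim_exact[Y' /simx_invariants[_ _ <-]] /mcong_sym[Z].
rewrite [Z]mx3_eta scale_mx3 => /(canRL (subrK _)) ->.
rewrite /frob add_mx3 det_mx3 -(subnKC ml) !exprD.
move: (Z i0 i0) (Z i0 i1) (Z i0 i2) (Z i1 i0) (Z i1 i1) (Z i1 i2) (Z i2 i0) (Z i2 i1)
  (Z i2 i2) => z00 z01 z02 z10 z11 z12 z20 z21 z22.
set pm := p ^+ m; set pj := p ^+ (l - m); set q := pm * pj.
(* The linear, quadratic and cubic terms in Z of the determinant, divided by p^(m+l). The linear one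
   is divisible because the cofactors carry p^m. *)
exists (- (k * z02 + pm * k * z10 - t * z20 + z21 - d * z22
  + pj * (- (pm * d) * (z10 * z22 - z12 * z20) + pm * (z10 * z21 - z11 * z20)
          - (z01 * z22 - z02 * z21) + t * (z00 * z22 - z02 * z20)
          - pm * k * (z00 * z12 - z02 * z10))
  + pj * q * (z00 * (z11 * z22 - z12 * z21) - z01 * (z10 * z22 - z12 * z20)
               + z02 * (z10 * z21 - z11 * z20)))).
by rewrite /q !exprD -/pm -/pj; ring.
Qed.

Lemma expp_cong0 m n : cong m (p ^+ n) 0 -> (m <= n)%N.
Proof.
move=> /cong0P[z e]; rewrite leqNgt; apply/negP => nm.
move: e; rewrite -(subnKC (ltnW nm)) exprD -mulrA -[LHS]mulr1.
move=> /(mulfI (expp_neq0 n)) e; have : 1 \is a @GRing.unit E := unitr1 _.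
by rewrite e (negPf (nunit_exp _ _)) // subn_gt0.
Qed.

Lemma cong_exp_unit m n x : x \is a GRing.unit -> cong m (p ^+ n * x) 0 -> (m <= n)%N.
Proof.
by move=> xu /(congM (cong_refl p m x^-1)); rewrite mulr0 mulrC mulrK //; exact: expp_cong0.
Qed.

Definition primitive3 (x y z : E) :=
  [|| x \is a GRing.unit, y \is a GRing.unit | z \is a GRing.unit].

(** By [quad] the level m and 2 c + t modulo p^m are invariants. Subtracting the latter from the
    trace 3 c + t leaves c. *)
Lemma nform_level l m n c t d k a c' t' d' k' a' :
  (m <= l)%N -> (n <= l)%N -> primitive3 d k a -> primitive3 d' k' a' ->
  sim l (nform c t (p ^+ m * d) (p ^+ m * k) (p ^+ m * a))
        (nform c' t' (p ^+ n * d') (p ^+ n * k') (p ^+ n * a')) ->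
  m = n /\ cong m c c'.
Proof.
move=> ml nl.
have H m' n' c1 t1 d1 k1 a1 c2 t2 d2 k2 a2 : (m' <= l)%N -> primitive3 d2 k2 a2 ->
   sim l (nform c1 t1 (p ^+ m' * d1) (p ^+ m' * k1) (p ^+ m' * a1))
        (nform c2 t2 (p ^+ n' * d2) (p ^+ n' * k2) (p ^+ n' * a2)) ->
   (m' <= n')%N /\ cong m' (2 * c1 + t1) (2 * c2 + t2).
  move=> ml' u S; have := quad_sim ml' S (nform_quad c1 t1 (cong_expl p d1 (leqnn _))
    (cong_expl p k1 (leqnn _)) (cong_expl p a1 (leqnn _))).
  move=> /quad_nform[e ed ek ea]; split => //.
  by case/or3P: u => u; [move: ed|move: ek|move: ea]; exact: cong_exp_unit.
move=> u u' S; have [mn e] := H _ _ _ _ _ _ _ _ _ _ _ _ ml u' S.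
have [nm _] := H _ _ _ _ _ _ _ _ _ _ _ _ nl u (sim_sym S).
have mn' : m = n by apply/eqP; rewrite eqn_leq mn.
split=> //; have [h _ _] := sim_invariants (sim_le ml S).
have := congB h e; rewrite !nformE /mxtrace !sum3 !mx3E.
rewrite (_ : _ - _ = c); last by ring.
by rewrite (_ : _ - _ = c'); last by ring.
Qed.

Lemma aformE c m t d k :
  aform c m t d k = nform c t (p ^+ m * d) (p ^+ m * k) (p ^+ m * 1).
Proof. by rewrite /aform mulr1. Qed.

Lemma primitive3_1 x y : primitive3 x y 1.
Proof. by rewrite /primitive3 unitr1 !orbT. Qed.

Lemma aform_level l m n c t d k c' t' d' k' : (m <= l)%N -> (n <= l)%N ->
  sim l (aform c m t d k) (aform c' n t' d' k') -> m = n /\ cong m c c'.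
Proof. by move=> ml nl; rewrite !aformE; apply: nform_level; rewrite ?primitive3_1. Qed.

Lemma tr_frob t d k a : \tr (frob t d k a) = t.
Proof. by rewrite /mxtrace sum3 !mx3E add0r addr0. Qed.

Lemma trace2_frob t d k a : trace2 (frob t d k a) = - d.
Proof. by rewrite /trace2 !mx3E; ring. Qed.

Lemma det_frob t d k a : \det (frob t d k a) = a * k.
Proof. by rewrite det_mx3; ring. Qed.

Definition frobE := (tr_frob, trace2_frob, det_frob).

(** The determinants agree modulo p^(m+l) and both carry p^(2m), which leaves k modulo p^(l-m). The
    general entry p^m a on the right serves the comparison with transposed forms. *)
Lemma frob_inj l m t d k a t' d' k' : (m <= l)%N ->
  sim l (frob t (p ^+ m * d) (p ^+ m * k) (p ^+ m))
        (frob t' (p ^+ m * d') (p ^+ m * k') (p ^+ m * a)) ->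
  [/\ cong l t t', cong (l - m) d d' & cong (l - m) k (a * k')].
Proof.
move=> ml S; have [] := sim_invariants S; rewrite !frobE => et ed _; split=> //.
  apply: (@cong_divp _ m); rewrite subnKC // -[X in cong _ X]opprK -[X in cong _ _ X]opprK.
  exact: congN.
apply: (@cong_divp _ (m + m)); rewrite -addnA subnKC //.
have := sim_det_precise ml S; rewrite det_frob exprD.
by rewrite -!mulrA [a * (_ * _)]mulrCA.
Qed.

Lemma aform_inj l m c t d k t' d' k' : (m <= l)%N ->
  sim l (aform c m t d k) (aform c m t' d' k') ->
  [/\ cong l t t', cong (l - m) d d' & cong (l - m) k k'].
Proof.
move=> ml /sim_shift S; have := @frob_inj l m t d k 1 t' d' k' ml.
by rewrite mulr1 mul1r; apply.
Qed.

Lemma frob_companion_inj l t d a t' d' a' : sim l (frob t d 1 a) (frob t' d' 1 a') ->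
  [/\ cong l t t', cong l d d' & cong l a a'].
Proof.
move=> /sim_invariants[]; rewrite !frobE !mulr1 => et ed ea; split => //.
by have := congN ed; rewrite !opprK.
Qed.

Lemma nform_tr c t d k a : simx (nform c t d k a)^T (nform c t d a k).
Proof.
rewrite /nform linearD /= tr_scalar_mx; apply: simx_shift.
exists (mx3 0 1 0 1 t 0 0 0 1).
  by rewrite unitmxE det_mx3 (_ : _ + _ = - 1) ?unitrN ?unitr1 //; ring.
by rewrite tr_mx3 !mul_mx3; congr mx3; ring.
Qed.

(** By Cayley-Hamilton this is the adjugate plus d times the identity. *)
Lemma frob_sq t d k a : frob t d k a *m frob t d k a + - t *: frob t d k a =
  mx3 d (a * k) (- t * a) 0 d a k 0 0.
Proof. by rewrite mul_mx3 scale_mx3 add_mx3; congr mx3; ring. Qed.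

Lemma cong_div1 m x : cong m.+1 (p ^+ m * x) 0 -> x \isn't a GRing.unit.
Proof.
rewrite -(mulr0 (p ^+ m)) -addn1 => /cong_divp/cong0P[z e]; apply/nunitP.
by exists z; rewrite e expr1.
Qed.

(* Modulo p^(m+1) and up to the factor p^m, the adjugate of the left-hand side has image
   spanned by the third basis vector, that of the right-hand side by the second one,
   which is also the image of both matrices modulo p. *)
Lemma frob_dual_absurd m t d k t' d' k' : (0 < m)%N ->
  t \isn't a GRing.unit -> d \isn't a GRing.unit -> k \isn't a GRing.unit ->
  t' \isn't a GRing.unit -> d' \isn't a GRing.unit -> k' \isn't a GRing.unit ->
  cong m.+1 t t' ->
  ~ sim m.+1 (frob t (p ^+ m * d) (p ^+ m) (p ^+ m * k))
             (frob t' (p ^+ m * d') (p ^+ m * k') (p ^+ m)).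
Proof.
move=> m0 /cong1P tn /cong1P dn /cong1P kn /cong1P tn' /cong1P dn' /cong1P kn' tt' [g gu e].
have N x : cong 1 x 0 -> cong m.+1 (p ^+ m * x) 0.
  by move=> /(cong_mulp m); rewrite mulr0 addn1.
set F := frob t _ _ _ in e; set F' := frob t' _ _ _ in e.
have e2 : mcong m.+1 ((F *m F + - t *: F) *m g) (g *m (F' *m F' + - t' *: F')).
  rewrite mulmxDl mulmxDr; apply: mcongD.
    rewrite -!mulmxA; apply: (mcong_trans (mcongMl _ e)).
    by rewrite !mulmxA; exact: mcongMr.
  rewrite -scalemxAl -scalemxAr; apply: (mcong_trans (mcongZ _ e)).
  move: tt' => [z ez]; exists (- z *: (g *m F')).
  by rewrite scalerA mulrN -ez -scalerBl; congr (_ *: _); ring.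
have {}e2 : mcong m.+1 (mx3 0 0 0 0 0 0 (p ^+ m) 0 0 *m g) (g *m mx3 0 0 0 0 0 (p ^+ m) 0 0 0).
  apply: mcong_trans (mcong_trans e2 _).
    apply: mcongMr; rewrite frob_sq; apply: mcong_sym.
    have pk x y : cong 1 x 0 -> cong m.+1 (y * (p ^+ m * x)) 0.
      by move=> /N/(congM (cong_refl p m.+1 y)); rewrite mulr0.
    apply: mcong_mx3; try exact: cong_refl; try exact: N.
    - by rewrite mulrC; exact: pk.
    - exact: pk.
  apply: mcongMl; rewrite frob_sq.
  have pt : cong m.+1 (- t' * p ^+ m) 0.
    by rewrite mulrC; apply: N; have := congN tn'; rewrite oppr0.
  apply: mcong_mx3; try exact: cong_refl; try exact: N.
  - by apply: cong_trans (_ : cong m.+1 (p ^+ m * (p ^+ m * k')) 0);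
      [exact: cong_refl | have := congM (cong_refl p m.+1 (p ^+ m)) (N _ kn'); rewrite mulr0].
  - exact: pt.
have {}e : mcong 1 (F *m g) (g *m F') by apply: mcong_le e.
have P1 : cong 1 (p ^+ m) 0 by rewrite -[p ^+ m]mulr1; exact: cong_expl.
have P2 x : cong 1 (p ^+ m * x) 0 by exact: cong_expl.
(* Counting rows and columns from 0, entries (2,0) and (2,1) of the congruence modulo p^(m+1) and
   entry (1,2) of the one modulo p force the row 0 of g to vanish modulo p. *)
move/mcongP: e => e; move/mcongP: e2 => e2.
have a12 := e i1 i2; have b20 := e2 i2 i0; have b21 := e2 i2 i1.
move: a12 b20 b21; rewrite [g]mx3_eta !mul_mx3 !mx3E !(mul0r, mulr0, add0r, addr0) mul1r.
move=> a12 /cong_div1 g00 /cong_div1 g01.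
have g02 : g i0 i2 \isn't a GRing.unit.
  apply/cong1P; have := congB a12 (congM tn (cong_refl p 1 (g i1 i2))).
  rewrite addrK mul0r subr0 => h; apply: (cong_trans h).
  have := congM (cong_refl p 1 (g i1 i0)) P1.
  by rewrite mulr0.
suff : \det g \isn't a GRing.unit by rewrite -unitmxE gu.
rewrite det3; apply: nunitD; last exact: nunitMl.
by apply: nunitD; rewrite ?unitrN; exact: nunitMl.
Qed.

Definition nunit3 (x y z : E) :=
  [&& x \isn't a GRing.unit, y \isn't a GRing.unit & z \isn't a GRing.unit].

Lemma cong_nunit k x y : (0 < k)%N -> cong k x y ->
  (x \is a GRing.unit) = (y \is a GRing.unit).
Proof.
by move=> k0 xy; apply/idP/idP; apply: unit_cong; [exact: k0|exact: xy|exact: k0|exact: cong_sym].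
Qed.

Lemma aform_tr_absurd l m n c t d k c' t' d' k' : (0 < m < l)%N -> (n <= l)%N ->
  nunit3 t d k -> ~ sim l (aform c m t d k)^T (aform c' n t' d' k').
Proof.
move=> /andP[m0 ml] nl /and3P[tn dn kn] S.
have ml' := ltnW ml; have l0 : (0 < l)%N by apply: leq_trans ml.
have lm0 : (0 < l - m)%N by rewrite subn_gt0.
have {}S : sim l (nform c t (p ^+ m * d) (p ^+ m) (p ^+ m * k)) (aform c' n t' d' k').
  exact: sim_trans (simx_sim p l (simx_sym (nform_tr _ _ _ _ _))) S.
have [mn] : m = n /\ cong m c c'.
  move: S; rewrite aformE -{2}[p ^+ m]mulr1; apply: nform_level => //.
    by rewrite /primitive3 unitr1 orbT.
  exact: primitive3_1.
subst n; move=> /cong_sym[x ex].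
have [t1 [d1 [k1 h]]] := aform_shift x c' m t' d' k'.
have {h}S := sim_trans S (simx_sim p l h).
have ec : c' - p ^+ m * x = c by rewrite -ex; ring.
rewrite ec in S; move/sim_shift: S => S.
(* The invariants force t1, d1, k1 to be nonunits along with t, d, k. For d1 and k1 this needs m <
   l. *)
have := @frob_inj l m t1 d1 k1 k t d 1 ml'; rewrite !mulr1 => /(_ (sim_sym S))[tt dd kk].
apply: (frob_dual_absurd m0 tn dn kn _ _ _ _ (sim_le ml S)).
- by rewrite (cong_nunit l0 tt).
- by rewrite (cong_nunit lm0 dd).
- by rewrite (cong_nunit lm0 kk).
- by apply: cong_le (cong_sym tt).
Qed.

Definition scalar_mod X := exists c, mcong 1 X c%:M.

Lemma scalar_mod_sim l X Y : (0 < l)%N -> sim l X Y -> scalar_mod X -> scalar_mod Y.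
Proof.
move=> l0 /(sim_le l0)/sim_sym[g gu e] [c h]; exists c; apply: (mcong_cancelr gu).
apply: mcong_trans e _; rewrite -scalar_mxC; exact: mcongMl.
Qed.

Lemma nform_nscalar c t d k a : ~ scalar_mod (nform c t d k a).
Proof.
move=> [u /mcongP/(_ i1 i0)]; rewrite nformE scalar_mx3 !mx3E => /cong1P.
by rewrite unitr1.
Qed.

Lemma nform_tr_nscalar c t d k a : ~ scalar_mod (nform c t d k a)^T.
Proof.
move=> /(scalar_mod_sim (ltn0Sn 0) (simx_sim p 1 (nform_tr _ _ _ _ _))).
exact: nform_nscalar.
Qed.

Lemma frob_nform t d k a : frob t d k a = nform 0 t d k a.
Proof. by rewrite /nform raddf0 add0r. Qed.

Lemma frob_aform_absurd l m t d a c t' d' k' : (0 < m <= l)%N ->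
  ~ sim l (frob t d 1 a) (aform c m t' d' k').
Proof.
move=> /andP[m0 ml] /sim_sym S; have l0 : (0 < l)%N by apply: leq_trans ml.
have := quad_sim ml S (nform_quad c t' (cong_expl p d' (leqnn _)) (cong_expl p k' (leqnn _)) _).
rewrite -[X in cong _ X](mulr1 (p ^+ m)) => /(_ (cong_expl p 1 (leqnn _))).
rewrite frob_nform => /quad_nform[_ _ /(cong_le m0)/cong1P]; by rewrite unitr1.
Qed.

Lemma frob_dual_cyclic_absurd l m t d a c t' d' k' : (0 < m <= l)%N ->
  ~ sim l (frob t d 1 a) (aform c m t' d' k')^T.
Proof.
move=> ml /sim_tr; rewrite trmxK frob_nform => S.
have [t1 [d1 [a1 h]]] : exists t' d' a', simx (nform 0 t d a 1) (frob t' d' 1 a').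
  by apply: nform_cyclic; rewrite unitr1 orbT.
apply: (frob_aform_absurd ml); apply: sim_trans S; apply: simx_sim.
exact: simx_trans (simx_sym h) (simx_sym (nform_tr _ _ _ _ _)).
Qed.

(** A uniformizer alone does not bound how often p divides an element, and d, k, a may vanish; so m
    is found by dividing out p at most l times. *)
Lemma level_split l d k a : (0 < l)%N ->
  d \isn't a GRing.unit -> k \isn't a GRing.unit -> a \isn't a GRing.unit ->
  exists m d' k' a', [/\ (0 < m <= l)%N, d = p ^+ m * d', k = p ^+ m * k',
    a = p ^+ m * a' & m = l \/ primitive3 d' k' a'].
Proof.
case: l => // l _ /nunitP[d' ->] /nunitP[k' ->] /nunitP[a' ->].
elim: l => [|l [m [d1 [k1 [a1 [ml e1 e2 e3 H]]]]]].
  by exists 1%N, d', k', a'; rewrite !expr1; split=> //; left.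
have [u|/norP[dn /norP[kn an]]] := boolP (primitive3 d1 k1 a1).
  by exists m, d1, k1, a1; split => //; [lia|right].
have {}H : m = l.+1 by case: H => //; rewrite /primitive3 (negPf dn) (negPf kn) (negPf an).
move/nunitP: dn => [d2 ed]; move/nunitP: kn => [k2 ek]; move/nunitP: an => [a2 ea].
exists l.+2, d2, k2, a2; rewrite e1 e2 e3 ed ek ea H; split=> //; try by rewrite [in RHS]exprSr mulrA.
- by rewrite leqnn.
- by left.
Qed.

Lemma nonscalar_classify l X : (0 < l)%N -> ~ scalar_mod X ->
  [\/ exists t d a, sim l X (frob t d 1 a),
      exists m c t d k, (0 < m <= l)%N /\ sim l X (aform c m t d k)
    | exists m c t d k, [/\ (0 < m < l)%N, nunit3 t d k & sim l X (aform c m t d k)^T]].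
Proof.
move=> l0 /nonscalar_nform[c [t [d [k [a XY]]]]].
have [u|/norP[kn /norP[an dn]]] :=
    boolP [|| k \is a GRing.unit, a \is a GRing.unit | d \is a GRing.unit].
  have [t' [d' [a' h]]] := nform_cyclic c t u; constructor 1; exists t', d', a'.
  exact/simx_sim/(simx_trans XY).
have [m [d' [k' [a' [/andP[m0 ml] ed ek ea H]]]]] := level_split l0 dn kn an; subst d k a.
have [em|{}ml] : m = l \/ (m < l)%N by move: ml; rewrite leq_eqVlt => /orP[/eqP|]; auto.
  constructor 2; exists m, c, t, 0, 0; split; first by rewrite m0.
  apply: (sim_trans (simx_sim p l XY)); apply: mcong_sim; rewrite /aform !nformE mulr0.
  subst m; apply: mcong_mx3; try exact: cong_refl; try exact: cong_expl.
  apply: (@cong_trans _ _ _ 0); first exact: cong_expl.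
  by rewrite -[p ^+ l]mulr1; exact/cong_sym/cong_expl.
have {}H : primitive3 d' k' a' by case: H => // H; rewrite H ltnn in ml.
have [u|nu] := boolP [|| a' \is a GRing.unit, d' \is a GRing.unit |
      (t \is a GRing.unit) && (k' \is a GRing.unit)].
  have [t1 [d1 [k1 h]]] := nform_aform c m0 u.
  constructor 2; exists m, c, t1, d1, k1; split; first by rewrite m0 ltnW.
  exact/simx_sim/(simx_trans XY).
move: nu => /norP[an' /norP[dn' tk]].
have ku : k' \is a GRing.unit by move: H; rewrite /primitive3 (negPf an') (negPf dn') orbF.
have tn : t \isn't a GRing.unit by move: tk; rewrite ku andbT.
have [|t1 [d1 [k1 h]]] := @nform_aform m c t d' a' k' m0; first by rewrite ku.
constructor 3; exists m, c, t1, d1, k1.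
(* The conjugacy is exact, so trace, second coefficient and determinant give equalities: t1 = t, d1
   = d' and k1 = k' a', all nonunits. *)
have [] : [/\ t = t1, p ^+ m * d' = p ^+ m * d1 &
    p ^+ m * k' * (p ^+ m * a') = p ^+ m * (p ^+ m * k1)].
  have := simx_shift (- c) h; rewrite !addrA -raddfD /= addNr raddf0 !add0r.
  by move=> /simx_invariants[]; rewrite !frobE => -> /oppr_inj -> ->.
move=> et /(mulfI (expp_neq0 m)) ed e.
have /(mulfI (expp_neq0 m))/(mulfI (expp_neq0 m)) ek :
    p ^+ m * (p ^+ m * (k' * a')) = p ^+ m * (p ^+ m * k1) by rewrite -e; ring.
split; [by rewrite m0 | by rewrite /nunit3 -et -ed -ek tn dn' nunitMr | ].
apply: simx_sim; rewrite -[X]trmxK; apply: simx_tr.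
apply: simx_trans (simx_tr XY) _; apply: simx_trans (nform_tr _ _ _ _ _) h.
Qed.

End NormalForm.

(** * Counting classes *)

Record equivalence (T : Type) (R : T -> T -> Prop) : Prop := Equivalence {
  eqv_refl : forall x, R x x;
  eqv_sym : forall x y, R x y -> R y x;
  eqv_trans : forall y x z, R x y -> R y z -> R x z }.

(** A finite system of representatives inside P, because neither P nor R is decidable. *)
Definition nclasses (T : Type) (P : set T) (R : T -> T -> Prop) (n : nat) : Prop :=
  exists (I : finType) (r : I -> T), [/\ #|I| = n, forall i, P (r i),
    forall i j, R (r i) (r j) -> i = j & forall x, P x -> exists i, R x (r i)].

Section Classes.
Variables (T : Type) (R : T -> T -> Prop).
Hypothesis eqR : equivalence R.
Implicit Types (P Q : set T) (m n : nat).

Lemma nclasses_le P Q m n : P `<=` Q -> nclasses P R m -> nclasses Q R n -> (m <= n)%N.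
Proof.
move=> PQ [I [r [<- rP rI _]]] [J [s [<- _ _ sS]]].
have /choice[f fP] i : exists j, R (r i) (s j) by exact/sS/PQ.
apply: (@leq_card _ _ f) => i j fij; apply: rI.
by apply: (eqv_trans eqR (fP i)); rewrite fij; apply: (eqv_sym eqR).
Qed.

Lemma nclasses_uniq P m n : nclasses P R m -> nclasses P R n -> m = n.
Proof.
move=> Pm Pn; apply/eqP; rewrite eqn_leq.
by rewrite (nclasses_le (@subset_refl _ P) Pm Pn) (nclasses_le (@subset_refl _ P) Pn Pm).
Qed.

Lemma nclassesU P Q m n : (forall x y, P x -> Q y -> ~ R x y) ->
  nclasses P R m -> nclasses Q R n -> nclasses (P `|` Q) R (m + n).
Proof.
move=> PQ [I [r [<- rP rI rS]]] [J [s [<- sP sI sS]]].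
exists (I + J)%type, (fun k => match k with inl i => r i | inr j => s j end).
split.
- by rewrite card_sum.
- by case=> k; [left|right].
- move=> [i|i] [j|j] h; [by congr inl; apply: rI| | |by congr inr; apply: sI].
    by have := PQ _ _ (rP i) (sP j).
  by have := PQ _ _ (rP j) (sP i); have := eqv_sym eqR h.
- by move=> x [/rS[i h]|/sS[i h]]; [exists (inl i)|exists (inr i)].
Qed.

Lemma nclasses0 : nclasses set0 R 0.
Proof. by exists void, (fun v : void => match v with end); split=> //; rewrite card_void. Qed.

Lemma nclasses_bigU (I : eqType) (s : seq I) (P : I -> set T) (n : I -> nat) :
  uniq s -> (forall i, i \in s -> nclasses (P i) R (n i)) ->
  (forall i j x y, i \in s -> j \in s -> P i x -> P j y -> R x y -> i = j) ->
  nclasses [set x | exists2 i, i \in s & P i x] R (\sum_(i <- s) n i).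
Proof.
elim: s => [_ _ _|i s IH /= /andP[is_ us] Pn sep].
  rewrite big_nil (_ : [set _ | _] = set0); first exact: nclasses0.
  by apply/seteqP; split=> x // [].
rewrite big_cons (_ : [set _ | _] = P i `|` [set x | exists2 j, j \in s & P j x]).
  apply: nclassesU.
  - move=> x y Px [j js Py] Rxy; move/negP: is_; apply.
    by rewrite (sep i j x y) // ?mem_head // inE js orbT.
  - by apply: Pn; rewrite mem_head.
  - apply: IH => // [j js|j k x y js ks]; first by apply: Pn; rewrite inE js orbT.
    by apply: sep; rewrite inE ?js ?ks orbT.
apply/seteqP; split=> x.
  by move=> [j]; rewrite inE => /orP[/eqP->|js]; [left|right; exists j].
by move=> [Px|[j js Px]]; [exists i => //; rewrite mem_head|exists j => //; rewrite inE js orbT].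
Qed.

Lemma nclasses_sub P Q n : Q `<=` P -> nclasses P R n -> exists m, nclasses Q R m.
Proof.
move=> QP [I [r [_ rP rI rS]]].
pose A := [pred i | `[< exists2 x, Q x & R x (r i) >]].
have /choice[f fP] (i : {i | A i}) : exists x, Q x /\ R x (r (val i)).
  by have /asboolP[x Qx Rx] := valP i; exists x.
exists #|{: {i | A i}}|, {i | A i}, f; split=> // [i|i j fij|x Qx].
- by have [] := fP i.
- apply/val_inj/rI; have [_ hi] := fP i; have [_ hj] := fP j.
  exact: (eqv_trans eqR (eqv_sym eqR hi) (eqv_trans eqR fij hj)).
- have [i Rxi] := rS x (QP x Qx).
  have Ai : A i by apply/asboolP; exists x.
  exists (exist _ i Ai); have [_ hi] := fP (exist _ i Ai).
  exact: (eqv_trans eqR Rxi (eqv_sym eqR hi)).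
Qed.

Lemma nclassesD P Q m n : Q `<=` P -> (forall x y, R x y -> Q x -> Q y) ->
  nclasses P R n -> nclasses Q R m ->
  exists2 k, nclasses (P `\` Q) R k & (k + m)%N = n.
Proof.
move=> QP Qinv Pn Qm; have [k Dk] := nclasses_sub (@subDsetl _ P Q) Pn.
exists k => //; apply: (nclasses_uniq _ Pn).
rewrite -(setDUK QP) setUC; apply: nclassesU => // x y [_ nQx] Qy Rxy.
by apply: nQx; apply: Qinv Qy; exact: (eqv_sym eqR).
Qed.

(** F has to land in P only up to R: a normal form is in general not Hermitian itself, merely
    similar to a Hermitian matrix. *)
Lemma nclasses_map (T' : Type) (R' : T' -> T' -> Prop) (P' : set T') P (F : T' -> T) n :
  nclasses P' R' n -> (forall x y, R' x y -> R (F x) (F y)) ->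
  (forall x y, P' x -> P' y -> R (F x) (F y) -> R' x y) ->
  (forall x, P' x -> exists2 y, P y & R y (F x)) ->
  (forall y, P y -> exists2 x, P' x & R y (F x)) -> nclasses P R n.
Proof.
move=> [I [r [<- rP rI rS]]] FR FI FP FS.
have /choice[f fP] i : exists y, P y /\ R y (F (r i)).
  by have [y Py Ry] := FP _ (rP i); exists y.
exists I, f; split=> // [i|i j fij|y Py]; first by have [] := fP i.
  have [[_ hi] [_ hj]] := (fP i, fP j); apply/rI/FI => //.
  exact: (eqv_trans eqR (eqv_sym eqR hi) (eqv_trans eqR fij hj)).
have [x Px Ryx] := FS _ Py; have [i Rxi] := rS _ Px; exists i.
have [_ hi] := fP i; apply: (eqv_trans eqR Ryx).
exact: (eqv_trans eqR (FR _ _ Rxi) (eqv_sym eqR hi)).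
Qed.

End Classes.

Lemma nclassesX (T T' : Type) R R' (P : set T) (P' : set T') m n :
  nclasses P R m -> nclasses P' R' n ->
  nclasses (P `*` P') (fun x y => R x.1 y.1 /\ R' x.2 y.2) (m * n).
Proof.
move=> [I [r [<- rP rI rS]]] [J [s [<- sP sI sS]]].
exists (I * J)%type, (fun k => (r k.1, s k.2)); split.
- by rewrite card_prod.
- by move=> [i j]; split; [exact: rP|exact: sP].
- by move=> [i j] [i' j'] /= [/rI-> /sI->].
- by move=> [x y] [/= /rS[i Ri] /sS[j Rj]]; exists (i, j).
Qed.

Lemma equivalenceX (T T' : Type) R R' : @equivalence T R -> @equivalence T' R' ->
  equivalence (fun x y : T * T' => R x.1 y.1 /\ R' x.2 y.2).
Proof.
move=> [r1 s1 t1] [r2 s2 t2]; split=> [x|x y [a b]|y x z [a b] [c d]].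
- by split.
- by split; [exact: s1|exact: s2].
- by split; [exact: t1 a c|exact: t2 b d].
Qed.

Section CountParameters.
Variables (E : idomainType) (p : E) (q : nat).
Hypothesis pP : uniformizer p.
Hypothesis residue : nclasses [set: E] (cong p 1) q.
Implicit Types (X Y : 'M[E]_3) (l m n : nat).

Lemma equiv_cong k : equivalence (cong p k).
Proof. split; [exact: cong_refl|exact: cong_sym|exact: cong_trans]. Qed.

Lemma equiv_sim l : equivalence (sim p l).
Proof. split; [exact: sim_refl|exact: sim_sym|exact: sim_trans]. Qed.

Lemma nclasses_cong k : nclasses [set: E] (cong p k) (q ^ k).
Proof.
elim: k => [|k IH].
  exists unit, (fun=> 0); rewrite card_unit expn0; split=> // [[] []//|x _].
  by exists tt, (x - 0); rewrite expr0 mul1r.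
have [I [r [cI rP rI rS]]] := residue; have [J [s [cJ sP sI sS]]] := IH.
exists (I * J)%type, (fun k => r k.1 + p * s k.2); split=> //.
- by rewrite card_prod cI cJ -expnS.
- move=> [i j] [i' j'] /= h; have ii : i = i'.
    apply: rI; move: h => [z]; rewrite exprS => e; exists (p ^+ k * z - s j + s j').
    by rewrite expr1 mulrDr mulrBr mulrA -e; ring.
  subst i'; congr pair; apply: sI; apply: (@cong_divp _ _ pP k 1).
  by rewrite expr1 add1n; move: h => [z e]; exists z; rewrite -e; ring.
- move=> x _; have [i [z e]] := rS x Logic.I; have [j [w e']] := sS z Logic.I.
  exists (i, j), w => /=; rewrite exprS -mulrA -e'; rewrite expr1 in e.
  by rewrite mulrBr -e; ring.
Qed.

End CountParameters.

Section Invariance.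
Variables (E : idomainType) (p : E).
Hypothesis pP : uniformizer p.
Implicit Types (X Y : 'M[E]_3) (l m n : nat).

(** Expresses [nunit3] through the similarity class alone, which yields its invariance without
    following t, d, k through a change of c. *)
Lemma nunit3_tr l m c t d k : (0 < m < l)%N ->
  nunit3 t d k <->
  ~ (exists c' t' d' k', sim p l (aform p c m t d k)^T (aform p c' m t' d' k')).
Proof.
move=> ml; split=> [nu [c' [t' [d' [k' S]]]]|H].
  by apply: aform_tr_absurd S => //; case/andP: ml => _ /ltnW.
apply: contrapT => /negP nu; apply: H; have m0 : (0 < m)%N by case/andP: ml.
have u : [|| k \is a GRing.unit, d \is a GRing.unit |
           (t \is a GRing.unit) && (1 \is a @GRing.unit E)].
  move: nu; rewrite /nunit3 unitr1 andbT -!negb_or negbK => /or3P[]-> //;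
  by rewrite ?orbT.
have [t' [d' [k' h]]] := nform_aform pP c m0 u; exists c, t', d', k'.
apply: simx_sim; apply: simx_trans (nform_tr _ _ _ _ _) _.
by rewrite mulr1 in h.
Qed.

Lemma nunit3_sim l m c t d k c' t' d' k' : (0 < m < l)%N ->
  sim p l (aform p c m t d k) (aform p c' m t' d' k') ->
  nunit3 t d k -> nunit3 t' d' k'.
Proof.
move=> ml /sim_tr/sim_sym S /(nunit3_tr c _ _ _ ml) H; apply/(nunit3_tr c' _ _ _ ml).
move=> [c1 [t1 [d1 [k1 h]]]]; apply: H; exists c1, t1, d1, k1.
exact: sim_trans (sim_sym S) h.
Qed.

Lemma aform_shift_to c c' m t d k : cong p m c c' -> exists t' d' k',
  simx (aform p c m t d k) (aform p c' m t' d' k').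
Proof.
move=> [x e]; have [t' [d' [k' h]]] := aform_shift p x c m t d k.
by exists t', d', k'; rewrite -[c'](_ : c - p ^+ m * x = _) // -e; ring.
Qed.

Lemma cong_params l m c t d k t' d' k' : (m <= l)%N ->
  cong p l t t' -> cong p (l - m) d d' -> cong p (l - m) k k' ->
  sim p l (aform p c m t d k) (aform p c m t' d' k').
Proof.
move=> ml tt dd kk; apply: mcong_sim; rewrite /aform !nformE.
apply: mcong_mx3; try exact: cong_refl.
- by have := cong_mulp m dd; rewrite subnKC.
- by apply: congD => //; exact: cong_refl.
- by have := cong_mulp m kk; rewrite subnKC.
Qed.

Lemma sim_scale l c X Y :
  sim p l.+1 (c%:M + p *: X) (c%:M + p *: Y) <-> sim p l X Y.
Proof.
split=> [/sim_shift[g gu [Z e]]|[g gu [Z e]]].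
  exists g => //; exists Z; apply/matrixP => i j; apply: (mulfI (uniformizer_neq0 pP)).
  move/matrixP: e => /(_ i j); rewrite -scalemxAl -scalemxAr -scalerBr !mxE.
  by rewrite exprS mulrA.
apply/sim_shift; exists g => //; exists Z.
by rewrite -scalemxAl -scalemxAr -scalerBr e scalerA -exprS.
Qed.

End Invariance.

(** * Counting normal forms over E with parameters in o, where E is o itself or its quadratic
    extension *)

Section CountForms.
Variables (o E : idomainType) (iota : {rmorphism o -> E}) (p : o) (q : nat).
Hypothesis pP : uniformizer p.
Hypothesis pE : uniformizer (iota p).
Hypothesis iota_cong : forall k x y, cong (iota p) k (iota x) (iota y) -> cong p k x y.
Hypothesis residue : nclasses [set: o] (cong p 1) q.
Local Notation sim := (sim (iota p)).
Local Notation mcong := (mcong (iota p)).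
Implicit Types (S : set 'M[E]_3) (l m n : nat).

Lemma cong_iota k x y : cong p k x y -> cong (iota p) k (iota x) (iota y).
Proof. by move=> [z e]; exists (iota z); rewrite -rmorphB e rmorphM rmorphXn. Qed.

Definition frobp (v : o * o * o) : 'M[E]_3 := frob (iota v.1.1) (iota v.1.2) 1 (iota v.2).

Definition aformp m (c : o) (v : o * (o * o)) : 'M[E]_3 :=
  aform (iota p) (iota c) m (iota v.1) (iota v.2.1) (iota v.2.2).

Lemma count_cyclic l S : (forall v, exists2 X, S X & sim l X (frobp v)) ->
  (forall X, S X -> exists v, sim l X (frobp v)) ->
  nclasses S (sim l) (q ^ l * q ^ l * q ^ l).
Proof.
move=> H1 H2; have C := nclasses_cong pP residue l.
apply: (nclasses_map (equiv_sim _ l) (F := frobp) (nclassesX (nclassesX C C) C)).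
- move=> [[t d] a] [[t' d'] a'] /= [[tt dd] aa]; apply: mcong_sim.
  by apply: mcong_mx3; try exact: cong_refl; exact: cong_iota.
- move=> [[t d] a] [[t' d'] a'] _ _ /frob_companion_inj[tt dd aa].
  by split; [split|]; exact: iota_cong.
- by move=> x _; exact: H1.
- by move=> X /H2[v h]; exists v.
Qed.

Definition cong3 l m (v w : o * (o * o)) :=
  cong p l v.1 w.1 /\ (cong p (l - m) v.2.1 w.2.1 /\ cong p (l - m) v.2.2 w.2.2).

Lemma equiv_cong3 l m : equivalence (cong3 l m).
Proof.
exact: equivalenceX (equiv_cong p l) (equivalenceX (equiv_cong p _) (equiv_cong p _)).
Qed.

(** The residue of c modulo p^m separates classes, and once c is a fixed representative the
    remaining parameters are unique up to [cong3]. The set V lets one count serve all parameters,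
    the nonunit ones and their complement. *)
Lemma count_aform l m n (V : set (o * (o * o))) S : (m <= l)%N ->
  nclasses V (cong3 l m) n ->
  (forall c v, V v -> exists2 X, S X & sim l X (aformp m c v)) ->
  (forall X, S X -> exists c, forall c', cong p m c c' ->
     exists2 v, V v & sim l X (aformp m c' v)) ->
  nclasses S (sim l) (q ^ m * n).
Proof.
move=> ml Vn H1 H2; have [I [r [<- _ rI rS]]] := nclasses_cong pP residue m.
pose Q i := [set X | S X /\ exists2 v, V v & sim l X (aformp m (r i) v)].
have -> : S = [set X | exists2 i, i \in index_enum I & Q i X].
  apply/seteqP; split=> X; last by move=> [i _ []].
  move=> SX; have [c h] := H2 X SX; have [i ci] := rS c Logic.I.
  by exists i; rewrite ?mem_index_enum //; split => //; exact: h.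
have -> : (#|I| * n)%N = (\sum_(i <- index_enum I) n)%N.
  by rewrite sum_nat_const.
apply: (nclasses_bigU (equiv_sim _ l)); first exact: index_enum_uniq.
- move=> i _; apply: (nclasses_map (equiv_sim _ l) (F := aformp m (r i)) Vn).
  + move=> v w [h1 [h2 h3]]; apply: cong_params => //; exact: cong_iota.
  + by move=> v w _ _ /(aform_inj pE ml)[h1 h2 h3]; split; [|split]; exact: iota_cong.
  + by move=> v Vv; have [X SX h] := H1 (r i) v Vv; exists X => //; split => //; exists v.
  + by move=> X [_ [v Vv h]]; exists v.
- move=> i j X Y _ _ [_ [v _ hX]] [_ [w _ hY]] XY; apply: rI; apply: iota_cong.
  have h := sim_trans (sim_trans (sim_sym hX) XY) hY.
  by have [] := aform_level pE ml ml h.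
Qed.

Lemma count_params l m :
  nclasses [set: o * (o * o)] (cong3 l m) (q ^ l * (q ^ (l - m) * q ^ (l - m))).
Proof.
have C := nclasses_cong pP residue.
have := nclassesX (C l) (nclassesX (C (l - m)%N) (C (l - m)%N)).
by rewrite !setXTT.
Qed.

(** Nonunits are multiples of p, which costs each of t, d, k one digit; m < l ensures that d and k
    have a digit to lose. *)
Lemma count_params_nunit l m : (m < l)%N ->
  nclasses [set v | nunit3 v.1 v.2.1 v.2.2] (cong3 l m)
    (q ^ l.-1 * (q ^ (l - m).-1 * q ^ (l - m).-1)).
Proof.
move=> ml; have C := nclasses_cong pP residue.
have := nclassesX (C l.-1) (nclassesX (C (l - m).-1%N) (C (l - m).-1%N)).
have l1 : l = (1 + l.-1)%N by rewrite add1n prednK //; exact: leq_trans ml.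
have lm1 : (l - m)%N = (1 + (l - m).-1)%N by rewrite add1n prednK // subn_gt0.
have PM k x y : cong p (1 + k) (p * x) (p * y) <-> cong p k x y.
  split=> [|/(cong_mulp 1)]; last by rewrite expr1.
  by rewrite -[p in p * _]expr1 -[p in _ (p * _)]expr1; exact: (cong_divp pP).
move=> Cn; apply: (nclasses_map (equiv_cong3 l m)
  (F := fun v : o * (o * o) => (p * v.1, (p * v.2.1, p * v.2.2))) Cn).
- move=> v w /= [h1 [h2 h3]]; split=> /=; first by rewrite l1; apply/PM.
  by split; rewrite lm1; apply/PM.
- move=> v w _ _ []; rewrite /= {1}l1 lm1 => /PM h1 [/PM h2 /PM h3]; by split; [|split].
- move=> v _; exists (p * v.1, (p * v.2.1, p * v.2.2)); last exact: (eqv_refl (equiv_cong3 l m)).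
  by rewrite /= /nunit3 !unitrM (negPf (uniformizer_nunit pP)).
- move=> [x [y z]] /and3P[/= /(nunitP pP)[x' ->] /(nunitP pP)[y' ->] /(nunitP pP)[z' ->]].
  by exists (x', (y', z')) => //; exact: (eqv_refl (equiv_cong3 l m)).
Qed.

Lemma count_scalar l n (H : set 'M[E]_3) :
  (forall c X, H X -> H ((iota c)%:M + iota p *: X)) ->
  (forall X, H X -> scalar_mod (iota p) X -> exists c, forall c', cong p 1 c c' ->
     exists2 Y, H Y & X = (iota c')%:M + iota p *: Y) ->
  nclasses H (sim l) n ->
  nclasses [set X | H X /\ scalar_mod (iota p) X] (sim l.+1) (q * n).
Proof.
move=> H1 H2 Hn; have [I [r [<- _ rI rS]]] := residue.
pose F i (X : 'M[E]_3) := (iota (r i))%:M + iota p *: X.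
have FS i X : mcong 1 (F i X) (iota (r i))%:M by exists X; rewrite expr1 addrAC subrr add0r.
pose Q i := [set X | exists2 Y, H Y & X = F i Y].
have -> : [set X | H X /\ scalar_mod (iota p) X] =
    [set X | exists2 i, i \in index_enum I & Q i X].
  apply/seteqP; split=> X; last first.
    by move=> [i _ [Y HY ->]]; split; [exact: H1|exists (iota (r i)); exact: FS].
  move=> [HX sX]; have [c h] := H2 X HX sX; have [i ci] := rS c Logic.I.
  by exists i; rewrite ?mem_index_enum //; exact: h.
have -> : (#|I| * n)%N = (\sum_(i <- index_enum I) n)%N by rewrite sum_nat_const.
apply: (nclasses_bigU (equiv_sim _ _)); first exact: index_enum_uniq.
- move=> i _; apply: (nclasses_map (equiv_sim _ _) (F := F i) Hn).
  + by move=> X Y XY; apply/(sim_scale pE).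
  + by move=> X Y _ _ /(sim_scale pE).
  + by move=> X HX; exists (F i X); [exists X|exact: sim_refl].
  + by move=> X [Y HY ->]; exists Y => //; exact: sim_refl.
- move=> i j X Y _ _ [X' _ ->] [Y' _ ->] S; apply: rI; apply: iota_cong.
  have [g gu e] := sim_le (ltn0Sn l) S.
  have {}e : mcong 1 ((iota (r i))%:M *m g) ((iota (r j))%:M *m g).
    apply: mcong_trans (mcongMr _ (mcong_sym (FS i X'))) _; apply: mcong_trans e _.
    by rewrite -scalar_mxC; apply: mcongMl; exact: FS.
  have /mcongP/(_ i0 i0) := mcong_cancelr gu e.
  by rewrite !mxE eqxx !mulr1n.
Qed.

End CountForms.

(** * Classes under the general linear group *)

Section CountGL.
Variables (o : idomainType) (p : o) (q : nat).
Hypothesis pP : uniformizer p.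
Hypothesis residue : nclasses [set: o] (cong p 1) q.
Local Notation sim := (sim p).
Implicit Types (X Y : 'M[o]_3) (l m n : nat).

Definition subs l m X := exists c t d k, sim l X (aform p c m t d k).
Definition duals l m X :=
  exists c t d k, nunit3 t d k /\ sim l X (aform p c m t d k)^T.

(* For m <= l (resp. m < l) these are q^(3 l - m) and q^(3 l - m - 3). *)
Definition nsubs l m := (q ^ m * (q ^ l * (q ^ (l - m) * q ^ (l - m))))%N.
Definition nduals l m := (q ^ m * (q ^ l.-1 * (q ^ (l - m).-1 * q ^ (l - m).-1)))%N.

Definition nunit_params : set (o * (o * o)) := [set v | nunit3 v.1 v.2.1 v.2.2].

Lemma idfun_cong k x y : cong (idfun p) k (idfun x) (idfun y) -> cong p k x y.
Proof. by []. Qed.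

Lemma count_GL_subs l m : (m <= l)%N ->
  nclasses (subs l m) (sim l) (nsubs l m).
Proof.
move=> ml; apply: (@count_aform _ _ (@idfun o) p q pP pP idfun_cong residue l m _ setT) => //.
- exact: count_params.
- by move=> c [t [d k]] _; exists (aformp idfun p m c (t, (d, k)));
    [exists c, t, d, k|]; exact: sim_refl.
- move=> X [c [t [d [k S]]]]; exists c => c' cc'.
  have [t' [d' [k' h]]] := aform_shift_to t d k cc'.
  by exists (t', (d', k')) => //; apply: sim_trans S _; exact: simx_sim.
Qed.

Lemma count_GL_duals l m : (0 < m < l)%N ->
  nclasses (duals l m) (sim l) (nduals l m).
Proof.
move=> ml; have /andP[m0 ml'] := ml.
have C : nclasses [set X | duals l m X^T] (sim l) (nduals l m).
  apply: (@count_aform _ _ (@idfun o) p q pP pP idfun_cong residue l m _ nunit_params).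
  - exact: ltnW.
  - exact: count_params_nunit.
  - move=> c [t [d k]] nu; exists (aformp idfun p m c (t, (d, k))); last exact: sim_refl.
    by exists c, t, d, k; split => //; exact: sim_refl.
  - move=> X [c [t [d [k [nu /sim_tr S]]]]]; exists c => c' cc'.
    rewrite !trmxK in S.
    have [t' [d' [k' h]]] := aform_shift_to t d k cc'.
    exists (t', (d', k')); last by apply: sim_trans S _; exact: simx_sim.
    exact: (nunit3_sim pP ml (simx_sim p l h)).
apply: (nclasses_map (equiv_sim p l) (F := @trmx _ _ _) C).
- by move=> X Y; exact: sim_tr.
- by move=> X Y _ _ /sim_tr; rewrite !trmxK.
- by move=> X dX; exists X^T => //; exact: sim_refl.
- by move=> X dX; exists X^T; [rewrite /= trmxK|rewrite trmxK; exact: sim_refl].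
Qed.

Lemma count_GL l n : nclasses [set: 'M[o]_3] (sim l) n ->
  nclasses [set: 'M[o]_3] (sim l.+1)
    (q * n + (q ^ l.+1 * q ^ l.+1 * q ^ l.+1
    + (\sum_(m <- index_iota 1 l.+2) nsubs l.+1 m
    + \sum_(m <- index_iota 1 l.+1) nduals l.+1 m)))%N.
Proof.
move=> Cn.
have C1 := @count_scalar _ _ (@idfun o) p q pP idfun_cong residue l n setT.
have {C1} C1 := C1 (fun _ _ _ => Logic.I).
have {}C1 : nclasses [set X | scalar_mod p X] (sim l.+1) (q * n).
  rewrite (_ : [set _ | _] = [set X | [set: 'M[o]_3] X /\ scalar_mod p X]); last first.
    by apply/seteqP; split=> X; [split|case].
  apply: C1 => // X _ [c [Z e]]; exists c => c' [z ez].
  exists (Z + z%:M) => //; rewrite /= -[LHS](subrK c%:M) e expr1 scalerDr.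
  rewrite scale_scalar_mx; rewrite expr1 in ez; rewrite -ez raddfB /=.
  by rewrite [in RHS]addrC -[RHS]addrA subrK.
pose cyc := [set X | exists v, sim l.+1 X (frobp idfun v)].
have C2 : nclasses cyc (sim l.+1) (q ^ l.+1 * q ^ l.+1 * q ^ l.+1).
  apply: (@count_cyclic _ _ (@idfun o) p q pP idfun_cong residue) => // v.
  by exists (frobp idfun v); [exists v|]; exact: sim_refl.
pose sub_s := [set X | exists2 m, m \in index_iota 1 l.+2 & subs l.+1 m X].
pose dual_s := [set X | exists2 m, m \in index_iota 1 l.+1 & duals l.+1 m X].
have C3 : nclasses sub_s (sim l.+1)
  (\sum_(m <- index_iota 1 l.+2) nsubs l.+1 m).
  apply: (nclasses_bigU (equiv_sim p l.+1)); first exact: iota_uniq.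
    by move=> m; rewrite mem_index_iota => /andP[_ ml]; exact: count_GL_subs.
  move=> i j X Y; rewrite !mem_index_iota => /andP[_ il] /andP[_ jl].
  move=> [c [t [d [k h]]]] [c' [t' [d' [k' h']]]] XY.
  by have [] := @aform_level _ _ pP l.+1 i j _ _ _ _ _ _ _ _ il jl
    (sim_trans (sim_trans (sim_sym h) XY) h').
have C4 : nclasses dual_s (sim l.+1)
  (\sum_(m <- index_iota 1 l.+1) nduals l.+1 m).
  apply: (nclasses_bigU (equiv_sim p l.+1)); first exact: iota_uniq.
    by move=> m; rewrite mem_index_iota => ml; exact: count_GL_duals.
  move=> i j X Y; rewrite !mem_index_iota => /andP[_ il] /andP[_ jl].
  move=> [c [t [d [k [_ h]]]]] [c' [t' [d' [k' [_ h']]]]] XY.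
  have := sim_tr (sim_trans (sim_trans (sim_sym h) XY) h'); rewrite !trmxK.
  by move=> /(@aform_level _ _ pP l.+1 i j _ _ _ _ _ _ _ _ (ltnW il) (ltnW jl))[].
rewrite (_ : [set: _] = [set X | scalar_mod p X] `|` (cyc `|` (sub_s `|` dual_s))).
  have nsc X Y c t d k a : scalar_mod p X -> sim l.+1 X Y -> ~ sim l.+1 Y (nform c t d k a).
    move=> sX XY h; apply: (@nform_nscalar _ p pP c t d k a).
    exact: scalar_mod_sim (sim_trans XY h) sX.
  have nsct X Y c t d k a : scalar_mod p X -> sim l.+1 X Y -> ~ sim l.+1 Y (nform c t d k a)^T.
    move=> sX XY h; apply: (@nform_tr_nscalar _ p pP c t d k a).
    exact: scalar_mod_sim (sim_trans XY h) sX.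
  apply: (nclassesU (equiv_sim p _)) C1 _; last apply: (nclassesU (equiv_sim p _)) C2 _.
  - move=> X Y sX [[v h]|[[m _ [c [t [d [k h]]]]]|[m _ [c [t [d [k [_ h]]]]]]]] XY.
    + by move: h; rewrite /frobp frob_nform; exact: nsc XY.
    + exact: nsc XY h.
    + exact: nsct XY h.
  - move=> X Y [v h] [[m ml [c [t [d [k h']]]]]|[m ml [c [t [d [k [_ h']]]]]]] XY;
      rewrite mem_index_iota in ml; have := sim_trans (sim_trans (sim_sym h) XY) h'.
    + exact: (frob_aform_absurd pP).
    + by apply: (frob_dual_cyclic_absurd pP); case/andP: ml => -> /ltnW.
  - apply: (nclassesU (equiv_sim p _)) C3 C4 => X Y [m ml [c [t [d [k h]]]]].
    move=> [m' ml' [c' [t' [d' [k' [nu h']]]]]] XY; rewrite !mem_index_iota in ml ml'.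
    have := sim_trans (sim_trans (sim_sym h') (sim_sym XY)) h.
    by apply: (aform_tr_absurd pP) nu; case/andP: ml.
apply/seteqP; split=> X // _; have [sX|nX] := pselect (scalar_mod p X); first by left.
right; have [[t [d [a h]]]|[m [c [t [d [k [ml h]]]]]]|[m [c [t [d [k [ml nu h]]]]]]] :=
  nonscalar_classify pP (ltn0Sn l) nX.
- by left; exists (t, d, a).
- by right; left; exists m; [rewrite mem_index_iota|exists c, t, d, k].
- by right; right; exists m; [rewrite mem_index_iota|exists c, t, d, k].
Qed.

End CountGL.

(** * Values of x^2 - nu y^2 in finite commutative rings *)

Lemma nclasses_preim (T T' : Type) (R : T -> T -> Prop) (F : T' -> T) n :
  equivalence R -> nclasses [set: T] R n ->
  exists m, nclasses [set: T'] (fun x y => R (F x) (F y)) m.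
Proof.
move=> eqR Tn; have [m [I [r [cI rP rI rS]]]] := nclasses_sub eqR (@subsetT _ (range F)) Tn.
have /choice[f fP] i : exists x, F x = r i by have [x _ e] := rP i; exists x.
exists m, I, f; split=> // [i j|x _]; first by rewrite !fP; exact: rI.
by have [|i h] := rS (F x); [exists x|exists i; rewrite fP].
Qed.

Lemma nclasses_coarser (T : Type) (R R' : T -> T -> Prop) n :
  equivalence R' -> (forall x y, R x y -> R' x y) ->
  (exists x y, R' x y /\ ~ R x y) -> equivalence R ->
  nclasses [set: T] R n -> exists2 m, (m < n)%N & nclasses [set: T] R' m.
Proof.
move=> eqR' RR' [x [y [Rxy nRxy]]] eqR [I [r [<- _ rI rS]]].
(* c chooses one index in each R'-class of representatives; its fixed points index the R'-classes.
   If all indices were fixed, R' would imply R. *)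
pose c i := odflt i [pick k | `[< R' (r i) (r k) >]].
have cR i : R' (r i) (r (c i)).
  by rewrite /c; case: pickP => [k /asboolP h|_]; [exact: h|exact: (eqv_refl eqR')].
have cE i j : R' (r i) (r j) -> c i = c j.
  move=> ij; rewrite /c (eq_pick (Q := fun k => `[< R' (r j) (r k) >])).
    case: pickP => // H; have : `[< R' (r j) (r j) >] by apply/asboolP; exact: (eqv_refl eqR').
    by rewrite H.
  move=> k; apply/asboolP/asboolP => h; last exact: (eqv_trans eqR' ij h).
  exact: (eqv_trans eqR' (eqv_sym eqR' ij) h).
exists #|{: {i | c i == i}}|.
  rewrite card_sig; apply/proper_card/properP; split; first exact: subset_predT.
  apply: contrapT => H.
  have {}H i : c i = i.
    by apply: contrapT => /eqP ci; apply: H; exists i => //; rewrite !inE.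
  have [i xi] := rS x Logic.I; have [j yj] := rS y Logic.I.
  have ij : i = j.
    rewrite -(H i) -(H j); apply: cE; apply: (eqv_trans eqR' (eqv_sym eqR' (RR' _ _ xi))).
    exact: (eqv_trans eqR' Rxy (RR' _ _ yj)).
  by apply: nRxy; apply: (eqv_trans eqR xi); rewrite ij; exact: (eqv_sym eqR).
exists {i | c i == i}, (r \o val); split=> // [i j ij|z _].
  by apply: val_inj; rewrite -(eqP (valP i)) -(eqP (valP j)); exact: cE.
have [i zi] := rS z Logic.I.
have cci : c (c i) == c i by apply/eqP/esym/cE/cR.
by exists (exist _ (c i) cci); apply: (eqv_trans eqR' (RR' _ _ zi)); exact: cR.
Qed.

Section NormForm.
Variable A : comNzRingType.
Implicit Types (J : set A) (a b x y : A).

Definition eqmod J x y := J (x - y).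
Definition unitmod J a := exists u, J (u * a - 1).

Lemma equiv_eqmod J : is_ideal J -> equivalence (eqmod J).
Proof.
move=> [J0 JD JM]; split=> [x|x y h|y x z h h']; rewrite /eqmod.
- by rewrite subrr.
- by rewrite -opprB -mulN1r; exact: JM.
- by rewrite -(subrK y x) -addrA; exact: JD.
Qed.

Lemma ideal_lin J a b x y : is_ideal J -> J x -> J y -> J (a * x + b * y).
Proof. by move=> [_ JD JM] Jx Jy; apply: JD; exact: JM. Qed.

Lemma ideal_cst J x y : is_ideal J -> J x -> J (y * x).
Proof. by move=> [_ _ JM]; exact: JM. Qed.

Lemma set_eq J x y : J x -> x = y -> J y.
Proof. by move=> Jx <-. Qed.

Definition ideal_adj J a : set A := [set x | exists j r, J j /\ x = j + r * a].
Definition ideal_colon J a : set A := [set x | J (x * a)].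

Lemma ideal_adj_ideal J a : is_ideal J -> is_ideal (ideal_adj J a).
Proof.
move=> [J0 JD JM]; split.
- by exists 0, 0; split=> //; rewrite mul0r addr0.
- move=> _ _ [j [r [Jj ->]]] [j' [r' [Jj' ->]]]; exists (j + j'), (r + r').
  by split; [exact: JD|ring].
- move=> b _ [j [r [Jj ->]]]; exists (b * j), (b * r); split; [exact: JM|ring].
Qed.

Lemma ideal_colon_ideal J a : is_ideal J -> is_ideal (ideal_colon J a).
Proof.
move=> [J0 JD JM]; split; rewrite /ideal_colon /=.
- by rewrite mul0r.
- by move=> x y hx hy; rewrite mulrDl; exact: JD.
- by move=> b x h; rewrite -mulrA; exact: JM.
Qed.

(** Models squaring modulo a prime ideal: fibres have at most two elements and that of 0 has one.
    The strict inequality makes any two such images in I meet. *)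
Lemma square_image_card (I : finType) (i0 : I) (neg F : I -> I) :
  (forall i j, F i = F j -> j = i \/ j = neg i) -> neg i0 = i0 ->
  (#|I| < 2 * #|[set F i | i : I]%SET|)%N.
Proof.
move=> HF n0; have fib i : (#|[set j | F j == F i]%SET| <= 2 - (F i == F i0))%N.
  case: eqP => [Fi|_].
    rewrite (_ : [set _ | _]%SET = [set i0]%SET) ?cards1 //.
    apply/setP => j; rewrite !inE Fi; apply/eqP/eqP => [e|-> //].
    by case: (HF i0 j) => //; rewrite n0.
  apply: leq_trans (_ : #|[set i; neg i]%SET| <= _)%N; last by rewrite cards2; case: eqP.
  by apply/subset_leq_card/fintype.subsetP => j; rewrite !inE => /eqP/esym/HF[->|->]; rewrite eqxx ?orbT.
have -> : #|I| = \sum_(k in [set F i | i : I]%SET) \sum_(i : I | F i == k) 1.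
  rewrite -sum1_card (partition_big F (mem [set F i | i : I]%SET)) //=.
  by move=> i _; exact: imset_f.
apply: leq_ltn_trans (_ : _ <= \sum_(k in [set F i | i : I]%SET) (2 - (k == F i0)))%N _.
  apply: leq_sum => k /imsetP[i _ ->]; apply: leq_trans (fib i).
  by rewrite sum1_card; apply: eq_leq; apply: eq_card => j; rewrite !inE.
have F0 : F i0 \in [set F i | i : I]%SET by exact: imset_f.
rewrite (bigD1 (F i0)) //= eqxx (eq_bigr (fun=> 2%N)) => [|k /andP[_ /negPf->] //].
by rewrite sum_nat_const (cardD1x F0) mulnDr mulnC.
Qed.

(** The values x^2 and h + nu y^2 each fill more than half of the finite quotient, so some value is
    common to both. *)
Lemma norm_mod_prime J nu h n : is_ideal J -> nclasses [set: A] (eqmod J) n ->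
  (forall a b, J (a * b) -> J a \/ J b) -> unitmod J nu ->
  exists x y, J (x ^+ 2 - nu * y ^+ 2 - h).
Proof.
move=> JI [I [r [_ _ rI rS]]] Jp [u Ju].
have /choice[cl clP] x : exists i, J (x - r i) by exact: rS.
pose neg i := cl (- r i); pose F1 i := cl (r i ^+ 2); pose F2 i := cl (h + nu * r i ^+ 2).
have negI i j : J (r j + r i) -> j = neg i.
  move=> hij; apply: rI; rewrite /eqmod /neg.
  have := ideal_lin 1 1 JI hij (clP (- r i)).
  move/set_eq; apply; ring.
have sqI i j : J (r i ^+ 2 - r j ^+ 2) -> j = i \/ j = neg i.
  rewrite subr_sqr => /Jp[h1|h1]; [left|right]; last by apply: negI; rewrite addrC.
  by apply/esym/rI.
have n0 : neg (cl 0) = cl 0.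
  apply/esym/negI; have := ideal_cst (- 2) JI (clP 0).
  move/set_eq; apply; ring.
have H1 : forall i j, F1 i = F1 j -> j = i \/ j = neg i.
  move=> i j e; apply: sqI; have := clP (r j ^+ 2); rewrite -/(F1 j) -e.
  move=> /(ideal_lin 1 (-1) JI (clP (r i ^+ 2))).
  move/set_eq; apply; rewrite /F1; ring.
have H2 : forall i j, F2 i = F2 j -> j = i \/ j = neg i.
  move=> i j e; apply: sqI; have := clP (h + nu * r j ^+ 2); rewrite -/(F2 j) -e.
  move=> /(ideal_lin 1 (-1) JI (clP (h + nu * r i ^+ 2))).
  move=> /set_eq h1; have {}h1 : J (nu * (r i ^+ 2 - r j ^+ 2)) by apply: h1; rewrite /F2; ring.
  have := ideal_lin u (- (r i ^+ 2 - r j ^+ 2)) JI h1 Ju.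
  move/set_eq; apply; ring.
have c1 := square_image_card H1 n0; have c2 := square_image_card H2 n0.
have [dis|] := boolP [disjoint [set F1 i | i : I]%SET & [set F2 i | i : I]%SET].
  have [_] := leq_card_setU [set F1 i | i : I]%SET [set F2 i | i : I]%SET.
  rewrite dis => /eqP e; have := max_card ([set F1 i | i : I] :|: [set F2 i | i : I])%SET.
  move: c1 c2; rewrite e; set a1 := #|_|; set a2 := #|_|; set a3 := #|_|; lia.
rewrite -setI_eq0 => /set0Pn[k]; rewrite inE => /andP[/imsetP[i _ e1] /imsetP[j _ e2]].
exists (r i), (r j); have := clP (r i ^+ 2); rewrite -/(F1 i) -e1 e2.
move=> /(ideal_lin (-1) 1 JI (clP (h + nu * r j ^+ 2))).
move/set_eq; apply; rewrite /F2; ring.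
Qed.

(* Induction on the index of J: a nilpotent modulo J is handled by a Newton step, zero
   divisors by the Chinese remainder theorem, and a field by the pigeonhole principle. *)
Lemma norm_mod J nu h n : is_ideal J -> nclasses [set: A] (eqmod J) n ->
  unitmod J 2 -> unitmod J nu -> unitmod J h ->
  exists x y, J (x ^+ 2 - nu * y ^+ 2 - h).
Proof.
elim/ltn_ind: n J => n IH J JI Jn [v Jv] [w Jw] [u Ju].
have [J0 JD JM] := JI.
have step K a : is_ideal K -> J `<=` K -> K a -> ~ J a ->
    exists x y, K (x ^+ 2 - nu * y ^+ 2 - h).
  move=> KI JK Ka nJa; have [m mn Km] : exists2 m, (m < n)%N & nclasses [set: A] (eqmod K) m.
    apply: nclasses_coarser (equiv_eqmod KI) _ _ (equiv_eqmod JI) Jn.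
      by move=> x y; exact: JK.
    by exists a, 0; rewrite /eqmod subr0.
  by apply: (IH m mn K KI Km); [exists v|exists w|exists u]; exact: JK.
have adjJ a : J `<=` ideal_adj J a by move=> x Jx; exists x, 0; rewrite mul0r addr0.
have adja a : ideal_adj J a a by exists 0, 1; rewrite mul1r add0r.
have [[a [nJa Jaa]]|Jrad] := pselect (exists a, ~ J a /\ J (a * a)).
  have [x [y [j [r [Jj e]]]]] := step _ a (ideal_adj_ideal a JI) (@adjJ a) (adja a) nJa.
  (* Newton step: with d the error and d^2 in J, scale (x, y) by 1 - d / (2 h). *)
  pose d := x ^+ 2 - nu * y ^+ 2 - h.
  have Jdd : J (d * d).
    have := ideal_lin (j + 2 * r * a) (r ^+ 2) JI Jj Jaa.
    move/set_eq; apply; rewrite /d e; ring.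
  pose c := - (v * u).
  exists (x * (1 + c * d)), (y * (1 + c * d)).
  have E1 : x ^+ 2 = d + nu * y ^+ 2 + h by rewrite /d; ring.
  have := ideal_lin 1 1 JI (ideal_lin (2 * c + c ^+ 2 * (h + d)) d JI Jdd
     (ideal_lin (- (2 * v)) (-1) JI Ju Jv)) J0.
  by move/set_eq; apply; rewrite !exprMn E1 /c; ring.
have [[a [b [nJa nJb Jab]]]|Jp] :=
    pselect (exists a b, [/\ ~ J a, ~ J b & J (a * b)]); last first.
  apply: (norm_mod_prime h JI Jn); last by exists w.
  move=> a b Jab; apply: contrapT => /not_orP[na nb]; apply: Jp; exists a, b; split=> //.
have radX x k : (0 < k)%N -> J (x ^+ k) -> J x.
  elim/ltn_ind: k x => -[//|[|k]] IHk x _ Jx; first by rewrite expr1 in Jx.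
  apply: (IHk (uphalf k.+2)); [by rewrite /= ltnS; lia|by []|].
  apply: contrapT => nJ; apply: Jrad; exists (x ^+ uphalf k.+2); split=> //.
  rewrite -exprD -[(_ + _)%N](_ : (k.+2 + (uphalf k.+2 + uphalf k.+2 - k.+2))%N = _).
    by rewrite exprD mulrC; exact: JM.
  by apply: subnKC; lia.
(* Powers of a repeat modulo J, so a^i (1 - a^(j-i)) lies in J for some i < j; as J is radical, a^i
   can be replaced by a. *)
have [k k0 Jk] : exists2 k, (0 < k)%N & J (a * (1 - a ^+ k)).
  have [I [r [_ _ rI rS]]] := Jn; have /choice[cl clP] x : exists i, J (x - r i) by exact: rS.
  have [i [j [ij e]]] : exists i j, (i < j)%N /\ cl (a ^+ i) = cl (a ^+ j).
    apply: contrapT => H.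
    have inj : injective (fun i : 'I_(#|I|.+1) => cl (a ^+ i)).
      move=> i j e; apply: val_inj => /=; case: (ltngtP i j) => // ij.
        by case: H; exists i, j.
      by case: H; exists j, i.
    by have := leq_card _ inj; rewrite card_ord ltnn.
  exists (j - i)%N; first by rewrite subn_gt0.
  apply: (radX _ i.+1) => //; rewrite exprMn exprS exprSr.
  have Jij : J (a ^+ i * (1 - a ^+ (j - i))).
    have := clP (a ^+ j); rewrite -e => /(ideal_lin 1 (-1) JI (clP (a ^+ i))).
    move/set_eq; apply; rewrite -[in a ^+ j](subnKC (ltnW ij)) exprD; ring.
  have := JM (a * (1 - a ^+ (j - i)) ^+ i) _ Jij.
  move/set_eq; apply; ring.
have colJ : J `<=` ideal_colon J a by move=> x Jx; rewrite /ideal_colon /= mulrC; exact: JM.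
have [x1 [y1 s1]] := step _ b (ideal_colon_ideal a JI) colJ
   (ltac:(by rewrite /ideal_colon /= mulrC)) nJb.
(* Modulo J, e = 1 - a^k is an idempotent killed by a. Weighting the solution modulo (J : a) by 1 -
   e and the one modulo J + (a) by e gives an error D with D a in J and D in J + (a); hence D^2 is
   in J, and so is D. *)
have [x2 [y2 [j [r [Jj s2]]]]] := step _ a (ideal_adj_ideal a JI) (@adjJ a) (adja a) nJa.
pose e := 1 - a ^+ k; exists ((1 - e) * x1 + e * x2), ((1 - e) * y1 + e * y2).
set X := (1 - e) * x1 + e * x2; set Y := (1 - e) * y1 + e * y2; pose D := X ^+ 2 - nu * Y ^+ 2 - h.
have Jea : J (a * e) by [].
have JDa : J (D * a).
  have := ideal_lin 1 ((x2 - x1) * (X + x1) - nu * (y2 - y1) * (Y + y1)) JI s1 Jea.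
  by move/set_eq; apply; rewrite /D /X /Y; ring.
pose c := (x1 - x2) * (X + x2) - nu * (y1 - y2) * (Y + y2).
have eD : D = j + (r + c * a ^+ k.-1) * a.
  have ek : 1 - e = a ^+ k.-1 * a by rewrite -exprSr prednK // /e; ring.
  transitivity (x2 ^+ 2 - nu * y2 ^+ 2 - h + (1 - e) * c); last by rewrite s2 ek; ring.
  by rewrite /D /X /Y /c /X /Y; ring.
apply: contrapT => nD; apply: Jrad; exists D; split => //; rewrite -/D.
have := ideal_lin D (r + c * a ^+ k.-1) JI Jj JDa.
move/set_eq; apply; transitivity (D * (j + (r + c * a ^+ k.-1) * a)); last by rewrite -eD.
ring.
Qed.

End NormForm.

(** * Hermitian matrices and the unitary group *)

(** What the unitary count extracts from the extension: [ud_fixed] descends invariants to o, [eta]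
    turns skew-Hermitian into Hermitian, and [ud_fin] feeds the induction on the index in
    [norm_mod]. *)
Record unitary_datum (o O : idomainType) (iota : {rmorphism o -> O})
    (sigma : {rmorphism O -> O}) (p : o) (eta : O) : Prop := UnitaryDatum {
  ud_o : uniformizer p;
  ud_O : uniformizer (iota p);
  ud_inj : injective iota;
  ud_iota : forall x, sigma (iota x) = iota x;
  ud_invol : involutive sigma;
  ud_fixed : forall z, sigma z = z -> exists x, z = iota x;
  ud_eta_unit : eta \is a GRing.unit;
  ud_eta : sigma eta = - eta;
  ud_2 : 2 \is a @GRing.unit O;
  ud_fin : forall k, exists n, nclasses [set: O] (cong (iota p) k) n }.

Section Unitary.
Variables (o O : idomainType) (iota : {rmorphism o -> O}) (sigma : {rmorphism O -> O}).
Variables (p : o) (eta : O).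
Hypothesis ud : unitary_datum iota sigma p eta.
Implicit Types (X Y g h u : 'M[O]_3) (l m n : nat).
Local Notation pi := (iota p).
Local Notation mcong := (mcong pi).
Local Notation sim := (sim pi).
Local Notation st := (@star O 3 sigma).
Let pE := ud_O ud.

Lemma starM X Y : st (X *m Y) = st Y *m st X.
Proof. by rewrite /star trmx_mul map_mxM. Qed.

Lemma starK X : st (st X) = X.
Proof. by apply/matrixP => i j; rewrite !mxE (ud_invol ud). Qed.

Lemma starD X Y : st (X + Y) = st X + st Y.
Proof. by rewrite /star linearD map_mxD. Qed.

Lemma starN X : st (- X) = - st X.
Proof. by rewrite /star linearN map_mxN. Qed.

Lemma starZ a X : st (a *: X) = sigma a *: st X.
Proof. by rewrite /star linearZ map_mxZ. Qed.

Lemma star_scalar a : st a%:M = (sigma a)%:M.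
Proof. by rewrite /star tr_scalar_mx map_scalar_mx. Qed.

Lemma star1 : st 1%:M = 1%:M.
Proof. by rewrite star_scalar rmorph1. Qed.

Lemma star_unit X : (st X \in unitmx) = (X \in unitmx).
Proof. by rewrite !unitmxE /star det_map_mx det_tr; apply/idP/idP => [/(rmorph_unit sigma)|];
  [rewrite (ud_invol ud)|exact: rmorph_unit]. Qed.

Lemma star_inv X : X \in unitmx -> st (invmx X) = invmx (st X).
Proof.
move=> Xu; have Xu' : st X \in unitmx by rewrite star_unit.
by rewrite -[LHS]mulmx1 -(mulmxV Xu') mulmxA -starM mulmxV // star1 mul1mx.
Qed.

Lemma star_iota (M : 'M[o]_3) : st (map_mx iota M) = map_mx iota M^T.
Proof. by apply/matrixP => i j; rewrite !mxE (ud_iota ud). Qed.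

Lemma star_mcong k X Y : mcong k X Y -> mcong k (st X) (st Y).
Proof.
move=> [Z e]; exists (st Z); rewrite -starN -starD e starZ rmorphXn.
by rewrite (ud_iota ud).
Qed.

Lemma star_sim k X Y : sim k X Y -> sim k (st X) (st Y).
Proof.
move=> /sim_sym[g gu e]; exists (st g); first by rewrite star_unit.
by rewrite -!starM; apply/mcong_sym/star_mcong.
Qed.

Lemma sigma_cong k x y : cong pi k x y -> cong pi k (sigma x) (sigma y).
Proof.
by move=> [z e]; exists (sigma z); rewrite -rmorphB e rmorphM rmorphXn (ud_iota ud).
Qed.

Definition inv2 : O := 2^-1.

Lemma sigma_inv2 : sigma inv2 = inv2.
Proof. by rewrite /inv2 rmorphV ?(ud_2 ud) // rmorph_nat. Qed.

Lemma half2 x : inv2 * (x + x) = x.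
Proof.
rewrite -mulr2n -mulr_natl mulrA mulVr ?mul1r //; exact: (ud_2 ud).
Qed.

Lemma cong_real k z : cong pi k z (sigma z) -> exists x, cong pi k z (iota x).
Proof.
move=> [w e]; have /(ud_fixed ud)[x ex] : sigma (inv2 * (z + sigma z)) = inv2 * (z + sigma z).
  by rewrite rmorphM rmorphD (ud_invol ud) sigma_inv2 addrC.
exists x, (inv2 * w); rewrite -ex mulrCA -e -{1}(half2 z); ring.
Qed.

Lemma iota_unit x : (iota x \is a GRing.unit) = (x \is a GRing.unit).
Proof.
apply/idP/idP; last exact: rmorph_unit.
apply: contraTT => /(nunitP (ud_o ud))[y ->].
by rewrite rmorphM unitrM (negPf (uniformizer_nunit pE)).
Qed.

Lemma unit2 : 2 \is a @GRing.unit o.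
Proof. by rewrite -iota_unit rmorph_nat (ud_2 ud). Qed.

Lemma eta_sq : exists2 nu, nu \is a GRing.unit & eta ^+ 2 = iota nu.
Proof.
have /(ud_fixed ud)[nu e] : sigma (eta ^+ 2) = eta ^+ 2 by rewrite rmorphXn (ud_eta ud) sqrrN.
by exists nu => //; rewrite -iota_unit -e unitrX // (ud_eta_unit ud).
Qed.

Lemma finite_mcong k : exists n, nclasses [set: 'M[O]_3] (mcong k) n.
Proof.
have [n [I [r [_ _ rI rS]]]] := ud_fin ud k.
exists #|{: {ffun 'I_3 * 'I_3 -> I}}|, {ffun 'I_3 * 'I_3 -> I},
  (fun f : {ffun 'I_3 * 'I_3 -> I} => \matrix_(i, j) r (f (i, j))); split=> //.
- move=> f g /mcongP h; apply/ffunP => -[i j]; apply: rI.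
  by have := h i j; rewrite !mxE.
- move=> X _; have /choice[f fP] (ij : 'I_3 * 'I_3) : exists k', cong pi k (X ij.1 ij.2) (r k').
    exact: rS.
  exists [ffun ij => f ij]; apply/mcongP => i j; rewrite !mxE ffunE.
  exact: (fP (i, j)).
Qed.

Section HermitianRoot.
Variables (h : 'M[O]_3) (l : nat).
Hypotheses (hu : h \in unitmx) (hh : st h = h) (l0 : (0 < l)%N).

Definition ev (f : {poly o}) : 'M[O]_3 := horner_mx h (map_poly iota f).

Lemma evM (f g : {poly o}) : ev (f * g) = ev f *m ev g.
Proof. by rewrite /ev !rmorphM. Qed.

Lemma evD (f g : {poly o}) : ev (f + g) = ev f + ev g.
Proof. by rewrite /ev !rmorphD. Qed.

Lemma evB (f g : {poly o}) : ev (f - g) = ev f - ev g.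
Proof. by rewrite /ev !rmorphB. Qed.

Lemma evC a : ev a%:P = (iota a)%:M.
Proof. by rewrite /ev map_polyC horner_mx_C. Qed.

Lemma evX : ev 'X = h.
Proof. by rewrite /ev map_polyX horner_mx_X. Qed.

Lemma ev1 : ev 1 = 1%:M.
Proof. by rewrite /ev !rmorph1. Qed.

Lemma ev_star f : st (ev f) = ev f.
Proof.
elim/poly_ind: f => [|f c IH]; first by rewrite /ev !rmorph0 /star linear0 map_mx0.
rewrite evD evM evC evX starD starM hh IH star_scalar (ud_iota ud); congr (_ + _).
by rewrite -{1}evX -evM mulrC evM evX.
Qed.

Lemma ev_comm X f : mcong l (h *m X) (X *m h) -> mcong l (ev f *m X) (X *m ev f).
Proof.
move=> e; elim/poly_ind: f => [|f c IH].
  by rewrite /ev !rmorph0 mul0mx mulmx0; exact: mcong_refl.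
rewrite evD evM evC evX mulmxDl mulmxDr scalar_mxC; apply: mcongD; last exact: mcong_refl.
rewrite -mulmxA; apply: (mcong_trans (mcongMl _ e)).
by rewrite !mulmxA; exact: mcongMr.
Qed.

(** Presents o[h] modulo p^l as a quotient of o[X], so that [norm_mod] applies to it. *)
Definition ev_ideal : set {poly o} := [set f | mcong l (ev f) 0].

Lemma ev_ideal_ideal : is_ideal ev_ideal.
Proof.
split; rewrite /ev_ideal /=.
- by rewrite /ev !rmorph0; exact: mcong_refl.
- by move=> f g hf hg; rewrite evD -[0]addr0; exact: mcongD.
- by move=> f g hg; rewrite evM -(mulmx0 _ (ev f)); exact: mcongMl.
Qed.

Lemma ev_eqmod (f g : {poly o}) : eqmod ev_ideal f g <-> mcong l (ev f) (ev g).
Proof.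
rewrite /eqmod /ev_ideal /= evB; split=> e.
  by have := mcongD e (mcong_refl pi l (ev g)); rewrite subrK add0r.
by have := mcongD e (mcong_refl pi l (- ev g)); rewrite subrr.
Qed.

(* c is found as x + eta y with x, y in the commutative ring generated by h over o, where
   eta^2 = nu, so that the equation becomes x^2 - nu y^2 = h. *)
Lemma hermitian_root : exists c, [/\ mcong l (c *m st c) h, mcong l (st c *m c) h,
  c \in unitmx & forall X, mcong l (h *m X) (X *m h) -> mcong l (c *m X) (X *m c)].
Proof.
have JI := ev_ideal_ideal.
have [n Jn] : exists n, nclasses [set: {poly o}] (eqmod ev_ideal) n.
  have [N CN] := finite_mcong l.
  have eqm : equivalence (mcong l).
    by split; [exact: mcong_refl|exact: mcong_sym|exact: mcong_trans].
  have [n [I [r [cI rP rI rS]]]] := nclasses_preim ev eqm CN.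
  exists n, I, r; split=> // [i j|f _]; first by move=> /ev_eqmod; exact: rI.
  by have [i hi] := rS f Logic.I; exists i; apply/ev_eqmod.
have constU a : a \is a GRing.unit -> unitmod ev_ideal a%:P.
  move=> au; exists (a^-1)%:P; rewrite -polyCM mulVr // subrr; by case: JI.
have [nu nuu enu] := eta_sq.
(* The inverse of h must be a polynomial in h over o. Powers of h repeat modulo p^l, so some h^(j-i)
   is congruent to 1 with i < j. *)
have XU : unitmod ev_ideal 'X.
  have [I [r [_ _ rI rS]]] := Jn.
  have /choice[cl clP] f : exists i, eqmod ev_ideal f (r i) by exact: rS.
  have [i [j [ij e]]] : exists i j, (i < j)%N /\ cl 'X^i = cl 'X^j.
    apply: contrapT => H.
    have inj : injective (fun i : 'I_(#|I|.+1) => cl 'X^i).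
      move=> i j e; apply: val_inj => /=; case: (ltngtP i j) => // ij.
        by case: H; exists i, j.
      by case: H; exists j, i.
    by have := leq_card _ inj; rewrite card_ord ltnn.
  have eqJ := equiv_eqmod JI.
  have : eqmod ev_ideal 'X^i 'X^j.
    by apply: (eqv_trans eqJ (clP _)); rewrite e; exact: (eqv_sym eqJ).
  move=> /ev_eqmod hij; exists 'X^((j - i).-1); apply/ev_eqmod.
  rewrite ev1 -exprSr prednK ?subn_gt0 //.
  have evi k : ev 'X^k \in unitmx.
    elim: k => [|k IH]; first by rewrite expr0 ev1 unitmx1.
    by rewrite exprS evM evX unitmx_mul hu.
  have ej : ev 'X^j = ev 'X^i *m ev 'X^(j - i) by rewrite -evM -exprD subnKC // ltnW.
  have := mcongMl (invmx (ev 'X^i)) hij.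
  by rewrite ej mulKmx // mulVmx //; exact: mcong_sym.
have U2 : unitmod ev_ideal 2 by rewrite -(rmorph_nat polyC); exact: constU unit2.
have [x [y]] := norm_mod JI Jn U2 (constU _ nuu) XU.
rewrite -/(eqmod _ _ 'X) => /ev_eqmod; rewrite evX => e.
have exy : ev x *m ev y = ev y *m ev x by rewrite -!evM mulrC.
have sc : st (ev x + eta *: ev y) = ev x - eta *: ev y.
  by rewrite starD starZ !ev_star (ud_eta ud) scaleNr.
have en : ev (x ^+ 2 - nu%:P * y ^+ 2) = ev x *m ev x - (eta * eta) *: (ev y *m ev y).
  by rewrite !expr2 evB !evM evC mul_scalar_mx -enu expr2.
have c1 : (ev x + eta *: ev y) *m (ev x - eta *: ev y) = ev (x ^+ 2 - nu%:P * y ^+ 2).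
  rewrite en mulmxDl !mulmxBr -!scalemxAl -!scalemxAr scalerA exy.
  by rewrite addrA subrK.
have c2 : (ev x - eta *: ev y) *m (ev x + eta *: ev y) = ev (x ^+ 2 - nu%:P * y ^+ 2).
  rewrite en mulmxBl !mulmxDr -!scalemxAl -!scalemxAr scalerA exy.
  by rewrite opprD addrA addrK.
exists (ev x + eta *: ev y); rewrite sc c1 c2; split=> //.
  have : ev (x ^+ 2 - nu%:P * y ^+ 2) \in unitmx.
    by apply: (unitmx_mcong pE l0 (mcong_sym e)).
  by rewrite -c1 unitmx_mul => /andP[].
move=> X hX; rewrite mulmxDl mulmxDr -scalemxAl -scalemxAr.
by apply: mcongD; [|apply: mcongZ]; exact: ev_comm.
Qed.

End HermitianRoot.

Definition herm X := st X = X.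

Lemma mcong_cancell k g X Y : g \in unitmx -> mcong k (g *m X) (g *m Y) -> mcong k X Y.
Proof. by move=> gu /(mcongMl (invmx g)); rewrite !mulmxA mulVmx // !mul1mx. Qed.

(** A polar decomposition. As X and Y are Hermitian, h = g g^* commutes with X modulo p^l; so does
    the c with c c^* = h, since c is a polynomial in h over O. Then u = c^-1 g is unitary modulo p^l
    and still intertwines X and Y. *)
Lemma herm_sim_unitary_mod l X Y : (0 < l)%N -> herm X -> herm Y -> sim l X Y ->
  exists u, [/\ u \in unitmx, mcong l (st u *m u) 1%:M & mcong l (X *m u) (u *m Y)].
Proof.
move=> l0 hX hY [g gu e].
have hu : g *m st g \in unitmx by rewrite unitmx_mul star_unit gu.
have hh : st (g *m st g) = g *m st g by rewrite starM starK.
have [c [c1 _ cu cc]] := hermitian_root hu hh l0.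
have hcomm : mcong l ((g *m st g) *m X) (X *m (g *m st g)).
  have e' : mcong l (st g *m X) (Y *m st g).
    by have := star_mcong e; rewrite !starM hX hY.
  apply: mcong_sym; rewrite !mulmxA; apply: (mcong_trans (mcongMr _ e)).
  by rewrite -!mulmxA; apply/mcongMl/mcong_sym.
have {}cc := cc _ hcomm; pose u := invmx c *m g.
have uu : u \in unitmx by rewrite unitmx_mul unitmx_inv cu.
have ustu : mcong l (u *m st u) 1%:M.
  have scu : st c \in unitmx by rewrite star_unit.
  have := mcongMr (invmx (st c)) (mcongMl (invmx c) c1).
  rewrite /u starM star_inv // !mulmxA mulVmx // mul1mx mulmxV //.
  exact: mcong_sym.
exists u; split=> //.
  apply: (mcong_cancell uu); rewrite mulmxA mulmx1 -[X in mcong _ _ X]mul1mx.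
  exact: mcongMr.
apply: (mcong_cancell cu); rewrite /u !mulmxA mulmxV // mul1mx.
apply: (mcong_trans (mcongMr _ (mcongMr _ cc))).
by rewrite -!mulmxA mulKVmx.
Qed.

(** Interpolates a binary cubic form from its values at (1,0), (0,1), (1,1) and (1,-1); the factor 2
    clears denominators. *)
Lemma det_pencil (P Q : 'M[O]_3) x y :
  2 * \det (x *: P + y *: Q) =
  2 * x ^+ 3 * \det P + x ^+ 2 * y * (\det (P + Q) - \det (P - Q) - 2 * \det Q)
  + x * y ^+ 2 * (\det (P + Q) + \det (P - Q) - 2 * \det P) + 2 * y ^+ 3 * \det Q.
Proof. by rewrite !det3 !mxE; ring. Qed.

Lemma eta_shift_unit : 1 + eta \is a GRing.unit /\ 1 - eta \is a GRing.unit.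
Proof.
have H e : sigma e = - e -> 1 + e \is a GRing.unit.
  move=> se; apply: contraT => /(cong1P pE) h.
  have := sigma_cong h; rewrite rmorphD rmorph1 se rmorph0 => h'.
  have e2 : 1 + e + (1 - e) = 2 by ring.
  have := congD h h'; rewrite addr0 e2.
  by move=> /(cong1P pE); rewrite (ud_2 ud).
by split; apply: H; rewrite ?rmorphN (ud_eta ud).
Qed.

(* For z = x + y eta with x, y fixed by sigma, det (z u + sigma z) is a cubic form in (x, y).
   If it vanished modulo p at (1,0), (0,1), (1,1), (1,-1), it would vanish identically,
   but at (eta, 1) its value is det (2 eta u). *)
Lemma cayley_scalar u : u \in unitmx ->
  exists2 z, z \is a GRing.unit & z *: u + (sigma z)%:M \in unitmx.
Proof.
move=> uu; pose P := u + 1%:M; pose Q := eta *: u - eta%:M.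
have [u1 u2] := eta_shift_unit.
apply: contrapT => H.
have N z : z \is a GRing.unit -> \det (z *: u + (sigma z)%:M) \isn't a GRing.unit.
  by move=> zu; rewrite -unitmxE; apply/negP => h; apply: H; exists z.
have dP : \det P \isn't a GRing.unit.
  by have := N 1 (unitr1 _); rewrite scale1r rmorph1.
have dQ : \det Q \isn't a GRing.unit.
  by have := N _ (ud_eta_unit ud); rewrite (ud_eta ud) raddfN.
have d1 : \det (P + Q) \isn't a GRing.unit.
  have := N _ u1; rewrite rmorphD rmorph1 (ud_eta ud) scalerDl scale1r raddfB /=.
  by rewrite /P /Q addrACA.
have d2 : \det (P - Q) \isn't a GRing.unit.
  have := N _ u2; rewrite rmorphB rmorph1 (ud_eta ud) opprK scalerBl scale1r raddfD /=.
  have -> : P - Q = u - eta *: u + (1%:M + eta%:M); last by [].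
  by rewrite /P /Q opprB [eta%:M - _]addrC addrACA.
have e : eta *: P + 1 *: Q = (2 * eta) *: u.
  by rewrite scale1r /P /Q scalerDr scale_scalar_mx mulr1 addrACA subrr addr0 -scalerDl mulrDl mul1r.
have := det_pencil P Q eta 1; rewrite e.
have : 2 * \det ((2 * eta) *: u) \is a GRing.unit.
  by rewrite detZ !(unitrM, unitrX) ?(ud_2 ud) ?(ud_eta_unit ud) // -unitmxE.
move=> + e'; rewrite e'; apply/negP.
apply: (nunitD pE); last exact: nunitMr.
apply: (nunitD pE); last first.
  apply: nunitMr; apply: (nunitD pE); first exact: (nunitD pE).
  by rewrite unitrN; exact: nunitMr.
apply: (nunitD pE); first exact: nunitMr.
apply: nunitMr; apply: (nunitD pE); last by rewrite unitrN; exact: nunitMr.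
by apply: (nunitD pE) => //; rewrite unitrN.
Qed.

Lemma half2m X : inv2 *: (X + X) = X.
Proof. by apply/matrixP => i j; rewrite !mxE half2. Qed.

(* The Cayley transform of a scalar multiple of u is skew-Hermitian modulo p^l, and a
   skew-Hermitian matrix modulo p^l lifts to an exact one. *)
Lemma lift_unitary l u : (0 < l)%N -> u \in unitmx -> mcong l (st u *m u) 1%:M ->
  exists2 v, GU3 sigma v & mcong l v u.
Proof.
move=> l0 uu e; have [z zu Wu] := cayley_scalar uu.
set W := _ + _ in Wu; pose N := z *: u - (sigma z)%:M.
pose Y := N *m invmx W; pose Y' := inv2 *: (Y - st Y); pose B := 1%:M - Y'.
have szu : sigma z \is a GRing.unit by exact: rmorph_unit.
have uW : u *m W = W *m u.
  by rewrite /W mulmxDl mulmxDr -scalemxAr -scalemxAl scalar_mxC.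
have uWi : invmx W *m u = u *m invmx W.
  by rewrite -[LHS]mulmx1 -(mulmxV Wu) mulmxA -(mulmxA _ u W) uW mulmxA mulVmx // mul1mx.
have sY' : st Y' = - Y'.
  by rewrite /Y' starZ sigma_inv2 starD starN starK -scalerN opprB addrC.
have sB : st B = 1%:M + Y' by rewrite /B starD star1 starN sY' opprK.
have YY : mcong l (Y + st Y) 0.
  have sWu : st W \in unitmx by rewrite star_unit.
  apply: (mcong_cancelr Wu); apply: (mcong_cancell sWu).
  rewrite mul0mx mulmx0 mulmxDl mulmxDr /Y starM star_inv // !mulmxA mulmxV // mul1mx.
  rewrite -(mulmxA _ (invmx W) W) mulVmx // mulmx1.
  have -> : st W *m N + st N *m W = (2 * z * sigma z) *: (st u *m u - 1%:M).
    rewrite /W /N !starD starN !starZ !star_scalar (ud_invol ud).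
    rewrite !mulmxDl !mulmxDr !mulmxN !mulNmx -!scalemxAl -!scalemxAr.
    rewrite !mul_scalar_mx !mul_mx_scalar !scale_scalar_mx !scalerA scalerBr.
    rewrite scale_scalar_mx.
    by apply/matrixP => i j; rewrite !mxE; ring.
  have := mcongZ (2 * z * sigma z) (mcongD e (mcong_refl pi l (- 1%:M))).
  by rewrite subrr scaler0.
have Y'Y : mcong l Y' Y.
  have := mcongZ (- inv2) YY; rewrite scaler0 => /mcongD/(_ (mcong_refl pi l Y)).
  rewrite add0r; congr mcong; rewrite -{3}[Y]half2m scaleNr -scalerN -scalerDr /Y'.
  by congr (_ *: _); rewrite opprD addrACA addNr add0r addrC.
have B1 : 1%:M - Y = (2 * sigma z) *: invmx W.
  rewrite -[LHS](mulmxK Wu) mulmxBl mul1mx /Y -(mulmxA N) mulVmx // mulmx1.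
  rewrite /W /N opprB addrC addrA subrK -raddfD /= mul_scalar_mx; congr (_ *: _); ring.
have C1 : 1%:M + Y = (2 * z) *: (u *m invmx W).
  rewrite -[LHS](mulmxK Wu) mulmxDl mul1mx /Y -(mulmxA N) mulVmx // mulmx1.
  rewrite /W /N addrACA subrr addr0 -scalerDl scalemxAl; congr (_ *: _ *m _); ring.
have B1Y : mcong l B (1%:M - Y).
  by apply: mcongD; [exact: mcong_refl|exact: mcongN].
have Bu : B \in unitmx.
  apply: (unitmx_mcong pE l0 (mcong_sym B1Y)); rewrite B1 unitmxZ ?unitmx_inv //.
  by rewrite unitrM (ud_2 ud) szu.
have sBu : st B \in unitmx by rewrite star_unit.
have BB : B *m st B = st B *m B.
  have H V : (1%:M - V) *m (1%:M + V) = (1%:M + V) *m (1%:M - V) :> 'M[O]_3.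
    rewrite !(mulmxDl, mulmxDr, mulmxN, mulNmx, mul1mx, mulmx1).
    by move: (V *m V) => V2; apply/matrixP => i j; rewrite !mxE; ring.
  by rewrite sB; exact: H.
(* Inverting the transform gives (1 - Y)^-1 (1 + Y) = (z / sigma z) u; the factor a has norm 1 and
   removes the scalar. *)
pose a := sigma z / z; have au : a \is a GRing.unit by rewrite unitrM unitrV szu.
have sa : sigma a * a = 1.
  rewrite /a rmorphM rmorphV // (ud_invol ud) -mulrA (mulrA _ (sigma z)) mulVr //.
  by rewrite mul1r mulrV.
exists (a *: (invmx B *m st B)); first split.
- by rewrite unitmxZ // unitmx_mul unitmx_inv Bu.
- rewrite starZ -scalemxAl -scalemxAr scalerA sa scale1r starM starK star_inv //.
  have e1 : B *m invmx (st B) = invmx (st B) *m B.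
    by rewrite -[LHS](mulKmx sBu) (mulmxA (st B)) -BB mulmxK.
  by rewrite e1 -!mulmxA mulKVmx // mulVmx.
- apply: (mcong_cancell Bu); rewrite -scalemxAr mulKVmx // sB.
  apply: mcong_trans (mcongZ a (mcongD (mcong_refl pi l _) Y'Y)) _.
  apply: mcong_trans (mcongMr u (mcong_sym B1Y)).
  rewrite C1 B1 -scalemxAl uWi scalerA.
  by have -> : a * (2 * z) = 2 * sigma z; [rewrite mulrCA /a divrK|exact: mcong_refl].
Qed.

Lemma herm_sim_unitary l X Y : herm X -> herm Y ->
  sim l X Y <-> exists2 g, GU3 sigma g & mcong l (X *m g) (g *m Y).
Proof.
move=> hX hY; split=> [S|[g [gu _] e]]; last by exists g.
case: l S => [_|l S].
  by exists 1%:M; [split; [exact: unitmx1|rewrite star1 mulmx1]|exact: mcong0].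
have [u [uu u1 e]] := herm_sim_unitary_mod (ltn0Sn l) hX hY S.
have [v vU vu] := lift_unitary (ltn0Sn l) uu u1; exists v => //.
apply: mcong_trans (mcongMl X vu) (mcong_trans e _).
exact: mcongMr (mcong_sym vu).
Qed.

(* With S = c^* c, the matrix c M c^-1 is Hermitian. *)
Lemma sim_herm_form l (S M : 'M[o]_3) : (0 < l)%N -> S \in unitmx -> S^T = S ->
  S *m M = M^T *m S -> exists2 X, herm X & sim l X (map_mx iota M).
Proof.
move=> l0 Su St SM; pose h := map_mx iota S; pose N := map_mx iota M.
have hu : h \in unitmx by rewrite unitmxE det_map_mx rmorph_unit // -unitmxE.
have hh : st h = h by rewrite star_iota St.
have hN : h *m N = st N *m h by rewrite star_iota -!map_mxM SM.
have [c [_ c1 cu _]] := hermitian_root hu hh l0.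
have scu : st c \in unitmx by rewrite star_unit.
pose X' := c *m N *m invmx c.
have X'h : mcong l (st X') X'.
  apply: (mcong_cancell scu); apply: (mcong_cancelr cu).
  rewrite /X' !starM star_inv // !mulmxA mulmxV // mul1mx.
  rewrite -!mulmxA mulVmx // mulmx1.
  apply: mcong_trans (mcongMl _ c1) _; rewrite -hN mulmxA.
  exact: mcongMr (mcong_sym c1).
exists (inv2 *: (X' + st X')).
  by rewrite /herm starZ sigma_inv2 starD starK addrC.
apply: (@sim_trans _ _ _ X').
  apply: mcong_sim; have := mcongZ inv2 (mcongD (mcong_refl pi l X') X'h).
  by rewrite half2m.
by apply: simx_sim; exists c => //; rewrite /X' -mulmxA mulVmx // mulmx1.
Qed.

Lemma map_frob t d k a :
  map_mx iota (frob t d k a) = frob (iota t) (iota d) (iota k) (iota a).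
Proof.
apply/matrixP => i j; rewrite !mxE.
by case: (ord3E i) => ->; case: (ord3E j) => ->; rewrite /= ?rmorph0 ?rmorph1.
Qed.

Lemma map_nform c t d k a : map_mx iota (nform c t d k a) =
  nform (iota c) (iota t) (iota d) (iota k) (iota a).
Proof. by rewrite /nform map_mxD map_scalar_mx map_frob. Qed.

Lemma map_aform m c v : map_mx iota (aform p c m v.1 v.2.1 v.2.2) = aformp iota p m c v.
Proof. by rewrite map_nform !rmorphM !rmorphXn. Qed.

Lemma sym_nform (S : 'M[o]_3) c t d k a : S *m frob t d k a = (frob t d k a)^T *m S ->
  S *m nform c t d k a = (nform c t d k a)^T *m S.
Proof.
by move=> e; rewrite /nform mulmxDr e linearD mulmxDl /= tr_scalar_mx scalar_mxC.
Qed.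

(** The matrix given to [sim_herm_form] is the Gram matrix of an invertible symmetric form for which
    the cyclic form is self-adjoint. *)
Lemma herm_frobp l v : (0 < l)%N -> exists2 X, herm X & sim l X (frobp iota v).
Proof.
move=> l0; have -> : frobp iota v = map_mx iota (frob v.1.1 v.1.2 1 v.2).
  by rewrite map_frob rmorph1.
apply: (@sim_herm_form l (mx3 0 0 1 0 1 0 1 0 (- v.1.2))) => //.
- by rewrite unitmxE det_mx3 (_ : _ + _ = - 1) ?unitrN ?unitr1 //; ring.
- by rewrite tr_mx3.
- by rewrite tr_mx3 !mul_mx3; congr mx3; ring.
Qed.

Lemma herm_aformp l m c v : (0 < m <= l)%N ->
  (m = l \/ ~~ nunit3 v.1 v.2.1 v.2.2) ->
  exists2 X, herm X & sim l X (aformp iota p m c v).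
Proof.
move=> /andP[m0 ml] H; have l0 : (0 < l)%N by apply: leq_trans ml.
case: v H => [t [d k]] /= H; have [lm|nu] : m = l \/ ~~ nunit3 t d k by [].
  (* For m = l the entries d, k, a vanish modulo p^l, and what remains is self-adjoint for the
     symmetric matrix below whatever t is. *)
  have [X hX SX] : exists2 X, herm X & sim l X (map_mx iota (nform c t 0 0 0)).
    apply: (@sim_herm_form l (mx3 0 1 0 1 t 0 0 0 1)) => //.
    - by rewrite unitmxE det_mx3 (_ : _ + _ = - 1) ?unitrN ?unitr1 //; ring.
    - by rewrite tr_mx3.
    - by apply: sym_nform; rewrite tr_mx3 !mul_mx3; congr mx3; ring.
  exists X => //; apply: (sim_trans SX); apply: mcong_sim.
  rewrite map_nform rmorph0 /aformp /aform !nformE lm.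
  apply: mcong_mx3; try exact: cong_refl; try by apply/cong_sym/cong_expl.
  by rewrite -[X in cong _ _ _ X]mulr1; apply/cong_sym/cong_expl.
rewrite -map_aform /=; pose pm := p ^+ m.
(* Modulo p the Gram matrix used below has determinant - b (t c1^2 + d c1 d0 + k d0^2), so both
   factors must be units. *)
have [a [b [c1 [d0 [eb bu Qu]]]]] : exists a b c1 d0,
    [/\ b = d * c1 + t * a + k * d0, b \is a GRing.unit &
        t * c1 ^+ 2 + d * c1 * d0 + k * d0 ^+ 2 \is a GRing.unit].
  have oP := ud_o ud.
  have [tu|tn] := boolP (t \is a GRing.unit).
    exists ((1 - d) / t), 1, 1, 0; split; rewrite ?unitr1 //.
      by rewrite mulrCA mulrV // ; ring.
    by have -> : t * 1 ^+ 2 + d * 1 * 0 + k * 0 ^+ 2 = t by ring.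
  have [ku|kn] := boolP (k \is a GRing.unit).
    exists 0, k, 0, 1; split=> //; first by ring.
    by have -> : t * 0 ^+ 2 + d * 0 * 1 + k * 1 ^+ 2 = k by ring.
  have du : d \is a GRing.unit.
    by move: nu; rewrite /nunit3 tn kn /= andbT negbK.
  exists 0, (d + k), 1, 1; split; first by ring.
    exact: (unitD_nunit oP).
  have -> : t * 1 ^+ 2 + d * 1 * 1 + k * 1 ^+ 2 = d + (t + k) by ring.
  by apply: (unitD_nunit oP) => //; exact: (nunitD oP).
(* The Gram matrix of a symmetric form for which the operator is self-adjoint: everything
   follows from a = B(e1,e1), b = B(e1,e2), c1 = B(e1,e3), d0 = B(e3,e3), and the relation
   B(X e2,e3) = B(e2,X e3) reads p^m (d c1 + t a + k d0) = p^m b. *)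
apply: (@sim_herm_form l (mx3 a b c1 b (pm * d * a + t * b + pm * k * c1) (pm * a)
    c1 (pm * a) d0)) => //.
- rewrite unitmxE.
  have -> : \det (mx3 a b c1 b (pm * d * a + t * b + pm * k * c1) (pm * a) c1 (pm * a) d0) =
      - b * (t * c1 ^+ 2 + d * c1 * d0 + k * d0 ^+ 2)
      + pm * (a * ((d * a + k * c1) * d0 - a * (pm * a)) + 2 * a * b * c1
              - c1 * (d * a + k * c1) * c1).
    by rewrite det_mx3 eb; ring.
  apply: unitD_nunit; first exact: (ud_o ud).
    by rewrite unitrM unitrN bu.
  exact: (nunit_exp (ud_o ud)).
- by rewrite tr_mx3.
- apply: sym_nform; rewrite tr_mx3 !mul_mx3; congr mx3; rewrite -/pm ?eb; ring.
Qed.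

Lemma iota_congI k x y : cong pi k (iota x) (iota y) -> cong p k x y.
Proof.
move=> [z e]; have /(ud_fixed ud)[w ew] : sigma z = z.
  apply: (mulfI (expp_neq0 pE k)); rewrite -[in LHS](ud_iota ud p).
  by rewrite -rmorphXn -rmorphM -e rmorphB !(ud_iota ud).
by exists w; apply: (ud_inj ud); rewrite rmorphB rmorphM rmorphXn -ew.
Qed.

Lemma map_tr_herm X : herm X ->
  [/\ sigma (\tr X) = \tr X, sigma (trace2 X) = trace2 X & sigma (\det X) = \det X].
Proof.
move=> hX; have e i j : sigma (X i j) = X j i by rewrite -{2}hX !mxE.
by split; rewrite /mxtrace ?sum3 /trace2 ?det3 !(rmorphD, rmorphN, rmorphM) /= !e; ring.
Qed.

Lemma cong_real_of k z w : cong pi k z w -> sigma w = w -> exists x, cong pi k z (iota x).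
Proof. by move=> zw /(ud_fixed ud)[x ex]; exists x; rewrite -ex. Qed.

Lemma cyclic_real l X t d a : herm X -> sim l X (frob t d 1 a) ->
  exists v, sim l X (frobp iota v).
Proof.
move=> hX S; have [r1 r2 r3] := map_tr_herm hX.
have [h1 h2 h3] := sim_invariants (sim_sym S); move: h1 h2 h3.
rewrite !frobE mulr1 => h1 h2 h3.
have [t' tt] := cong_real_of h1 r1; have [a' aa] := cong_real_of h3 r3.
have [d' dd] : exists d', cong pi l d (iota d').
  have := congN h2; rewrite opprK => /cong_real_of; apply.
  by rewrite rmorphN r2.
exists (t', d', a'); apply: (sim_trans S); apply: mcong_sim.
by apply: mcong_mx3 => //; exact: cong_refl.
Qed.

Lemma cong_real_divp m l z w : cong pi (m + l) (pi ^+ m * z) w -> sigma w = w ->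
  exists x, cong pi l z (iota x).
Proof.
move=> zw sw; apply: cong_real; apply: (cong_divp pE (l := m)).
apply: (cong_trans zw); have := sigma_cong zw; rewrite sw rmorphM rmorphXn (ud_iota ud).
exact: cong_sym.
Qed.

Lemma quad_star k a b X : herm X -> quad pi k a b X -> quad pi k (sigma a) (sigma b) X.
Proof.
move=> hX /star_mcong; rewrite starM starD starZ star_scalar hX.
by [].
Qed.

(** Each parameter is an invariant at the precision at which it matters, and invariants of a
    Hermitian matrix are fixed by sigma. First c: applying [star] to the quadratic equation shows
    that 2 c + t is fixed modulo p^m, and the trace shows it for 3 c + t. After a shift to c in o,
    the trace, second coefficient and precise determinant treat t, d, k. *)
Lemma aform_real l m X c t d k : (m <= l)%N -> herm X -> sim l X (aform pi c m t d k) ->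
  exists c' v, sim l X (aformp iota p m c' v).
Proof.
move=> ml hX S; have S' := sim_sym S.
have [c0 hc] : exists c0, cong pi m c (iota c0).
  apply: cong_real.
  have q1 := quad_sim ml S' (nform_quad c t (cong_expl pi d (leqnn m)) (cong_expl pi k (leqnn m))
    (ltac:(by exists 1; rewrite subr0 mulr1))).
  have [e1 _ _ _] := quad_nform (quad_sim ml S (quad_star hX q1)).
  have [r1 _ _] := map_tr_herm hX.
  have [h1 _ _] := sim_invariants (sim_le ml S'); move: h1.
  rewrite /aform nformE /mxtrace sum3 !mx3E => h1.
  have := sigma_cong h1; rewrite r1 => h2.
  have := congB (cong_trans h2 (cong_sym h1)) e1.
  rewrite !rmorphD !rmorphM !rmorph_nat.
  rewrite (_ : _ - _ = sigma c); last by ring.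
  by rewrite (_ : _ - _ = c); [exact: cong_sym|ring].
have [t1 [d1 [k1 h]]] := aform_shift_to t d k hc.
have {S S'} S := sim_trans S (simx_sim pi l h).
pose Y := X - (iota c0)%:M.
have hY : herm Y by rewrite /herm /Y starD starN star_scalar (ud_iota ud) hX.
have [r1 r2 r3] := map_tr_herm hY.
have SY : sim l (frob t1 (pi ^+ m * d1) (pi ^+ m * k1) (pi ^+ m)) Y.
  by apply/sim_sym/(sim_shift pi l (iota c0)); rewrite /Y addrC subrK.
have [h1 h2 _] := sim_invariants SY; have h3 := sim_det_precise ml SY.
rewrite !frobE in h1 h2; rewrite mulrA -exprD in h3.
have [t' tt] := cong_real_of h1 r1.
have [d' dd] : exists d', cong pi (l - m) d1 (iota d').
  apply: (@cong_real_divp m _ _ (- trace2 Y)); last by rewrite rmorphN r2.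
  by rewrite subnKC //; have := congN h2; rewrite opprK.
have [k' kk] : exists k', cong pi (l - m) k1 (iota k').
  by apply: (@cong_real_divp (m + m) _ _ (\det Y)) => //; rewrite -addnA subnKC.
exists c0, (t', (d', k')); apply: (sim_trans S).
exact: cong_params.
Qed.

Lemma iota_nunit3 t d k : nunit3 (iota t) (iota d) (iota k) = nunit3 t d k.
Proof. by rewrite /nunit3 !iota_unit. Qed.

Lemma star_aform m c t d k :
  st (aform pi c m t d k) = (aform pi (sigma c) m (sigma t) (sigma d) (sigma k))^T.
Proof.
apply/matrixP => i j; rewrite /aform !nformE !mxE.
by case: (ord3E i) => ->; case: (ord3E j) => ->;
  rewrite /= ?(rmorphM, rmorphD, rmorphXn) ?(ud_iota ud) ?rmorph0 ?rmorph1.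
Qed.

(** Over o, [star] is transposition, so a Hermitian X would make the form similar to its own
    transpose. *)
Lemma aformp_prim l m X c v : (0 < m < l)%N -> herm X -> sim l X (aformp iota p m c v) ->
  ~~ nunit3 v.1 v.2.1 v.2.2.
Proof.
move=> ml hX S; apply/negP; rewrite -iota_nunit3 => nu.
have := star_sim S; rewrite hX star_aform !(ud_iota ud) => S'.
have := sim_trans (sim_sym S') S.
by apply: (aform_tr_absurd pE ml) nu; case/andP: ml => _ /ltnW.
Qed.

(** Here the parameters lie in O; [star] turns the transposed form into an untransposed one with
    conjugate parameters, which is not similar to it. *)
Lemma dual_herm_absurd l m X c t d k : (0 < m < l)%N -> herm X -> nunit3 t d k ->
  ~ sim l X (aform pi c m t d k)^T.
Proof.
move=> ml hX nu S; have := star_sim S; rewrite hX => S'.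
have e : st (aform pi c m t d k)^T = aform pi (sigma c) m (sigma t) (sigma d) (sigma k).
  by rewrite -[RHS]trmxK -star_aform /star trmxK map_trmx trmxK.
have := sim_trans (sim_sym S) S'; rewrite e.
by apply: (aform_tr_absurd pE ml) nu; case/andP: ml => _ /ltnW.
Qed.

(** * Counting similarity classes of Hermitian matrices *)

Variable q : nat.
Hypothesis residue : nclasses [set: o] (cong p 1) q.

Definition herm_subs l m X := herm X /\ exists c v, sim l X (aformp iota p m c v).

Lemma count_herm_top l : (0 < l)%N ->
  nclasses (herm_subs l l) (sim l) (nsubs q l l).
Proof.
move=> l0; apply: (count_aform (ud_o ud) pE iota_congI residue (leqnn l)
  (count_params (ud_o ud) residue l l)).
- move=> c v _; have [|X hX S] := @herm_aformp l l c v _ (or_introl erefl).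
    by rewrite l0 leqnn.
  by exists X => //; split=> //; exists c, v.
- move=> X [_ [c [v S]]]; exists c => c' cc'.
  have [t' [d' [k' h]]] := aform_shift_to v.1 v.2.1 v.2.2 cc'.
  exists (t', (d', k')) => //; apply: (sim_trans S); apply: simx_sim.
  have [g gu e] := h; exists (map_mx iota g).
    by rewrite unitmxE det_map_mx rmorph_unit // -unitmxE.
  by rewrite -!map_aform -!map_mxM e.
Qed.

Lemma count_herm_lower l m : (0 < m < l)%N ->
  exists2 n, nclasses (herm_subs l m) (sim l) n & (n + nduals q l m)%N = nsubs q l m.
Proof.
move=> ml; have /andP[m0 ml'] := ml.
have l0 : (0 < l)%N by apply: ltn_trans ml'.
have lm0 : (0 < l - m)%N by rewrite subn_gt0.
have [k Vk ek] := nclassesD (equiv_cong3 p l m) (@subsetT _ (@nunit_params o))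
  (ltac:(by move=> v w [h1 [h2 h3]];
     rewrite /nunit_params /= /nunit3 (cong_nunit (ud_o ud) l0 h1)
       (cong_nunit (ud_o ud) lm0 h2) (cong_nunit (ud_o ud) lm0 h3)))
  (count_params (ud_o ud) residue l m) (count_params_nunit (ud_o ud) residue ml').
exists (q ^ m * k)%N; last by rewrite /nduals /nsubs -mulnDr ek.
apply: (count_aform (ud_o ud) pE iota_congI residue (ltnW ml') Vk).
- move=> c v [_ /negP nv]; have [|X hX S] := @herm_aformp l m c v _ (or_intror nv).
    by rewrite m0 ltnW.
  by exists X => //; split=> //; exists c, v.
- move=> X [hX [c [v S]]]; exists c => c' cc'.
  have [t' [d' [k' h]]] := aform_shift_to v.1 v.2.1 v.2.2 cc'.
  have S' : sim l X (aformp iota p m c' (t', (d', k'))).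
    apply: (sim_trans S); apply: simx_sim; have [g gu e] := h.
    exists (map_mx iota g).
    by rewrite unitmxE det_map_mx rmorph_unit // -unitmxE.
    by rewrite -!map_aform -!map_mxM e.
  exists (t', (d', k')) => //; split=> // nu.
  by have := aformp_prim ml hX S'; rewrite nu.
Qed.

(** The sum of the [nduals], which GL_3 adds, is subtracted here; it stands on the left to avoid
    truncated subtraction. *)
Lemma count_herm l n : nclasses herm (sim l) n ->
  exists2 N, nclasses herm (sim l.+1) N &
    (N + \sum_(m <- index_iota 1 l.+1) nduals q l.+1 m =
     q * n + (q ^ l.+1 * q ^ l.+1 * q ^ l.+1 + \sum_(m <- index_iota 1 l.+2) nsubs q l.+1 m))%N.
Proof.
move=> Cn.
have C1 : nclasses [set X | herm X /\ scalar_mod pi X] (sim l.+1) (q * n).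
  apply: (count_scalar pE iota_congI residue) Cn.
  - move=> c X hX.
    by rewrite /herm starD star_scalar starZ !(ud_iota ud) hX.
  - move=> X hX [c [Z e]].
    have [c0 e0] : exists c0, X i0 i0 = iota c0.
      by apply: (ud_fixed ud); rewrite -{2}hX !mxE.
    have cc0 : cong pi 1 c (iota c0).
      move/matrixP: e => /(_ i0 i0); rewrite !mxE eqxx mulr1n e0 => e.
      by apply: cong_sym; exists (Z i0 i0).
    exists c0 => c' /(cong_iota iota) c0c'.
    have [w ew] := cong_trans cc0 c0c'.
    have eX : X = (iota c')%:M + pi *: (Z + w%:M).
      rewrite -[LHS](subrK c%:M) e expr1 scalerDr scale_scalar_mx.
      by rewrite expr1 in ew; rewrite -ew raddfB /= [in RHS]addrC -[RHS]addrA subrK.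
    exists (Z + w%:M) => //; rewrite /herm.
    have h0 : st ((iota c')%:M + pi *: (Z + w%:M)) = (iota c')%:M + pi *: (Z + w%:M).
      by rewrite -eX.
    rewrite [LHS]starD star_scalar starZ !(ud_iota ud) in h0; move/addrI: h0 => h.
    apply/matrixP => i j; apply: (mulfI (uniformizer_neq0 pE)).
    by move/matrixP: h => /(_ i j); rewrite !mxE.
pose cyc := [set X | herm X /\ exists v, sim l.+1 X (frobp iota v)].
have C2 : nclasses cyc (sim l.+1) (q ^ l.+1 * q ^ l.+1 * q ^ l.+1).
  apply: (count_cyclic (ud_o ud) iota_congI residue); last by move=> X [].
  by move=> v; have [X hX S] := herm_frobp v (ltn0Sn l); exists X => //; split=> //; exists v.
have /choice[f fP] m : exists k, (0 < m < l.+2)%N ->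
   nclasses (herm_subs l.+1 m) (sim l.+1) k /\
   (k + (if (m < l.+1)%N then nduals q l.+1 m else 0) = nsubs q l.+1 m)%N.
  have [ml|ml] := ltnP m l.+1.
    have [m0|m0] := posnP m; first by exists 0%N; rewrite m0.
    have [|k Ck ek] := @count_herm_lower l.+1 m; first by rewrite m0.
    by exists k.
  exists (nsubs q l.+1 m) => /andP[_ ml']; have -> : m = l.+1 by lia.
  by split; [exact: count_herm_top|rewrite addn0].
pose S := [set X | exists2 m, m \in index_iota 1 l.+2 & herm_subs l.+1 m X].
have C3 : nclasses S (sim l.+1) (\sum_(m <- index_iota 1 l.+2) f m).
  apply: (nclasses_bigU (equiv_sim pi l.+1)); first exact: iota_uniq.
    by move=> m; rewrite mem_index_iota => ml; have [] := fP m ml.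
  move=> i j X Y; rewrite !mem_index_iota => /andP[_ il] /andP[_ jl].
  move=> [_ [c [v h]]] [_ [c' [v' h']]] XY.
  by have [] := @aform_level _ _ pE l.+1 i j _ _ _ _ _ _ _ _ il jl
    (sim_trans (sim_trans (sim_sym h) XY) h').
exists (q * n + (q ^ l.+1 * q ^ l.+1 * q ^ l.+1 + \sum_(m <- index_iota 1 l.+2) f m))%N.
  have -> : herm = [set X | herm X /\ scalar_mod pi X] `|` (cyc `|` S).
    apply/seteqP; split=> X; last by move=> [[]|[[]|[m _ []]]].
    move=> hX; have [sX|nX] := pselect (scalar_mod pi X); first by left.
    right; have [[t [d [a h]]]|[m [c [t [d [k [ml h]]]]]]|[m [c [t [d [k [ml nu h]]]]]]] :=
      nonscalar_classify pE (ltn0Sn l) nX.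
    - by left; split=> //; exact: cyclic_real h.
    - right; exists m; first by rewrite mem_index_iota.
      by split=> //; apply: aform_real hX h; case/andP: ml.
    - by have := dual_herm_absurd ml hX nu h.
  have nsc X Y c t d k a : scalar_mod pi X -> sim l.+1 X Y -> ~ sim l.+1 Y (nform c t d k a).
    move=> sX XY h; apply: (@nform_nscalar _ pi pE c t d k a).
    exact: scalar_mod_sim (sim_trans XY h) sX.
  apply: (nclassesU (equiv_sim pi _)) C1 _; last apply: (nclassesU (equiv_sim pi _)) C2 C3.
  - move=> X Y [_ sX] [[_ [v h]]|[m _ [_ [c [v h]]]]] XY.
      by move: h; rewrite /frobp frob_nform; exact: nsc XY.
    exact: nsc XY h.
  - move=> X Y [_ [v h]] [m ml [_ [c' [v' h']]]] XY; rewrite mem_index_iota in ml.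
    by have := sim_trans (sim_trans (sim_sym h) XY) h'; exact: (frob_aform_absurd pE).
rewrite -!addnA; congr (_ + (_ + _))%N.
rewrite [in RHS](eq_big_nat _ _ (F2 := fun m => f m +
  (if (m < l.+1)%N then nduals q l.+1 m else 0))%N); last first.
  by move=> m ml; have [_ ->] := fP m ml.
rewrite big_split /=; congr (_ + _)%N; rewrite [in RHS]big_nat_recr //= ltnn addn0.
by apply: eq_big_nat => m /andP[_ ->].
Qed.

End Unitary.

(** * Orbits over the truncated rings *)

Section Dvr.
Variable A : idomainType.
Implicit Types (p x y : A).

Lemma dvr_uniformizer : is_dvr A -> exists p, uniformizer p.
Proof.
move=> [princ loc [x0 x0v x0n]]; have [p ep] := princ _ loc; exists p.
have ivP x : val_ideal A x <-> exists y, x = p * y.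
  by rewrite ep; split=> [[y _ <-]|[y ->]]; [exists y|exists y].
split.
- apply/eqP => p0; move: x0v x0n => /ivP[y ->]; by rewrite p0 mul0r eqxx.
- by have /ivP : exists y, p = p * y by exists 1; rewrite mulr1.
- by move=> x xn; apply/ivP.
Qed.

Variable p : A.
Hypothesis pP : uniformizer p.

Lemma val_idealP x : val_ideal A x <-> exists y, x = p * y.
Proof.
by rewrite /val_ideal /=; split=> [/(nunitP pP)|[y ->]] //; apply/(nunitP pP); exists y.
Qed.

Lemma ideal_expP k x : ideal_exp (val_ideal A) k x <-> cong p k x 0.
Proof.
elim: k x => [|k IH] x.
  by split=> // _; apply/cong0P; exists x; rewrite expr0 mul1r.
split=> [[n [a [b [ab ->]]]]|/cong0P[z ->]].
  apply: (big_ind (fun y => cong p k.+1 y 0)).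
  - exact: cong_refl.
  - by move=> y z hy hz; rewrite -[0]addr0; exact: congD.
  - move=> i _; have [/val_idealP[y ->] /IH/cong0P[z ->]] := ab i.
    by apply/cong0P; exists (y * z); rewrite exprS; ring.
exists 1%N, (fun=> p), (fun=> p ^+ k * z); split.
  move=> _; split; first by apply/val_idealP; exists 1; rewrite mulr1.
  by apply/IH/cong0P; exists z.
by rewrite big_ord1 exprS mulrA.
Qed.

Lemma cong_subr0 k x y : cong p k (x - y) 0 <-> cong p k x y.
Proof. by rewrite /cong subr0. Qed.

Lemma trunc_piE l x y : trunc_pi l x = trunc_pi l y <-> cong p l x y.
Proof.
have H : (x - y \in @val_pow A l) = (trunc_pi l x == trunc_pi l y).
  exact: Quotient.idealrBE.
split=> [/eqP|e]; first by rewrite -H => /asboolP/ideal_expP/cong_subr0.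
by apply/eqP; rewrite -H; apply/asboolP/ideal_expP/cong_subr0.
Qed.

Lemma trunc_piK l (x : trunc A l) : exists y, trunc_pi l y = x.
Proof. by exists (repr (x : Quotient.quot (@val_pow A l))); rewrite /trunc_pi reprK. Qed.

Lemma map_trunc_piE l (X Y : 'M[A]_3) :
  map_mx (@trunc_pi A l) X = map_mx (@trunc_pi A l) Y <-> mcong p l X Y.
Proof.
split=> [/matrixP h|/mcongP h].
  by apply/mcongP => i j; apply/trunc_piE; have := h i j; rewrite !mxE.
by apply/matrixP => i j; rewrite !mxE; apply/trunc_piE.
Qed.

Lemma map_trunc_piK l (Y : 'M[trunc A l]_3) : exists X, map_mx (@trunc_pi A l) X = Y.
Proof.
have /choice[f fP] (ij : 'I_3 * 'I_3) : exists x, trunc_pi l x = Y ij.1 ij.2.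
  exact: trunc_piK.
by exists (\matrix_(i, j) f (i, j)); apply/matrixP => i j; rewrite !mxE (fP (i, j)).
Qed.

Lemma nclasses_residue q : ([set: trunc A 1] #= `I_q)%card ->
  nclasses [set: A] (cong p 1) q.
Proof.
move=> /card_set_bijP[f [fI finj fsurj]].
have /choice[r rP] (i : 'I_q) : exists x, f (trunc_pi 1 x) = i.
  have [|t _ ft] := fsurj i; first exact: (ltn_ord i).
  by have [x ex] := trunc_piK t; exists x; rewrite ex.
exists 'I_q, r; rewrite card_ord; split=> // [i j /trunc_piE e|x _].
  by apply: val_inj; rewrite /= -(rP i) -(rP j) e.
have fx : (f (trunc_pi 1 x) < q)%N by exact: fI.
exists (Ordinal fx); apply/trunc_piE; apply: finj; rewrite ?inE // rP.
Qed.

Lemma residue_gt1 q : nclasses [set: A] (cong p 1) q -> (1 < q)%N.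
Proof.
move=> [I [r [<- _ rI rS]]]; have [i i0] := rS 0 Logic.I; have [j j1] := rS 1 Logic.I.
have ij : i != j.
  apply/eqP => ij; subst j; have := cong_trans j1 (cong_sym i0).
  by move=> /(cong1P pP); rewrite unitr1.
have := max_card (mem [set i; j]%SET); rewrite cards2 ij; exact.
Qed.

Lemma dvr_valuation : is_dvr A -> forall x, x != 0 ->
  exists k u, u \is a GRing.unit /\ x = p ^+ k * u.
Proof.
move=> dA x x0; pose I := [set y | forall k, cong p k y 0] : set A.
have II : is_ideal I.
  split=> [k|y z hy hz k|a y hy k]; first exact: cong_refl.
    by rewrite -[0]addr0; exact: congD.
  by rewrite -(mulr0 a); apply: congM; [exact: cong_refl|exact: hy].
have [a ea] := dvr_principal dA II.
have Ia : I a by rewrite ea; exists 1; rewrite ?mulr1.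
(* Krull's intersection argument: the intersection of the powers of p is generated by a, and a / p
   lies in it too, so a = p c a with 1 - p c a unit. *)
have a0 : a = 0.
  have /cong0P[b eb] := Ia 1%N; rewrite expr1 in eb.
  have : I b.
    move=> k; have /cong0P[c ec] := Ia k.+1; apply/cong0P; exists c.
    by apply: (mulfI (uniformizer_neq0 pP)); rewrite -eb ec exprS mulrA.
  rewrite ea => -[c _ ec]; rewrite -ec in eb.
  have /eqP : a * (1 - p * c) = 0 by rewrite mulrBr mulr1 {1}eb; ring.
  rewrite mulf_eq0 => /orP[/eqP//|/eqP e].
  have : 1 - p * c \is a GRing.unit.
    apply: (unitD_nunit pP (unitr1 _)); rewrite unitrN.
    exact/nunitMl/(uniformizer_nunit pP).
  by rewrite e unitr0.
have [k nk] : exists k, ~ cong p k x 0.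
  apply: contrapT => H; have : I x by move=> k; apply: contrapT => h; apply: H; exists k.
  by rewrite ea => -[c _]; rewrite a0 mul0r => e; rewrite -e eqxx in x0.
elim: k nk => [[]|k IH nk]; first by exists x; rewrite expr0 mul1r subr0.
have [/cong0P[u eu]|] := pselect (cong p k x 0); last exact: IH.
exists k, u; split=> //; apply: contrapT => /negP/(nunitP pP)[w ew]; apply: nk.
by apply/cong0P; exists w; rewrite eu ew exprSr mulrA.
Qed.

End Dvr.

Lemma card_range_fset (I : finType) (T : choiceType) (F : I -> T) : injective F ->
  #|` fset_set (range F)|%fset = #|I|.
Proof.
move=> Finj; rewrite (_ : range F = [set` [fset F i | i in I]%fset]).
  by rewrite set_fsetK card_imfset // cardE.
apply/seteqP; split=> [_ [i _ <-]|x /= /imfsetP[i _ ->]]; last by exists i.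
by apply/imfsetP; exists i.
Qed.

(** * Orbits on matrices modulo p^l as classes of lifts *)

Section OrbitCount.
Variables (A : idomainType) (p : A) (l : nat) (G : set 'M[A]_3).
Hypothesis pP : uniformizer p.
Hypothesis G_unit : forall g, G g -> g \in unitmx.
Hypothesis G_one : G 1%:M.
Hypothesis G_mul : forall g h, G g -> G h -> G (g *m h).
Hypothesis G_inv : forall g, G g -> G (invmx g).
Local Notation tr := (map_mx (@trunc_pi A l)).

Lemma adjoint_trunc g X : adjoint g (tr X) = tr (g *m X *m invmx g).
Proof. by rewrite /adjoint !map_mxM. Qed.

Lemma adjoint_mul g h (Y : 'M[trunc A l]_3) : G g -> G h ->
  adjoint g (adjoint h Y) = adjoint (g *m h) Y.
Proof.
move=> /G_unit gu /G_unit hu; rewrite /adjoint.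
have e : invmx (g *m h) = invmx h *m invmx g.
  have ghu : g *m h \in unitmx by rewrite unitmx_mul gu.
  by rewrite -[RHS]mulmx1 -(mulmxV ghu) !mulmxA mulmxKV // mulVmx // mul1mx.
by rewrite e !map_mxM !mulmxA.
Qed.

Lemma adjoint1 (Y : 'M[trunc A l]_3) : adjoint 1%:M Y = Y.
Proof.
have [X <-] := map_trunc_piK Y; rewrite adjoint_trunc mul1mx.
have e : invmx 1%:M = 1%:M :> 'M[A]_3 by rewrite -[LHS]mulmx1 mulVmx // unitmx1.
by rewrite e mulmx1.
Qed.

Lemma num_orbitsE (P : set 'M[A]_3) (R : 'M[A]_3 -> 'M[A]_3 -> Prop) n :
  nclasses P R n ->
  (forall X Y, P X -> P Y -> R X Y <-> exists2 g, G g & mcong p l (X *m g) (g *m Y)) ->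
  num_orbits G [set tr X | X in P] = n.
Proof.
move=> [I [r [<- rP rI rS]]] RG; pose orb (Y : 'M[trunc A l]_3) := [set adjoint g Y | g in G].
have orbE X Y : P X -> P Y -> orb (tr X) = orb (tr Y) <-> R X Y.
  move=> PX PY; rewrite (RG _ _ PX PY); split=> [e|[g Gg e]].
    have : orb (tr X) (tr X) by exists 1%:M => //; rewrite adjoint1.
    rewrite e => -[g Gg]; rewrite adjoint_trunc => /(map_trunc_piE pP) h; exists g => //.
    have := mcongMr g h; rewrite mulmxKV ?G_unit //; exact: mcong_sym.
  have eX : tr X = adjoint g (tr Y).
    rewrite adjoint_trunc; apply/(map_trunc_piE pP).
    by have := mcongMr (invmx g) e; rewrite mulmxK // G_unit.
  apply/seteqP; split=> _ [h Gh <-].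
    by rewrite eX adjoint_mul //; exists (h *m g) => //; exact: G_mul.
  have Gi := G_inv Gg; exists (h *m invmx g); first exact: G_mul.
  by rewrite eX adjoint_mul //; [rewrite mulmxKV ?G_unit|exact: G_mul].
rewrite /num_orbits (_ : adjoint_orbits _ _ = range (fun i => orb (tr (r i)))).
  apply: card_range_fset => i j e; apply: rI; apply/orbE => //; exact: rP.
apply/seteqP; split=> [_ [_ [X PX <-] <-]|_ [i _ <-]].
  have [i Xi] := rS X PX; exists i => //; apply/esym/orbE => //.
by exists (tr (r i)) => //; exists (r i) => //; exact: rP.
Qed.

End OrbitCount.

Lemma s_gl3E (o : idomainType) (p : o) l n : uniformizer p ->
  nclasses [set: 'M[o]_3] (sim p l) n -> s_gl3 o l = n.
Proof.
move=> pP Cn; rewrite /s_gl3 (_ : @gl3 o l = [set map_mx (@trunc_pi o l) X | X in setT]).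
  apply: (num_orbitsE pP _ _ _ _ Cn) => //.
  - by rewrite /GL3 /= unitmx1.
  - by move=> g h gu hu; rewrite /GL3 /= unitmx_mul; apply/andP.
  - by move=> g gu; rewrite /GL3 /= unitmx_inv.
apply/seteqP; split=> // Y _; have [X eX] := map_trunc_piK Y.
by exists X.
Qed.

Section UnitaryOrbits.
Variables (o O : idomainType) (iota : {rmorphism o -> O}) (sigma : {rmorphism O -> O}).
Variables (p : o) (eta : O).
Hypothesis ud : unitary_datum iota sigma p eta.
Local Notation pi := (iota p).
Let pE := ud_O ud.

Lemma sim_scale_unit k a X Y : a \is a GRing.unit ->
  sim pi k (a *: X) (a *: Y) <-> sim pi k X Y.
Proof.
have H b U V : sim pi k U V -> sim pi k (b *: U) (b *: V).
  by move=> [g gu e]; exists g => //; rewrite -scalemxAl -scalemxAr; exact: mcongZ.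
move=> au; split=> [/(H a^-1)|]; last exact: H.
by rewrite !scalerA mulVr // !scale1r.
Qed.

Lemma trunc_mapE l x : trunc_map sigma (trunc_pi l x) = trunc_pi l (sigma x).
Proof.
rewrite /trunc_map; apply/(trunc_piE pE)/(sigma_cong ud)/(trunc_piE pE).
by rewrite /trunc_pi reprK.
Qed.

Lemma star_trunc l (X : 'M[O]_3) : star (trunc_map sigma) (map_mx (@trunc_pi O l) X) =
  map_mx (@trunc_pi O l) (star sigma X).
Proof. by apply/matrixP => i j; rewrite !mxE trunc_mapE. Qed.

(** A lift of a matrix that is skew modulo p^l is made exactly skew by taking half its difference
    with its [star]; this changes it only by a multiple of p^l. *)
Lemma gu3_lift l : @gu3 O sigma l =
  [set map_mx (@trunc_pi O l) X | X in [set X | star sigma X = - X]].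
Proof.
apply/seteqP; split=> [Y|_ [X hX <-]]; rewrite /gu3 /=; last first.
  by rewrite star_trunc hX -map_mxD addNr map_mx0.
have [X <-] := map_trunc_piK Y; rewrite star_trunc -map_mxD.
rewrite -(map_mx0 (@trunc_pi O l)) => /(map_trunc_piE pE) h.
exists (inv2 O *: (X - star sigma X)).
  by rewrite /= starZ (sigma_inv2 ud) starD starN (starK ud) -scalerN opprB addrC.
apply/(map_trunc_piE pE).
have := mcongD (mcongZ (- inv2 O) h) (mcong_refl pi l X).
rewrite scaler0 add0r; congr (mcong _ _ _).
rewrite -{3}(half2m ud X) scaleNr -scalerN -scalerDr; congr (_ *: _).
by rewrite opprD addrACA addNr addr0 addrC.
Qed.

Lemma s_gu3E l n : nclasses (herm sigma) (sim pi l) n -> s_gu3 sigma l = n.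
Proof.
move=> Cn; rewrite /s_gu3 gu3_lift.
have eu := ud_eta_unit ud.
have hE X : star sigma X = - X <-> herm sigma (eta^-1 *: X).
  rewrite /herm starZ rmorphV // (ud_eta ud) invrN scaleNr; split=> [->|h].
    by rewrite scalerN opprK.
  have := congr1 (fun Z => eta *: Z) h; rewrite scalerN !scalerA mulrV // !scale1r => e.
  by rewrite -[in RHS]e opprK.
have C' : nclasses [set X | star sigma X = - X] (sim pi l) n.
  apply: (nclasses_map (equiv_sim pi l) (F := fun X => eta *: X) Cn).
  - by move=> X Y /(sim_scale_unit _ _ _ eu).
  - by move=> X Y _ _ /(sim_scale_unit _ _ _ eu).
  - move=> X hX; exists (eta *: X); last exact: sim_refl.
    by apply/hE; rewrite scalerA mulVr // scale1r.
  - move=> X /hE hX; exists (eta^-1 *: X) => //.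
    by rewrite scalerA mulrV // scale1r; exact: sim_refl.
apply: (num_orbitsE pE _ _ _ _ C').
- by move=> g [].
- by split; [exact: unitmx1|rewrite star1 mulmx1].
- move=> g h [gu ge] [hu he]; split; first by rewrite unitmx_mul gu.
  by rewrite starM -mulmxA (mulmxA (star _ g)) ge mul1mx.
- move=> g [gu ge]; split; first by rewrite unitmx_inv.
  rewrite (star_inv ud) //.
  have sgu : star sigma g \in unitmx by rewrite (star_unit ud).
  have e : invmx (star sigma g) = g by rewrite -[RHS]mul1mx -(mulVmx sgu) -mulmxA ge mulmx1.
  by rewrite e mulmxV.
move=> X Y hX hY; rewrite -(sim_scale_unit l X Y (_ : eta^-1 \is a GRing.unit)) ?unitrV //.
have hX' : herm sigma (eta^-1 *: X) by apply/hE.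
have hY' : herm sigma (eta^-1 *: Y) by apply/hE.
rewrite (herm_sim_unitary ud l hX' hY').
split=> -[g Gg e]; exists g => //.
  have := mcongZ eta e; rewrite scalemxAl scalemxAr !scalerA mulrV // !scale1r.
  by [].
by rewrite -scalemxAl -scalemxAr; exact: mcongZ.
Qed.

End UnitaryOrbits.

(** * The unitary datum of an unramified quadratic extension *)

Section UnramifiedDatum.
Variables (o O : idomainType) (iota : {rmorphism o -> O}) (sigma : {rmorphism O -> O}).
Variables (p : o) (q : nat).
Hypothesis pP : uniformizer p.
Hypothesis residue : nclasses [set: o] (cong p 1) q.
Hypothesis odd_char : odd_residue_char o.
Hypothesis unram : unramified_quadratic iota.
Hypothesis galois : nontrivial_galois iota sigma.

Lemma odd_char_unit2 : 2 \is a @GRing.unit o.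
Proof.
have [r [_ r0 ro]] := odd_char; apply: contraT => n2.
have rn : r%:R \isn't a @GRing.unit o.
  apply/(cong1P pP)/(trunc_piE pP); by rewrite rmorph_nat r0 rmorph0.
have : 1 \is a @GRing.unit o := unitr1 _.
have -> : 1 = r%:R + - (2 * (r./2)%:R) :> o.
  by rewrite -{1}(odd_double_half r) ro natrD -muln2 natrM -[true : nat]/1%N; ring.
apply: contraLR => _; apply: (nunitD pP rn); rewrite unitrN; exact: nunitMl.
Qed.

Lemma unram_uniformizer : uniformizer (iota p).
Proof.
have [[_ _ [x0 x0v x0n]] _ eI] := unram.
have ivP x : val_ideal O x <-> exists y, x = iota p * y.
  rewrite eI; split=> [[n [a [b [ab ->]]]]|[y ->]].
    apply: (big_ind (fun z => exists y, z = iota p * y)).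
    - by exists 0; rewrite mulr0.
    - by move=> _ _ [y ->] [z ->]; exists (y + z); rewrite mulrDr.
    - move=> i _; have [_ [c /(val_idealP pP)[d ->] <-]] := ab i.
      by exists (a i * iota d); rewrite rmorphM; ring.
  exists 1%N, (fun=> y), (fun=> iota p); split; last by rewrite big_ord1 mulrC.
  move=> _; split=> //; exists p => //; apply/(val_idealP pP).
  by exists 1; rewrite mulr1.
split.
- by apply/eqP => p0; move: x0v x0n => /ivP[y ->]; rewrite p0 mul0r eqxx.
- by have /ivP : exists y, iota p = iota p * y by exists 1; rewrite mulr1.
- by move=> x xn; apply/ivP.
Qed.

Definition comb (b0 b1 : O) (c : o * o) := iota c.1 * b0 + iota c.2 * b1.

Lemma unitary_datum_exists : exists eta, unitary_datum iota sigma p eta.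
Proof.
have [dO [b0 [b1 basis]] _] := unram; have [_ si [x sx]] := galois.
have pE := unram_uniformizer.
have u2 : 2 \is a @GRing.unit O by rewrite -(rmorph_nat iota) rmorph_unit // odd_char_unit2.
have combI v w : comb b0 b1 v = comb b0 b1 w -> v = w.
  by move=> e; have [c [_ cu]] := basis (comb b0 b1 v); rewrite -(cu v) // -(cu w).
have combS y : exists v, y = comb b0 b1 v by have [c [ec _]] := basis y; exists c.
have inj : injective iota.
  move=> y z e; suff [-> //] : (y, 0) = (z, 0) :> o * o.
  by apply: combI; rewrite /comb /= e.
have [[e0 e1] one] := combS 1.
(* Cayley-Hamilton for multiplication by z on the free module with basis b0, b1. *)
have quadr z : exists t n, z ^+ 2 = iota t * z - iota n.
  have [[p0 q0] h0] := combS (z * b0); have [[r0 s0] h1] := combS (z * b1).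
  exists (p0 + s0), (p0 * s0 - q0 * r0); rewrite /comb /= in h0 h1.
  apply/eqP; rewrite -subr_eq0; apply/eqP.
  set N := _ - _; rewrite -[N]mulr1 one /comb mulrDr !(mulrCA N).
  have N0 : N * b0 = 0.
    transitivity (z * (z * b0) - (iota p0 + iota s0) * (z * b0)
      + (iota p0 * iota s0 - iota q0 * iota r0) * b0).
      by rewrite /N !(rmorphD, rmorphN, rmorphM); ring.
    rewrite h0 mulrDr (mulrCA z) h0 (mulrCA z) h1; ring.
  have N1 : N * b1 = 0.
    transitivity (z * (z * b1) - (iota p0 + iota s0) * (z * b1)
      + (iota p0 * iota s0 - iota q0 * iota r0) * b1).
      by rewrite /N !(rmorphD, rmorphN, rmorphM); ring.
    rewrite h1 mulrDr (mulrCA z) h0 (mulrCA z) h1; ring.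
  by rewrite N0 N1 !mulr0 addr0.
have invol : involutive sigma.
  move=> z; have [e|nz] := eqVneq (sigma z) z; first by rewrite !e.
  have [t [n e]] := quadr z.
  have e' := congr1 sigma e; rewrite rmorphXn rmorphB rmorphM !si in e'.
  (* z and sigma z are distinct roots of one quadratic polynomial over o, so their sum is t. *)
  have st : sigma z = iota t - z.
    apply/eqP; rewrite -subr_eq0; have : (sigma z - z) * (sigma z - (iota t - z)) = 0.
      transitivity (sigma z ^+ 2 - z ^+ 2 - iota t * (sigma z - z)); first by ring.
      by rewrite e e'; ring.
    by move/eqP; rewrite mulf_eq0 !subr_eq0 (negPf nz).
  by rewrite {1}st rmorphB si st; ring.
have fixed z : sigma z = z -> exists y, z = iota y.
  move=> sz; have [[z0 z1] hz] := combS z; have [[x0 x1] hx] := combS x.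
  rewrite /comb /= in one hz hx.
  (* This determinant times x is an o-combination of z and 1, hence fixed by sigma, whereas x is
     moved. So z and 1 are proportional over o; since 1 = e0 b0 + e1 b1, one of e0, e1 is a unit. *)
  have D : iota (e0 * z1 - e1 * z0) = 0.
    have rel : iota (e0 * z1 - e1 * z0) * x =
        iota (e0 * x1 - e1 * x0) * z - iota (z0 * x1 - z1 * x0) * 1.
      rewrite hx hz one !(rmorphB, rmorphM); ring.
    rewrite mulr1 in rel.
    have := congr1 sigma rel; rewrite !(rmorphB, rmorphM) !si sz -!rmorphM -!rmorphB.
    rewrite -rel => /eqP; rewrite -subr_eq0 -mulrBr mulf_eq0 => /orP[/eqP//|].
    by rewrite subr_eq0 (negPf sx).
  rewrite rmorphB !rmorphM in D; move/eqP: D; rewrite subr_eq0 => /eqP D.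
  have ez0 : iota e0 * z = iota z0.
    by rewrite -[RHS]mulr1 one hz !mulrDr !mulrA D; ring.
  have ez1 : iota e1 * z = iota z1.
    by rewrite -[RHS]mulr1 one hz !mulrDr !mulrA -D; ring.
  have [u|n0] := boolP (e0 \is a GRing.unit).
    exists (e0^-1 * z0); rewrite rmorphM -ez0 mulrA -rmorphM mulVr //.
    by rewrite rmorph1 mul1r.
  have [u|n1] := boolP (e1 \is a GRing.unit).
    exists (e1^-1 * z1); rewrite rmorphM -ez1 mulrA -rmorphM mulVr //.
    by rewrite rmorph1 mul1r.
  have nu y : y \isn't a GRing.unit -> iota y \isn't a GRing.unit.
    move=> /(nunitP pP)[w ->]; rewrite rmorphM; apply: nunitMl.
    exact: uniformizer_nunit pE.
  have : 1 \isn't a @GRing.unit O.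
    by rewrite one; apply: (nunitD pE); apply: nunitMl; exact: nu.
  by rewrite unitr1.
(* sigma x - x changes sign under sigma; removing the power of p, which sigma fixes, leaves a unit
   with the same property. *)
have [|k [eta [etau eeta]]] := dvr_valuation pE dO (_ : sigma x - x != 0).
  by rewrite subr_eq0.
exists eta; split=> //.
- apply: (mulfI (expp_neq0 pE k)); rewrite -[in LHS](si p) -[in LHS]rmorphXn -rmorphM.
  by rewrite -eeta rmorphB invol mulrN -eeta opprB.
- move=> k'; exists (q ^ k' * q ^ k')%N.
  have C := nclasses_cong pP residue k'.
  apply: (nclasses_map (equiv_cong (iota p) k') (F := comb b0 b1) (nclassesX C C)).
  + move=> v w [h1 h2]; apply: congD; apply: congM; try exact: cong_refl; exact: cong_iota.
  + move=> v w _ _ [z e]; have [[z0 z1] ez] := combS z.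
    have /combI ev : comb b0 b1 v = comb b0 b1 (w.1 + p ^+ k' * z0, w.2 + p ^+ k' * z1).
      rewrite -[LHS](subrK (comb b0 b1 w)) e ez /comb /= !rmorphD !rmorphM !rmorphXn; ring.
    by rewrite ev; split; [exists z0|exists z1]; rewrite /=; ring.
  + by move=> v _; exists (comb b0 b1 v) => //; exact: cong_refl.
  + by move=> y _; have [v ->] := combS y; exists v => //; exact: cong_refl.
Qed.

End UnramifiedDatum.

(** * The Dirichlet series *)

Section ComplexSeries.
Variable R : realType.
Local Open Scope complex_scope.
Implicit Types (z w : R[i]).

Definition modulus z : R := Num.sqrt (complex.Re z ^+ 2 + complex.Im z ^+ 2).

Lemma normC_modulus z : `|z| = (modulus z)%:C.
Proof. exact: normc_def. Qed.

Lemma modulus_ge0 z : 0 <= modulus z.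
Proof. exact: sqrtr_ge0. Qed.

Lemma modulusM z w : modulus (z * w) = modulus z * modulus w.
Proof. by apply: complexI; rewrite rmorphM /= -!normC_modulus normrM. Qed.

Lemma modulusD z w : modulus (z + w) <= modulus z + modulus w.
Proof. by rewrite -lecR rmorphD /= -!normC_modulus ler_normD. Qed.

Lemma cvgC_modulus (u : nat -> R[i]^o) (l : R[i]^o) :
  u @ \oo --> l <-> (modulus (u n - l) @[n --> \oo] --> (0 : R)).
Proof.
split=> [/cvgrPdist_lt h|/cvgrPdist_lt h].
  apply/cvgrPdist_lt => e e0; have : 0 < e%:C :> R[i] by rewrite ltcR.
  move=> /h; apply: filterS => n; rewrite distrC normC_modulus ltcR.
  by rewrite sub0r normrN ger0_norm ?modulus_ge0.
apply/cvgrPdist_lt => e; rewrite ltcE /= => /andP[/eqP e1 e0].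
apply: filterS (h _ e0) => n; rewrite sub0r normrN ger0_norm ?modulus_ge0 // => h'.
rewrite distrC normC_modulus ltcE /= h' andbT -e1; exact/eqP.
Qed.

Lemma contraction_cvg0 (x d : nat -> R) (r : R) : 0 <= r < 1 -> (forall n, 0 <= x n) ->
  (forall n, x n.+1 <= r * x n + d n) -> d @ \oo --> (0 : R) -> x @ \oo --> (0 : R).
Proof.
move=> /andP[r0 r1] x0 xS /cvgrPdist_lt dl; apply/cvgrPdist_lt => e e0.
have r1' : 0 < 1 - r by rewrite subr_gt0.
(* e / 2 is the fixed point of y -> r y + e / 2 (1 - r), hence the constant term of the bound
   below. *)
have e1 : 0 < e / 2 * (1 - r) by rewrite mulr_gt0 // divr_gt0.
have [N _ dN] := dl _ e1.
have bnd k : x (N + k)%N <= r ^+ k * x N + e / 2.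
  elim: k => [|k IH]; first by rewrite addn0 expr0 mul1r lerDl ltW // divr_gt0.
  rewrite addnS; apply: (le_trans (xS _)).
  have dk : d (N + k)%N <= e / 2 * (1 - r).
    have := dN (N + k)%N (leq_addr _ _); rewrite /= sub0r normrN => /ltW.
    exact: le_trans (ler_norm _).
  apply: (le_trans (lerD (ler_wpM2l r0 IH) dk)).
  by rewrite exprS; lra.
have rk : (fun k => r ^+ k * x N) @ \oo --> (0 : R).
  rewrite -(mul0r (x N)); apply: cvgM; last exact: cvg_cst.
  by apply: cvg_expr; rewrite ger0_norm.
move/cvgrPdist_lt: rk => /(_ (e / 2)) []; first by rewrite divr_gt0.
move=> K _ rK; exists (N + K)%N => //= n /= Kn.
rewrite sub0r normrN ger0_norm //.
have -> : n = (N + (n - N))%N by lia.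
have := rK (n - N)%N; rewrite /= => /(_ ltac:(lia)).
rewrite sub0r normrN => /(le_lt_trans (ler_norm _)) h.
by apply: (le_lt_trans (bnd _)); lra.
Qed.

(** Divides a series by one linear factor. The partial sums satisfy S(n+1) = r S(n) + (partial sum
    of b), so their distance to B / (1 - r) contracts up to an error tending to 0. *)
Lemma series_recursion (f b : nat -> R[i]^o) (r B : R[i]) :
  f 0%N = b 0%N -> (forall n, f n.+1 = r * f n + b n.+1) -> modulus r < 1 ->
  series b @ \oo --> (B : R[i]^o) -> series f @ \oo --> (B / (1 - r) : R[i]^o).
Proof.
move=> f0 fS r1 /cvgC_modulus bB; apply/cvgC_modulus.
have r1n : 1 - r != 0.
  rewrite subr_eq0; apply/eqP => e; have : modulus (1 : R[i]) < 1 by rewrite e.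
  by rewrite /modulus /= expr1n expr0n addr0 sqrtr1 ltxx.
have S n : series f n.+1 = r * series f n + series b n.+1.
  elim: n => [|n IH].
    by rewrite /series /= !big_nat1 big_geq // f0 mulr0 add0r.
  by rewrite (seriesSr f n.+1) {1}IH fS (seriesSr f n) (seriesSr b n.+1); ring.
apply: (@contraction_cvg0 _ (fun n => modulus (series b n.+1 - B)) (modulus r)).
- by rewrite modulus_ge0.
- by move=> n; exact: modulus_ge0.
- move=> n; rewrite -modulusM; apply: le_trans (modulusD _ _).
  rewrite S (_ : _ - _ = r * (series f n - B / (1 - r)) + (series b n.+1 - B)) //.
  by field.
- by move: bB; rewrite -cvg_shiftS.
Qed.

Lemma series_finite (b : nat -> R[i]^o) N : (forall n, (N <= n)%N -> b n = 0) ->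
  series b @ \oo --> (\sum_(0 <= k < N) b k : R[i]^o).
Proof.
move=> b0; apply: (@cvg_near_cst _ _ _ _ _ _).
near=> n.
have Nn : (N <= n)%N by near: n; exact: nbhs_infty_ge.
rewrite /series /= (big_cat_nat _ Nn) //=.
have -> : \sum_(N <= k < n) b k = 0.
  by rewrite big_nat_cond big1 // => k /andP[/andP[Nk _] _]; exact: b0.
by rewrite addr0.
Unshelve. all: by end_near. Qed.

Lemma natpowCD (q : nat) z w : natpowC q (z + w) = natpowC q z * natpowC q w.
Proof.
case: z => a b; case: w => c d; rewrite /natpowC /=; apply/eqP; rewrite eq_complex /=.
rewrite !mulrDl expRD cosD sinD; apply/andP; split; apply/eqP; ring.
Qed.

Lemma natpowC0 (q : nat) : natpowC q (0 : R[i]) = 1.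
Proof. by rewrite /natpowC /= !mul0r expR0 cos0 sin0 mulr1 mulr0. Qed.

Lemma natpowC_natl (q n : nat) z : natpowC q (n%:R * z) = natpowC q z ^+ n.
Proof.
elim: n => [|n IH]; first by rewrite mul0r natpowC0 expr0.
by rewrite -natr1 mulrDl mul1r natpowCD IH exprSr.
Qed.

Lemma natpowC1 (q : nat) : (0 < q)%N -> natpowC q (1 : R[i]) = q%:R.
Proof.
move=> q0; rewrite /natpowC /= mul1r mul0r cos0 sin0 mulr1 mulr0 lnK ?posrE ?ltr0n //.
by rewrite -(rmorph_nat (real_complex R)).
Qed.

Lemma modulus_natpowC (q : nat) z : modulus (natpowC q z) = expR (complex.Re z * ln q%:R).
Proof.
rewrite /modulus /natpowC /= !exprMn -mulrDr cos2Dsin2 mulr1.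
by rewrite sqrtr_sqr ger0_norm // expR_ge0.
Qed.

Lemma zeta_series (a : nat -> nat) (q : nat) (s eps : R[i]) :
  (1 < q)%N -> 3 < complex.Re s -> a 0%N = 1%N ->
  (forall l, (a l.+1)%:R = q%:R * (a l)%:R + (q%:R ^+ (3 * l.+1)
    + (\sum_(m <- index_iota 1 l.+2) nsubs q l.+1 m)%:R
    + eps * (\sum_(m <- index_iota 1 l.+1) nduals q l.+1 m)%:R) :> R[i]) ->
  series (zeta_term a q s) @ \oo --> zeta_value eps q s.
Proof.
move=> q1 s3 a0 aS; have q0 : (0 < q)%N by exact: ltnW.
pose Q : R[i] := q%:R; pose t := natpowC q (- s).
have mt k : (k <= 3)%N -> modulus (Q ^+ k * t) < 1.
  move=> k3; rewrite /Q -natpowC1 // -natpowC_natl -natpowCD modulus_natpowC expR_lt1.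
  rewrite pmulr_llt0; last by rewrite ln_gt0 // ltr1n.
  have -> : complex.Re (k%:R * 1 + - s) = k%:R - complex.Re s.
    by rewrite mulr1 -(rmorph_nat (real_complex R)); case: (s).
  have : (k%:R : R) <= 3 by rewrite ler_nat.
  lra.
have pk k : natpowC q (k%:R - s) = Q ^+ k * t.
  by rewrite natpowCD -[k%:R]mulr1 natpowC_natl natpowC1.
have p1 : natpowC q (1 - s) = Q * t by rewrite -(pk 1%N).
have p22 : natpowC q (2 - 2 * s) = Q ^+ 2 * t ^+ 2.
  by rewrite -mulrN natpowCD -[2 in X in X * _]mulr1 !natpowC_natl natpowC1.
have zE l : zeta_term a q s l = (a l)%:R * t ^+ l.
  by rewrite /zeta_term -mulrN natpowC_natl.
pose T l := (\sum_(m <- index_iota 1 l.+1) nsubs q l m)%N.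
pose D l := (\sum_(m <- index_iota 1 l) nduals q l m)%N.
have TS l : T l.+1 = (q ^ 2 * (q ^ (3 * l) + T l))%N.
  (* Raising both l and m by 1 multiplies q^(3l-m) by q^2; the new first term m = 1 comes from m =
     0, whose value is q^(3l). *)
  have nS m : (m <= l)%N -> nsubs q l.+1 m.+1 = (q ^ 2 * nsubs q l m)%N.
    by move=> ml; rewrite /nsubs subSS -!expnD; congr expn; lia.
  rewrite /T big_add1 /= big_nat_recl // big_add1 /=.
  rewrite (eq_big_nat _ _ (F2 := fun m => q ^ 2 * nsubs q l m.+1)%N); last first.
    by move=> m /andP[_ ml]; rewrite nS.
  rewrite nS // -big_distrr -mulnDr /=; congr (_ * (_ + _))%N.
  by rewrite /nsubs subn0 expn0 mul1n -!expnD; congr expn; lia.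
have DS l : D l.+2 = (q ^ 2 * (q ^ (3 * l) + D l.+1))%N.
  (* The same shift; the index starts at l + 2 because the sum for [nduals] stops at m < l and is
     empty up to l = 1. *)
  have nS m : (m <= l)%N -> nduals q l.+2 m.+1 = (q ^ 2 * nduals q l.+1 m)%N.
    by move=> ml; rewrite /nduals subSS -!expnD; congr expn; lia.
  rewrite /D big_add1 /= big_nat_recl // big_add1 /=.
  rewrite (eq_big_nat _ _ (F2 := fun m => q ^ 2 * nduals q l.+1 m.+1)%N); last first.
    by move=> m /andP[_ ml]; rewrite nS.
  rewrite nS // -big_distrr -mulnDr /=; congr (_ * (_ + _))%N.
  by rewrite /nduals subn0 expn0 mul1n -!expnD; congr expn; rewrite /=; lia.
have T0 : T 0%N = 0%N by rewrite /T big_geq.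
have D0 : D 0%N = 0%N by rewrite /D big_geq.
have D1 : D 1%N = 0%N by rewrite /D big_geq.
(* V = (1 + eps q^2 t^2) / ((1 - q^2 t) (1 - q^3 t)) and U = (1 + eps q^2 t^2) / (1 - q^3 t)
   as generating functions. *)
pose V l : R[i] := Q ^+ (3 * l) + (T l)%:R + eps * (D l)%:R.
pose U l : R[i] := match l with 0%N => 1 | 1%N => Q ^+ 3
  | m.+2 => Q ^+ (3 * m + 6) + eps * Q ^+ (3 * m + 2) end.
pose b l : R[i] := if l is 0%N then 1 else if l == 2%N then eps * (Q ^+ 2 * t ^+ 2) else 0.
have VS l : V l.+1 = Q ^+ 2 * V l + U l.+1.
  case: l => [|l]; rewrite /V /U.
    by rewrite TS T0 D0 D1 muln0 !natrM natrD !natrX -/Q; ring.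
  rewrite !(TS l.+1) DS !natrM !natrD !natrX -/Q.
  have -> : (3 * l.+2 = 3 * l + 6)%N by lia.
  have -> : (3 * l.+1 = 3 * l + 3)%N by lia.
  rewrite !exprD; ring.
have US l : U l.+1 * t ^+ l.+1 = Q ^+ 3 * t * (U l * t ^+ l) + b l.+1.
  case: l => [|[|l]]; rewrite /U /b /=.
  - by ring.
  - by rewrite muln0 !add0n; ring.
  - have -> : (3 * l.+1 + 6 = 3 * l + 9)%N by lia.
    have -> : (3 * l.+1 + 2 = 3 * l + 5)%N by lia.
    by rewrite !exprD !exprS; ring.
have hb : series (b : nat -> R[i]^o) @ \oo --> (1 + eps * (Q ^+ 2 * t ^+ 2) : R[i]^o).
  have := @series_finite b 3; rewrite !big_nat_recr //= big_geq // !add0r addr0.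
  by apply=> -[|[|[|n]]].
(* The factors 1 - q^3 t, 1 - q^2 t and 1 - q t are divided out in turn, leading from b to U, to V,
   and to the orbit numbers. Re s > 3 makes even q^3 t smaller than 1 in modulus. *)
have e1 := @series_recursion (fun l => U l * t ^+ l) b (Q ^+ 3 * t) _ _ US (mt 3 isT) hb.
have e2 := @series_recursion (fun l => V l * t ^+ l) _ (Q ^+ 2 * t) _ _ _ (mt 2 isT) (e1 _).
have e3 := @series_recursion (zeta_term a q s) _ (Q ^+ 1 * t) _ _ _ (mt 1%N isT) (e2 _ _ _).
rewrite /zeta_value p1 p22 !pk.
have -> : (1 + eps * (Q ^+ 2 * t ^+ 2)) / ((1 - Q * t) * (1 - Q ^+ 2 * t) * (1 - Q ^+ 3 * t)) =
    (1 + eps * (Q ^+ 2 * t ^+ 2)) / (1 - Q ^+ 3 * t) / (1 - Q ^+ 2 * t) / (1 - Q ^+ 1 * t).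
  by rewrite !invfM expr1; ring.
apply: e3 => //.
- by rewrite zE a0 /V T0 D0 muln0 !expr0; ring.
- by move=> l; rewrite !zE aS -/(T l.+1) -/(D l.+1) -/Q -/(V l.+1) (exprS t); ring.
- by rewrite /V T0 D0 /U muln0 !expr0; ring.
- by move=> l; rewrite VS (exprS t); ring.
- by rewrite /U /b expr0 mulr1.
Qed.

End ComplexSeries.

Lemma nclasses_sim0 (E : idomainType) (p : E) (P : set 'M[E]_3) X :
  P X -> nclasses P (sim p 0) 1.
Proof.
move=> PX; exists unit, (fun=> X); rewrite card_unit; split=> // [[] []//|Y _].
by exists tt; apply: mcong_sim; exact: mcong0.
Qed.

(** * The two zeta functions and the theorem *)

Section Recursions.
Variables (R : realType) (o : idomainType) (p : o) (q : nat).
Hypothesis pP : uniformizer p.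
Hypothesis residue : nclasses [set: o] (cong p 1) q.
Local Open Scope complex_scope.

Lemma nclasses_GL l : nclasses [set: 'M[o]_3] (sim p l) (s_gl3 o l).
Proof.
suff [n Cn] : exists n, nclasses [set: 'M[o]_3] (sim p l) n by rewrite (s_gl3E pP Cn).
elim: l => [|l [n Cn]]; first by exists 1%N; exact: (@nclasses_sim0 _ _ _ 0).
by eexists; exact: (count_GL pP residue Cn).
Qed.

Lemma s_gl3_zeta (s : R[i]) : 3 < complex.Re s ->
  series (zeta_term (s_gl3 o) q s) @ \oo --> zeta_value 1 q s.
Proof.
move=> s3; apply: zeta_series => //; first exact: residue_gt1 residue.
  exact: (s_gl3E pP (@nclasses_sim0 _ _ _ 0 Logic.I)).
move=> l; rewrite (s_gl3E pP (count_GL pP residue (nclasses_GL l))).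
rewrite natrD natrM !natrD -!expnD natrX mul1r !addrA.
by have -> : (l.+1 + l.+1 + l.+1 = 3 * l.+1)%N by lia.
Qed.

Variables (O : idomainType) (iota : {rmorphism o -> O}) (sigma : {rmorphism O -> O}).
Variable eta : O.
Hypothesis ud : unitary_datum iota sigma p eta.

Lemma nclasses_GU l : nclasses (herm sigma) (sim (iota p) l) (s_gu3 sigma l).
Proof.
suff [n Cn] : exists n, nclasses (herm sigma) (sim (iota p) l) n by rewrite (s_gu3E ud Cn).
elim: l => [|l [n Cn]]; last by have [N CN _] := count_herm ud residue Cn; exists N.
by exists 1%N; apply: (@nclasses_sim0 _ _ _ 1%:M); exact: star1.
Qed.

Lemma s_gu3_zeta (s : R[i]) : 3 < complex.Re s ->
  series (zeta_term (s_gu3 sigma) q s) @ \oo --> zeta_value (-1) q s.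
Proof.
move=> s3; apply: zeta_series => //; first exact: residue_gt1 residue.
  by apply: (s_gu3E ud); apply: (@nclasses_sim0 _ _ _ 1%:M); exact: star1.
move=> l; have [N CN eN] := count_herm ud residue (nclasses_GU l).
rewrite (s_gu3E ud CN); apply: (addIr (\sum_(m <- index_iota 1 l.+1) nduals q l.+1 m)%:R).
rewrite -natrD eN natrD natrM !natrD -!expnD natrX.
have -> : (l.+1 + l.+1 + l.+1 = 3 * l.+1)%N by lia.
by ring.
Qed.

End Recursions.

Theorem theoremE (R : realType) (o : idomainType) (q : nat) (s : R[i]%C)
    (o_cdvr : is_compact_dvr o)
    (card_residue : ([set: trunc o 1] #= `I_q)%card)
    (Re_s : 3 < complex.Re s) :
  (series (zeta_term (s_gl3 o) q s) @ \oo --> zeta_value 1 q s)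
  /\
  (odd_residue_char o ->
   forall (O : idomainType) (iota : {rmorphism o -> O})
          (sigma : {rmorphism O -> O}),
     unramified_quadratic iota -> nontrivial_galois iota sigma ->
     series (zeta_term (s_gu3 sigma) q s) @ \oo --> zeta_value (-1) q s).
Proof.
have [p pP] := dvr_uniformizer o_cdvr.1.
have residue := nclasses_residue pP card_residue.
split=> [|odd O iota sigma unram galois]; first exact: (s_gl3_zeta pP residue Re_s).
have [eta ud] := unitary_datum_exists pP residue odd unram galois.
exact: (s_gu3_zeta pP residue ud Re_s).
Qed.
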